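(* In the proportional likelihood ratio model, the efficient score $S_{\mathrm{eff}}(Y,X)$ for $\beta$ at the truth $(\beta_0,g_0,\eta_0)$ equals $$XY-E(XY\mid X)-\sum_{j=0}^\infty\left[\mathcal{B}^j\mathcal{K}(XY)-E\{\mathcal{B}^j\mathcal{K}(XY)\mid X\}\right].$$
   Context: Model. $Y$ is a real-valued response and $X$ is an $\mathbb{R}^q$-valued covariate. The proportional likelihood ratio model is the set $\mathcal{P}$ of joint densities $$p_{Y,X}\{y,x;\beta,g(\cdot),\eta(\cdot)\}=\frac{\exp(\beta^T x y)\,g(y)}{\int \exp(\beta^T x y)\,dG(y)}\,\eta(x),$$ where $\beta\in\mathbb{R}^q$ is the parameter of interest, $g$ is a density with respect to a dominating measure $\nu$ with distribution function $G$ (the conditional distribution of $Y$ given $X=0$), and $\eta$ is the density of $X$ with respect to some dominating measure; $g$ and $\eta$ are unrestricted infinite-dimensional nuisance parameters. True values are $\beta_0,g_0,\eta_0$; all expectations and conditional expectations are taken under the true distribution. The standard smoothness and regularity conditions of semiparametric theory are assumed throughout for the model and for parametric submodels (e.g. mean-square differentiability of the root density with respect to the finite-dimensional parameter, finite-variance scores, nonsingular information). Hilbert space. $\mathcal{H}$ is the Hilbert space of all $q$-dimensional (measurable) random functions $a(Y,X)$ with $E\{a(Y,X)\}=0$ and finite variance, with inner product $\langle a_1,a_2\rangle=E(a_1^Ta_2)$; infinite series are understood in the norm of $\mathcal{H}$. Nuisance tangent space. A nuisance parametric submodel is a pair of smooth families $g(\cdot;\gamma),\eta(\cdot;\gamma)$,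 $\gamma\in\mathbb{R}^r$, of densities with $g(\cdot;\gamma_0)=g_0$, $\eta(\cdot;\gamma_0)=\eta_0$ for some $\gamma_0$; its nuisance score is $S_\gamma(y,x)=\partial_\gamma\log p_{Y,X}\{y,x;\beta_0,g(\cdot;\gamma),\eta(\cdot;\gamma)\}|_{\gamma=\gamma_0}$. $\Lambda\subset\mathcal{H}$ is the mean-square closure of the set of all elements $C\,S_\gamma(Y,X)$ over all such submodels and all constant $q\times r$ matrices $C$; $\Lambda^\perp$ is its orthogonal complement in $\mathcal{H}$. Scores. $S_\beta(Y,X)$ is the derivative of $\log p_{Y,X}\{y,x;\beta,g_0(\cdot),\eta_0(\cdot)\}$ with respect to $\beta$ at $\beta_0$, evaluated at $(Y,X)$. The efficient score $S_{\mathrm{eff}}(Y,X)$ is the orthogonal projection in $\mathcal{H}$ of $S_\beta(Y,X)$ on $\Lambda^\perp$. Operators. $\mathcal{K}\{a(Y,X)\}=E\{a(Y,X)\mid Y\}-E[E\{a(Y,X)\mid X\}\mid Y]$; $\mathcal{B}\{f(Y)\}=E[E\{f(Y)\mid X\}\mid Y]$; $\mathcal{B}^0$ is the identity. *)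

(* Defs.v *)
From HB Require Import structures.
From mathcomp Require Import all_boot all_order all_algebra.
From mathcomp Require Import all_classical all_reals all_analysis.

Set Implicit Arguments.
Unset Strict Implicit.
Unset Printing Implicit Defensive.
Import Order.TTheory GRing.Theory Num.Theory.
Import numFieldNormedType.Exports.
Local Open Scope classical_set_scope.
Local Open Scope ring_scope.

Definition dot (R : realType) (q : nat) (u v : 'rV[R]_q) : R := (u *m v^T) 0 0.

Section Hilbert.
Context (R : realType) (d : measure_display) (T : measurableType d).
Variables (P : probability T R) (q : nat).
Implicit Types a b s : T -> 'rV[R]_q.

(* Elements are functions; equality in the Hilbert space is equality P-a.e. *)
Definition Hspace : set (T -> 'rV[R]_q) :=
  [set a | forall i : 'I_q, (fun z => a z 0 i) \in Lfun P 2%:E /\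
                            \int[P]_z a z 0 i = 0].

Definition Hinner a b : R := \int[P]_z dot (a z) (b z).

Definition Hclosure (A : set (T -> 'rV[R]_q)) : set (T -> 'rV[R]_q) :=
  [set a | Hspace a /\
    forall e : R, 0 < e -> exists2 b, A b & Hinner (a - b) (a - b) < e].

Definition Horth (A : set (T -> 'rV[R]_q)) : set (T -> 'rV[R]_q) :=
  [set a | Hspace a /\ forall b, A b -> Hinner a b = 0].

Definition is_Hproj (M : set (T -> 'rV[R]_q)) a s : Prop :=
  M s /\ forall b, M b -> Hinner (a - s) b = 0.

Definition is_Hsum (u : nat -> T -> 'rV[R]_q) s : Prop :=
  [/\ forall j, Hspace (u j), Hspace s &
      (fun n => Hinner (series u n - s) (series u n - s)) @ \oo --> (0 : R)].

Section CondExp.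
Context (d' : measure_display) (V : measurableType d').

Definition is_condexp (W : T -> V) (f : T -> R) (h : V -> R) : Prop :=
  [/\ f \in Lfun P 1, measurable_fun setT h, h \o W \in Lfun P 1 &
      forall A : set V, measurable A ->
        \int[P]_(z in W @^-1` A) h (W z) = \int[P]_(z in W @^-1` A) f z].

(* A chosen version of E(f | W), as a random variable; it is the zero function
   when f is not integrable. *)
Definition condexp (W : T -> V) (f : T -> R) : T -> R :=
  xget (cst 0) [set h | is_condexp W f h] \o W.

Definition vcondexp (W : T -> V) (a : T -> 'rV[R]_q) : T -> 'rV[R]_q :=
  fun z => \row_i condexp W (fun z' => a z' 0 i) z.

End CondExp.
End Hilbert.

Section Regular.
Context (R : realType) (d : measure_display) (T : measurableType d).

(* The family of densities p t with respect to m is regular at t0, with score S,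
   P being the distribution with density p t0.  Demanding 0 < p t z for t near
   t0 makes the (total) function ln a genuine logarithm there.  The score is
   determined only P-a.e., hence it is a parameter.  The third field is
   mean-square differentiability of the root density at t0. *)
Record regular_family (m : {measure set T -> \bar R}) (P : probability T R)
    (r : nat) (p : 'rV[R]_r -> T -> R) (t0 : 'rV[R]_r) (S : T -> 'rV[R]_r)
    : Prop := RegularFamily {
  regular_score : {ae P, forall z,
    [/\ \forall t \near t0, 0 < p t z,
        differentiable (fun t => ln (p t z)) t0 &
        S z = \row_i 'D_(delta_mx 0 i) (fun t => ln (p t z)) t0]};
  regular_variance : forall i : 'I_r, (fun z => S z 0 i) \in Lfun P 2%:E;
  regular_qmd : forall e : R, 0 < e -> \forall t \near t0,
    (\int[m]_z ((Num.sqrt (p t z) - Num.sqrt (p t0 z)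
       - 2^-1 * dot (t - t0) (S z) * Num.sqrt (p t0 z)) ^+ 2)%:E
     <= (e * `|t - t0| ^+ 2)%:E)%E;
  regular_info : (\matrix_(i, j) \int[P]_z (S z 0 i * S z 0 j)) \in unitmx
}.

Definition is_density (m : {measure set T -> \bar R}) (f : T -> R) : Prop :=
  [/\ measurable_fun setT f, forall x, 0 <= f x & (\int[m]_x (f x)%:E = 1)%E].

End Regular.

Section Model.
Context (R : realType) (q : nat).

Notation RY := (measurableTypeR R).
Notation RX := (q.-tuple (measurableTypeR R)).

(* R^q is q.-tuple R, which carries the product sigma-algebra. *)
Definition vec (x : RX) : 'rV[R]_q := \row_i tnth x i.

Variables (nu : {sigma_finite_measure set RY -> \bar R})
          (mu : {sigma_finite_measure set RX -> \bar R}).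

Definition plr_norm (b : 'rV[R]_q) (g : RY -> R) (x : RX) : \bar R :=
  (\int[nu]_y (expR (dot b (vec x) * y) * g y)%:E)%E.

(* Where plr_norm is +oo the quotient is 0 by convention; plr_model excludes
   this mu-a.e. on the support of eta. *)
Definition plr_density (b : 'rV[R]_q) (g : RY -> R) (eta : RX -> R)
    (z : RY * RX) : R :=
  expR (dot b (vec z.2) * z.1) * g z.1 / fine (plr_norm b g z.2) * eta z.2.

Definition plr_model (b : 'rV[R]_q) (g : RY -> R) (eta : RX -> R) : Prop :=
  [/\ is_density nu g, is_density mu eta &
      {ae mu, forall x, 0 < eta x -> (plr_norm b g x < +oo)%E}].

Variable P : probability (RY * RX)%type R.

Definition has_plr_law (b : 'rV[R]_q) (g : RY -> R) (eta : RX -> R) : Prop :=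
  plr_model b g eta /\
  forall A, measurable A ->
    (P A = \int[nu \x mu]_(z in A) (plr_density b g eta z)%:E)%E.

Definition is_beta_score (b0 : 'rV[R]_q) (g0 : RY -> R) (eta0 : RX -> R)
    (S : RY * RX -> 'rV[R]_q) : Prop :=
  regular_family (nu \x mu)%E P (fun b => plr_density b g0 eta0) b0 S.

Definition nuisance_submodel (b0 : 'rV[R]_q) (g0 : RY -> R) (eta0 : RX -> R)
    (r : nat) (g : 'rV[R]_r -> RY -> R) (eta : 'rV[R]_r -> RX -> R)
    (c0 : 'rV[R]_r) (S : RY * RX -> 'rV[R]_r) : Prop :=
  [/\ forall c, plr_model b0 (g c) (eta c), g c0 = g0, eta c0 = eta0 &
      regular_family (nu \x mu)%E P (fun c => plr_density b0 (g c) (eta c))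
        c0 S].

(* Random vectors are rows, so that C S_gamma is written S *m C^T. *)
Definition nuisance_scores (b0 : 'rV[R]_q) (g0 : RY -> R) (eta0 : RX -> R) :
    set (RY * RX -> 'rV[R]_q) :=
  [set a | exists r g eta c0 (S : RY * RX -> 'rV[R]_r) (C : 'M[R]_(q, r)),
    nuisance_submodel b0 g0 eta0 g eta c0 S /\ a = (fun z => S z *m C^T)].

Definition nuisance_tangent_space b0 g0 eta0 : set (RY * RX -> 'rV[R]_q) :=
  Hclosure P (nuisance_scores b0 g0 eta0).

Definition is_efficient_score b0 g0 eta0 (Sbeta Seff : RY * RX -> 'rV[R]_q) :
    Prop :=
  is_Hproj P (Horth P (nuisance_tangent_space b0 g0 eta0)) Sbeta Seff.

Definition condY (a : RY * RX -> 'rV[R]_q) : RY * RX -> 'rV[R]_q :=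
  vcondexp P fst a.

Definition condX (a : RY * RX -> 'rV[R]_q) : RY * RX -> 'rV[R]_q :=
  vcondexp P snd a.

Definition opK (a : RY * RX -> 'rV[R]_q) : RY * RX -> 'rV[R]_q :=
  condY a - condY (condX a).

Definition opB (f : RY * RX -> 'rV[R]_q) : RY * RX -> 'rV[R]_q :=
  condY (condX f).

Definition XY : RY * RX -> 'rV[R]_q := fun z => z.1 *: vec z.2.

Definition series_term (j : nat) : RY * RX -> 'rV[R]_q :=
  iter j opB (opK XY) - condX (iter j opB (opK XY)).

End Model.

(* Main.v *)
(* Write E_X, E_Y for the conditional expectations given X and Y, both orthogonal
   projections of L2.  The score is S_beta = XY - E(XY|X) =: s, so E_X s = 0 and
   K(XY) = E_Y s; with a_0 = s and a_(n+1) = (1 - E_X)(1 - E_Y) a_n one finds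
   E_Y a_n = B^n K(XY), and a_n is s minus the n-th partial sum of the series.
   Moreover <a_m, a_n> depends only on m + n and decreases, so (a_n) is Cauchy
   (von Neumann's alternating projections); its limit F satisfies
   E_X F = E_Y F = 0, and s - F is orthogonal to every function with these two
   properties.  It remains to see that the orthocomplement of the tangent space
   consists of exactly these functions.  On the one hand the score of a nuisance
   submodel is a.e. of the form u(Y) + v(X); u and v need not be integrable, but
   truncating both at the same level does not increase |u + v|.  On the other hand
   bounded perturbations of g and eta have scores f(Y) + h(X) - E(f(Y)|X) with
   arbitrary bounded centred f and h. *)

Require Import Defs.
From HB Require Import structures.
From mathcomp Require Import all_boot all_order all_algebra.
From mathcomp Require Import all_classical all_reals all_analysis.
From mathcomp Require Import measurable_realfun ring lra.
Set Implicit Arguments.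
Unset Strict Implicit.
Unset Printing Implicit Defensive.
Import Order.TTheory GRing.Theory Num.Theory.
Import numFieldNormedType.Exports.
Local Open Scope classical_set_scope.
Local Open Scope ring_scope.

(** * Square-integrable functions *)

Section L2.
Context (R : realType) (d : measure_display) (T : measurableType d).
Variable P : probability T R.
Implicit Types f g h : T -> R.

(** Elements of the Hilbert space are functions and conditional expectations are chosen versions, so
    projections are handled through inner products, and almost-everywhere statements are drawn from
    them only where required. [XY] is assumed integrable, not square integrable. Hence the
    projections of L2 cannot be applied to it directly: what starts the iteration is the residual s,
    which lies in L2 because it agrees almost everywhere with the score. No gap between the two
    projections is assumed, so there is no geometric rate; convergence has to come from
    monotonicity. The additive form of a nuisance score comes from the mixed second difference of
    the log-density over (y, x), (y0, x0), (y, x0), (y0, x): every term in one variable alone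
    cancels, the normalising constant included, and the remainder is free of the nuisance parameter.
    The base point (y0, x0) must be such that the score is regular almost everywhere along the two
    lines through it; the positivity set of the density, being a rectangle, provides one. *)

Definition L2dot f g : R := \int[P]_z (f z * g z).

Lemma Lfun_measurable (p : \bar R) f : f \in Lfun P p -> measurable_fun setT f.
Proof. by move/sub_Lfun_mfun; rewrite inE. Qed.

Lemma Lfun1P f : f \in Lfun P 1 <-> P.-integrable setT (EFin \o f).
Proof. exact: Lfun1_integrable. Qed.

Lemma Lfun2P f : f \in Lfun P 2%:E <->
  measurable_fun setT f /\ (\int[P]_z (f z ^+ 2)%:E < +oo)%E.
Proof.
split=> [f2|[mf If]].
  split; first exact: Lfun_measurable f2.
  have /integrableP[_] := Lfun2_integrable_sqr f2.
  by under eq_integral => z _ do rewrite /= ger0_norm ?sqr_ge0//.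
rewrite inE; apply/andP; split; rewrite inE//= /finite_norm unlock.
rewrite poweR_lty//; apply: le_lt_trans If.
rewrite le_eqVlt; apply/orP; left; apply/eqP; apply: eq_integral => z _.
by rewrite /= (powR_mulrn 2)// real_normK ?num_real.
Qed.

Lemma Lfun12 f : f \in Lfun P 2%:E -> f \in Lfun P 1.
Proof. by apply: Lfun_subset12; exact: fin_num_measure. Qed.

Lemma Lfun2D f g : f \in Lfun P 2%:E -> g \in Lfun P 2%:E ->
  (fun z => f z + g z) \in Lfun P 2%:E.
Proof.
move=> f2 g2; have [_ /(_ 1 f g f2 g2)] := Lfun_submod_closed P (lee1n 2).
by rewrite scale1r.
Qed.

Lemma Lfun2Z (a : R) f : f \in Lfun P 2%:E -> (fun z => a * f z) \in Lfun P 2%:E.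
Proof.
move=> f2; have [z0 /(_ a f _ f2 z0)] := Lfun_submod_closed P (lee1n 2).
by rewrite addr0.
Qed.

Lemma Lfun2B f g : f \in Lfun P 2%:E -> g \in Lfun P 2%:E ->
  (fun z => f z - g z) \in Lfun P 2%:E.
Proof.
move=> f2 g2; rewrite (_ : (fun z => _) = (fun z => f z + -1 * g z)).
  exact: Lfun2D f2 (Lfun2Z (-1) g2).
by apply/funext => z; rewrite mulN1r.
Qed.

Lemma Lfun2_bounded f (M : R) : measurable_fun setT f ->
  (forall z, `|f z| <= M) -> f \in Lfun P 2%:E.
Proof.
move=> mf fM; apply/Lfun2P; split=> //.
apply: (@le_lt_trans _ _ (\int[P]_z (cst (M ^+ 2)%:E z))%E); last first.
  by rewrite integral_cst//= probability_setT mule1 ltry.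
apply: ge0_le_integral => //.
- by move=> z _; rewrite lee_fin sqr_ge0.
- by apply/measurable_EFinP; exact: measurable_funX.
- by move=> z _; rewrite lee_fin -[leLHS]real_normK ?num_real// lerXn2r ?nnegrE// (le_trans _ (fM z)).
Qed.

Lemma L2dot_integrable f g : f \in Lfun P 2%:E -> g \in Lfun P 2%:E ->
  P.-integrable setT (EFin \o (fun z => f z * g z)).
Proof. by move=> f2 g2; apply/Lfun1P; exact: Lfun2_mul_Lfun1. Qed.

Lemma L2dotC f g : L2dot f g = L2dot g f.
Proof. by apply: eq_Rintegral => z _; rewrite mulrC. Qed.

Lemma L2dotDl f g h : f \in Lfun P 2%:E -> g \in Lfun P 2%:E ->
  h \in Lfun P 2%:E -> L2dot (fun z => f z + g z) h = L2dot f h + L2dot g h.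
Proof.
move=> f2 g2 h2; rewrite /L2dot -RintegralD//; try exact: L2dot_integrable.
by apply: eq_Rintegral => z _; rewrite mulrDl.
Qed.

Lemma L2dotZl a f h : f \in Lfun P 2%:E ->
  h \in Lfun P 2%:E -> L2dot (fun z => a * f z) h = a * L2dot f h.
Proof.
move=> f2 h2; rewrite /L2dot -RintegralZl//; try exact: L2dot_integrable.
by apply: eq_Rintegral => z _; rewrite mulrA.
Qed.

Lemma L2dotBl f g h : f \in Lfun P 2%:E -> g \in Lfun P 2%:E ->
  h \in Lfun P 2%:E -> L2dot (fun z => f z - g z) h = L2dot f h - L2dot g h.
Proof.
move=> f2 g2 h2; rewrite /L2dot -RintegralB//; try exact: L2dot_integrable.
by apply: eq_Rintegral => z _; rewrite mulrBl.
Qed.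

Lemma L2dotBr f g h : f \in Lfun P 2%:E -> g \in Lfun P 2%:E ->
  h \in Lfun P 2%:E -> L2dot h (fun z => f z - g z) = L2dot h f - L2dot h g.
Proof. by move=> f2 g2 h2; rewrite L2dotC L2dotBl// ![L2dot h _]L2dotC. Qed.

Lemma L2dot_ge0 f : 0 <= L2dot f f.
Proof. by apply: Rintegral_ge0 => z _; rewrite -expr2 sqr_ge0. Qed.

Lemma L2dotE f : f \in Lfun P 2%:E -> (L2dot f f)%:E = (\int[P]_z (f z ^+ 2)%:E)%E.
Proof.
move=> f2; rewrite /L2dot /Rintegral fineK; last first.
  apply: integrable_fin_num => //; exact: L2dot_integrable.
by apply: eq_integral => z _; rewrite expr2.
Qed.

Lemma L2dot_CS f g : f \in Lfun P 2%:E -> g \in Lfun P 2%:E ->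
  L2dot f g ^+ 2 <= L2dot f f * L2dot g g.
Proof.
move=> f2 g2.
have H t : 0 <= L2dot f f - 2 * t * L2dot f g + t ^+ 2 * L2dot g g.
  have tg2 := Lfun2Z t g2.
  have := L2dot_ge0 (fun z => f z - t * g z).
  rewrite L2dotBl ?L2dotBr ?L2dotZl ?Lfun2B//.
  rewrite (L2dotC f (fun z => t * g z)) (L2dotC g (fun z => t * g z)) !L2dotZl// (L2dotC g f) => h.
  by apply: (le_trans h); rewrite le_eqVlt; apply/orP; left; apply/eqP; ring.
have := L2dot_ge0 g; rewrite le_eqVlt => /orP[/eqP g0|g0].
  rewrite -g0 mulr0.
  have [->|fg0] := eqVneq (L2dot f g) 0; first by rewrite expr0n.
  (* The bound is affine in t here; this t makes it equal to -1. *)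
  have := H ((L2dot f f + 1) / (2 * L2dot f g)).
  rewrite -g0 mulr0 addr0.
  have -> : 2 * ((L2dot f f + 1) / (2 * L2dot f g)) * L2dot f g = L2dot f f + 1.
    by field.
  by move=> h; exfalso; lra.
have := H (L2dot f g / L2dot g g); rewrite -(pmulr_rge0 _ g0).
have -> : L2dot g g * (L2dot f f - 2 * (L2dot f g / L2dot g g) * L2dot f g +
    (L2dot f g / L2dot g g) ^+ 2 * L2dot g g) =
    L2dot f f * L2dot g g - L2dot f g ^+ 2 by field; rewrite gt_eqF.
by rewrite subr_ge0.
Qed.

Lemma L2dot_eq0 f : f \in Lfun P 2%:E -> L2dot f f = 0 -> {ae P, forall z, f z = 0}.
Proof.
move=> f2 f0; have mf := Lfun_measurable f2.
have : (\int[P]_z `|(f z ^+ 2)%:E| = 0)%E.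
  by under eq_integral do rewrite gee0_abs ?lee_fin ?sqr_ge0//; rewrite -L2dotE// f0.
move/ae_eq_integral_abs => /(_ measurableT).
have mf2 : measurable_fun setT (fun z => (f z ^+ 2)%:E).
  by apply/measurable_EFinP; exact: measurable_funX.
move=> /(_ mf2); apply: filterS => z /(_ I) [] /eqP.
by rewrite sqrf_eq0 => /eqP.
Qed.

Lemma L2dot_ae f g h : measurable_fun setT f -> measurable_fun setT g ->
  measurable_fun setT h -> {ae P, forall z, f z = g z} -> L2dot f h = L2dot g h.
Proof.
move=> mf mg mh fg; rewrite /L2dot /Rintegral; congr fine.
apply: ae_eq_integral => //.
- by apply/measurable_EFinP; exact: measurable_funM.
- by apply/measurable_EFinP; exact: measurable_funM.
- by apply: filterS fg => z /= -> _.
Qed.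

End L2.

(** * Completeness of L2 *)

Section L2_complete.
Context (R : realType) (d : measure_display) (T : measurableType d).
Variable P : probability T R.

Lemma Rintegral_probability_cst (c : R) : \int[P]_z c = c.
Proof.
rewrite -[RHS]mulr1 Rintegral_cst//; congr (_ * _).
exact: (congr1 fine (probability_setT P)).
Qed.

Lemma le_limn_einf_cst (v : (\bar R)^nat) (c : \bar R) :
  (forall n, (v n <= c)%E) -> (limn_einf v <= c)%E.
Proof.
move=> vc; rewrite limn_einf_lim; apply: lime_le; first exact: is_cvg_einfs.
apply: nearW => n; apply: le_trans (vc n).
by apply: ereal_inf_lbound => /=; exists n => //=.
Qed.

(** The sum of the absolute increments has finite integral, so it is finite almost everywhere, and
    there the telescoping series converges absolutely. *)
Lemma ae_cvg_of_summable_increments (v : nat -> T -> R) :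
  (forall k, measurable_fun setT (v k)) ->
  (\sum_(0 <= k <oo) \int[P]_z `|v k.+1 z - v k z|%:E < +oo)%E ->
  {ae P, forall z, cvgn (v ^~ z)}.
Proof.
move=> mv.
have mD k : measurable_fun setT (fun z => `|v k.+1 z - v k z|%:E).
  by apply/measurable_EFinP; apply: measurableT_comp => //; exact: measurable_funB.
rewrite -integral_nneseries// => Ioo.
have : P.-integrable setT (fun z => \sum_(0 <= k <oo) `|v k.+1 z - v k z|%:E)%E.
  apply/integrableP; split.
    by apply: ge0_emeasurable_sum => // k z _ _; rewrite lee_fin.
  under eq_integral do rewrite gee0_abs ?nneseries_ge0//; exact: Ioo.
move=> /(integrable_ae measurableT); apply: filterS => z /(_ I) fz.
have cS : cvgn [normed series (telescope (v ^~ z))].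
  apply: nondecreasing_is_cvgn.
    by apply: nondecreasing_series => ? _ _; exact: normr_ge0.
  exists (fine (\sum_(0 <= k <oo) `|v k.+1 z - v k z|%:E)%E) => _ [n _ <-].
  rewrite -lee_fin fineK// /series/= -sumEFin; apply: nneseries_lim_ge.
  by move=> *; rewrite lee_fin.
have /normed_cvg := cS; rewrite telescopeK => cv.
rewrite (_ : v ^~ z = (fun n => (v n z - v 0%N z) + v 0%N z)).
  by apply: is_cvgD => //; exact: is_cvg_cst.
by apply/funext => n; rewrite subrK.
Qed.

(** Riesz-Fischer: a subsequence with summable increments converges almost everywhere, and Fatou's
    lemma bounds the distance from every late [u n] to its limit. *)
Lemma L2_complete (u : nat -> T -> R) : (forall n, u n \in Lfun P 2%:E) ->
  (forall e : R, 0 < e -> exists N, forall m n, (N <= m)%N -> (N <= n)%N ->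
    L2dot P (fun z => u m z - u n z) (fun z => u m z - u n z) <= e) ->
  exists2 a, a \in Lfun P 2%:E &
    (fun n => L2dot P (fun z => u n z - a z) (fun z => u n z - a z)) @ \oo --> (0 : R).
Proof.
move=> u2 uC.
have d2 m n : (fun z => u m z - u n z) \in Lfun P 2%:E by exact: Lfun2B.
(* By Cauchy-Schwarz against the constant 1, a squared L2 increment below [e k] gives an L1
   increment below 2^-(k+1), which is summable. *)
pose e k : R := (2^-1 ^+ k.+1) ^+ 2.
have e0 k : 0 < e k by rewrite !exprn_gt0.
have [N NP] := choice (fun k => uC (e k) (e0 k)).
(* The running sum makes [phi] nondecreasing and at least [N k]; the successors make it at least
   k. *)
pose phi k := (\sum_(j < k.+1) (N j).+1)%N.
have phiN k : (N k <= phi k)%N by rewrite /phi big_ord_recr (leq_trans (leqnSn _))// leq_addl.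
have phiE k : phi k.+1 = (phi k + (N k.+1).+1)%N by rewrite /phi big_ord_recr.
have phiS k : (phi k <= phi k.+1)%N by rewrite phiE leq_addr.
have phi_ge k : (k <= phi k)%N.
  by elim: k => [//|k IH]; rewrite phiE addnS ltnS (leq_trans IH)// leq_addr.
pose v k := u (phi k).
have v2 k : v k \in Lfun P 2%:E by exact: u2.
have mv k : measurable_fun setT (v k) by exact: Lfun_measurable (v2 k).
have vint k : (\int[P]_z `|v k.+1 z - v k z|%:E <= (2^-1 ^+ k.+1)%:E)%E.
  have f2 : (fun z => `|v k.+1 z - v k z|) \in Lfun P 2%:E.
    have [mf If] := (Lfun2P P (fun z => v k.+1 z - v k z)).1 (Lfun2B (v2 _) (v2 _)).
    apply/Lfun2P; split; first exact: measurableT_comp.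
    by under eq_integral do rewrite real_normK ?num_real//.
  have o2 : cst 1 \in Lfun P 2%:E by exact: Lfun_cst.
  have := L2dot_CS f2 o2; rewrite {1}/L2dot.
  have -> : L2dot P (cst 1) (cst 1) = 1.
    rewrite /L2dot; under eq_Rintegral do rewrite mulr1/=.
    exact: Rintegral_probability_cst.
  rewrite mulr1; under eq_Rintegral do rewrite /= mulr1.
  have -> : L2dot P (fun z => `|v k.+1 z - v k z|) (fun z => `|v k.+1 z - v k z|) =
    L2dot P (fun z => v k.+1 z - v k z) (fun z => v k.+1 z - v k z).
    by apply: eq_Rintegral => z _; rewrite -!expr2 real_normK ?num_real.
  move=> /le_trans/(_ (NP k _ _ (leq_trans (phiN k) (phiS k)) (phiN k))).
  rewrite /e ler_pXn2r ?nnegrE ?exprn_ge0 ?invr_ge0 ?Rintegral_ge0// => le.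
  have : ((\int[P]_z `|v k.+1 z - v k z|)%:E <= (2^-1 ^+ k.+1)%:E)%E by rewrite lee_fin.
  rewrite /Rintegral fineK//.
  by apply: integrable_fin_num => //; apply/Lfun1P; exact: Lfun12.
have : (\sum_(0 <= k <oo) \int[P]_z `|v k.+1 z - v k z|%:E < +oo)%E.
  apply: (@le_lt_trans _ _ 1%:E); last exact: ltry.
  apply: le_trans (epsilon_trick0 xpredT ler01).
  apply: lee_nneseries => [k _ _|k _]; first exact: integral_ge0.
  by rewrite (le_trans (vint k))// lee_fin exprVn natrX div1r.
move=> /(ae_cvg_of_summable_increments mv) cv.
(* The upper limit is measurable everywhere and agrees with the limit wherever that exists. *)
pose a z := fine (limn_esup (fun k => (v k z)%:E)).
have ma : measurable_fun setT a.
  apply: (measurableT_comp (fine_measurable measurableT)).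
  by apply: measurable_fun_limn_esup => n; exact/measurable_EFinP.
have va : {ae P, forall z, v ^~ z @ \oo --> a z}.
  apply: filterS cv => z cz; rewrite /a.
  have : EFin (v k z) @[k --> \oo] --> (limn (v ^~ z))%:E by apply: cvg_EFin => //; exact: nearW.
  by move=> /cvg_limn_einf_sup [_ ->].
have key eps N0 : (forall m n, (N0 <= m)%N -> (N0 <= n)%N ->
    L2dot P (fun z => u m z - u n z) (fun z => u m z - u n z) <= eps) ->
    forall n, (N0 <= n)%N -> (\int[P]_z ((u n z - a z) ^+ 2)%:E <= eps%:E)%E.
  move=> H n N0n.
  (* The shift by [N0] puts every index [phi (k + N0)] in the range of the Cauchy bound. *)
  pose w k z : \bar R := ((u n z - v (k + N0)%N z) ^+ 2)%:E.
  have mw k : measurable_fun setT (w k).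
    apply/measurable_EFinP; apply: measurable_funX.
    exact: measurable_funB (Lfun_measurable (u2 _)) (mv _).
  have mE : measurable_fun setT (fun z => limn_einf (w ^~ z)).
    apply: measurableT_comp => //; apply: measurable_fun_limn_esup => k.
    exact: measurableT_comp.
  have -> : (\int[P]_z ((u n z - a z) ^+ 2)%:E = \int[P]_z limn_einf (w ^~ z))%E.
    apply: ae_eq_integral => //.
      apply/measurable_EFinP; apply: measurable_funX.
      exact: measurable_funB (Lfun_measurable (u2 _)) ma.
    apply: filterS va => z vz _; apply/esym.
    have : w k z @[k --> \oo] --> ((u n z - a z) ^+ 2)%:E.
      apply: cvg_EFin => /=; first exact: nearW.
      have : (u n z - v (k + N0)%N z) @[k --> \oo] --> u n z - a z.
        apply: cvgB; first exact: cvg_cst.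
        by have := vz; rewrite -(cvg_shiftn N0).
      by move=> c; apply: (cvgM c c).
    by move=> /cvg_limn_einf_sup [-> _].
  apply: (@le_trans _ _ (limn_einf (fun k => \int[P]_z w k z)%E)).
    by apply: fatou => // k z _; rewrite lee_fin sqr_ge0.
  apply: le_limn_einf_cst => k.
  rewrite /w -L2dotE ?Lfun2B// lee_fin; apply: H => //.
  exact: leq_trans (leq_addl _ _) (phi_ge _).
have a2 : a \in Lfun P 2%:E.
  have [N0 HN0] := uC 1 ltr01.
  have un : (fun z => u N0 z - a z) \in Lfun P 2%:E.
    apply/Lfun2P; split; first exact: measurable_funB (Lfun_measurable (u2 _)) ma.
    exact: le_lt_trans (key _ _ HN0 N0 (leqnn _)) (ltry _).
  rewrite (_ : a = fun z => u N0 z - (u N0 z - a z)); first exact: Lfun2B.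
  by apply/funext => z; rewrite subKr.
exists a => //; apply/cvgrPdist_le => eps eps0.
have [N0 HN0] := uC eps eps0.
exists N0 => // n /= N0n; rewrite sub0r normrN ger0_norm ?L2dot_ge0//.
by rewrite -lee_fin L2dotE ?Lfun2B//; exact: key HN0 _ N0n.
Qed.

End L2_complete.

(** * Alternating projections *)

Section AlternatingProjections.
Context (R : realType) (d : measure_display) (T : measurableType d).
Variable P : probability T R.

(* Weak form of "E is an orthogonal projection of L2": it makes sense although
   elements of L2 are functions and E need only be determined P-a.e. *)
Record L2projector (E : (T -> R) -> T -> R) : Prop := L2Projector {
  L2projector_L2 : forall f, f \in Lfun P 2%:E -> E f \in Lfun P 2%:E;
  L2projector_adj : forall f g, f \in Lfun P 2%:E -> g \in Lfun P 2%:E ->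
    L2dot P (E f) g = L2dot P f (E g);
  L2projector_idem : forall f g, f \in Lfun P 2%:E -> g \in Lfun P 2%:E ->
    L2dot P (E f) (E g) = L2dot P (E f) g
}.

Variables EX EY : (T -> R) -> T -> R.
Hypotheses (projX : L2projector EX) (projY : L2projector EY).
Variables (s : T -> R) (k : nat -> T -> R).
Hypothesis s2 : s \in Lfun P 2%:E.
Hypothesis sX : forall g, g \in Lfun P 2%:E -> L2dot P s (EX g) = 0.
Hypothesis k02 : k 0%N \in Lfun P 2%:E.
Hypothesis k0Y : forall g, g \in Lfun P 2%:E ->
  L2dot P (k 0%N) g = L2dot P s (EY g).
Hypothesis kS : forall n, k n.+1 = EY (EX (k n)).

Variable a : nat -> T -> R.
Hypothesis aE : forall n z,
  a n z = s z - \sum_(0 <= j < n) (k j z - EX (k j) z).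

Let k2 n : k n \in Lfun P 2%:E.
Proof. by elim: n => // n IH; rewrite kS; exact/(L2projector_L2 projY)/(L2projector_L2 projX). Qed.

Let Xk2 n : EX (k n) \in Lfun P 2%:E.
Proof. exact: (L2projector_L2 projX). Qed.

Let aS n : a n.+1 = fun z => a n z - (k n z - EX (k n) z).
Proof. by apply/funext => z; rewrite !aE big_nat_recr//= opprD addrA. Qed.

Let a0 : a 0%N = s.
Proof. by apply/funext => z; rewrite aE big_geq// subr0. Qed.

Let a2 n : a n \in Lfun P 2%:E.
Proof. by elim: n => [|n IH]; rewrite ?a0// aS; do 2 apply: Lfun2B => //. Qed.

Let aSdot n g : g \in Lfun P 2%:E ->
  L2dot P (a n.+1) g = L2dot P (a n) g - L2dot P (k n) g + L2dot P (EX (k n)) g.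
Proof.
move=> g2; rewrite aS L2dotBl ?Lfun2B// L2dotBl//; ring. Qed.

Let aX n g : g \in Lfun P 2%:E -> L2dot P (a n) (EX g) = 0.
Proof.
move=> g2; elim: n => [|n IH]; first by rewrite a0 sX.
have Xg2 := L2projector_L2 projX g2.
rewrite aSdot// IH (L2projector_idem projX)//.
by rewrite (L2projector_adj projX)//; ring.
Qed.

(** Weak form of [k n] = [EY (a n)]. In the induction step [EY] fixes [k n], which therefore cancels
    [EY (a n)] and leaves [EY (EX (k n))]. *)
Let kaY n g : g \in Lfun P 2%:E -> L2dot P (k n) g = L2dot P (a n) (EY g).
Proof.
elim: n g => [|n IH] g g2; first by rewrite a0 k0Y.
have Yg2 := L2projector_L2 projY g2.
rewrite kS aSdot// (L2projector_adj projY)// IH//.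
by rewrite -[L2dot P (a n) (EY (EY g))](L2projector_adj projY)// (L2projector_idem projY)// (L2projector_adj projY)//; ring.
Qed.

Let kkY n g : g \in Lfun P 2%:E -> L2dot P (k n) (EY g) = L2dot P (k n) g.
Proof.
move=> g2; have Yg2 := L2projector_L2 projY g2.
by rewrite !kaY// -(L2projector_adj projY)// (L2projector_idem projY)// (L2projector_adj projY).
Qed.

Let kk m n : L2dot P (k m) (k n) = L2dot P (k m) (a n).
Proof.
by rewrite L2dotC kaY// -(L2projector_adj projY)// L2dotC kkY// ?a2//.
Qed.

(* With D = (1 - EX)(1 - EY)(1 - EX), which is self-adjoint, a n = D^n s; hence
   the products below depend only on m + n. *)
Let a_shift m n : L2dot P (a m.+1) (a n) = L2dot P (a m) (a n.+1).
Proof.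
rewrite aSdot// [in RHS]L2dotC aSdot// (L2dotC P (a n)).
rewrite -!kk (L2dotC P (k n)) !(L2dotC P (EX _)).
by rewrite !aX.
Qed.

Let w n := L2dot P (a n) s.

Let aw m n : L2dot P (a m) (a n) = w (m + n)%N.
Proof.
elim: n m => [|n IH] m; first by rewrite a0 addn0.
by rewrite -a_shift IH addSnnS.
Qed.

(** The values of [w] at 2n, 2n+1, 2n+2 are the squared norms of [a n], (1 - EY) [a n] and (1 -
    EX)(1 - EY) [a n]. By Pythagoras each drop is the squared norm of what a projection removes,
    here and in [w_odd]. *)
Let w_even n : w (n + n) - w (n + n).+1 = L2dot P (k n) (k n).
Proof.
rewrite -addSn -!aw aSdot// -kk (L2dotC P (EX _)) aX//; ring.
Qed.

Let w_odd n : w (n + n).+1 - w (n + n).+2 = L2dot P (EX (k n)) (EX (k n)).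
Proof.
rewrite -addSn -[(_ + n).+1]addnS -!aw [in X in _ - X]aSdot//.
rewrite [L2dot P (EX (k n)) (a n.+1)]L2dotC aX// addr0 (L2dotC P (a n.+1)).
rewrite opprB addrCA subrr addr0 L2dotC aSdot// (L2dotC P (a n)) kk subrr add0r.
by rewrite (L2projector_idem projX).
Qed.

Let w_step n : w n.+1 <= w n.
Proof.
rewrite -subr_ge0 -[n]odd_double_half -addnn; case: (odd n).
  by rewrite add1n w_odd L2dot_ge0.
by rewrite add0n w_even L2dot_ge0.
Qed.

Let w_mono : {homo w : m n / (n <= m)%N >-> m <= n}.
Proof. by move=> m n; apply: (@homo_leq _ w (fun x y => y <= x)) => // x y z h1 h2; exact: le_trans h2 h1. Qed.

Let w_ge0 n : 0 <= w n.
Proof.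
apply: le_trans (w_mono (leq_addr n n)); rewrite -aw; exact: L2dot_ge0.
Qed.

Let w_cvg : cvgn w.
Proof.
apply: nonincreasing_is_cvgn; first by move=> m n; exact: w_mono.
by exists 0 => _ [n _ <-]; exact: w_ge0.
Qed.

Let a_dist m n : L2dot P (fun z => a m z - a n z) (fun z => a m z - a n z) =
  w (m + m) - w (m + n) - (w (m + n) - w (n + n)).
Proof.
rewrite L2dotBl ?L2dotBr ?Lfun2B// !aw (addnC n m); ring.
Qed.

(** The limit of [a n] inherits orthogonality to the range of [EX] from each [a n]. For [EY] one
    uses that [k n] tends to 0, its squared norm being a drop of the convergent sequence [w]. The
    last clause holds because the product of [a n] with such a [b] does not change with n. *)
Theorem alternating_projections : exists2 t, t \in Lfun P 2%:E &
  [/\ (fun n => L2dot P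
         (fun z => \sum_(0 <= j < n) (k j z - EX (k j) z) - t z)
         (fun z => \sum_(0 <= j < n) (k j z - EX (k j) z) - t z)) @ \oo --> (0 : R),
     forall g, g \in Lfun P 2%:E -> L2dot P (fun z => s z - t z) (EX g) = 0,
     forall g, g \in Lfun P 2%:E -> L2dot P (fun z => s z - t z) (EY g) = 0 &
     forall b, b \in Lfun P 2%:E ->
       (forall g, g \in Lfun P 2%:E -> L2dot P b (EX g) = 0) ->
       (forall g, g \in Lfun P 2%:E -> L2dot P b (EY g) = 0) ->
       L2dot P t b = 0].
Proof.
have [f f2 af] : exists2 f, f \in Lfun P 2%:E &
    (fun n => L2dot P (fun z => a n z - f z) (fun z => a n z - f z)) @ \oo --> (0 : R).
  apply: L2_complete => // e e0.
  (* By [a_dist] the squared distance combines four values of [w], each within e / 4 of the limit;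
     their coefficients add up to 0. *)
  have := w_cvg => /cvgrPdist_le /(_ (e / 4)); rewrite divr_gt0// => /(_ isT) [N _ HN].
  exists N => m n Nm Nn; rewrite a_dist.
  have H i j : (N <= i)%N -> `|limn w - w (i + j)%N| <= e / 4.
    by move=> Ni; apply: HN => /=; exact: leq_trans Ni (leq_addr _ _).
  move: (H m m Nm) (H m n Nm) (H n n Nn); rewrite !ler_distl.
  by move=> /andP[? ?] /andP[? ?] /andP[? ?]; lra.
have lim_dot g : g \in Lfun P 2%:E -> L2dot P (a n) g @[n --> \oo] --> L2dot P f g.
  move=> g2; apply/cvgrPdist_le => e e0.
  (* The added 1 keeps the divisor positive when g is null. *)
  have Cpos : 0 < L2dot P g g + 1 by rewrite ltr_wpDl// L2dot_ge0.
  have := af => /cvgrPdist_le /(_ (e ^+ 2 / (L2dot P g g + 1))).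
  rewrite divr_gt0 ?exprn_gt0// => /(_ isT); apply: filterS => n.
  rewrite sub0r normrN ger0_norm ?L2dot_ge0// => H.
  rewrite distrC -L2dotBl// -ler_sqr ?nnegrE ?(ltW e0)// real_normK ?num_real//.
  apply: le_trans (L2dot_CS (Lfun2B (a2 n) f2) g2) _.
  apply: le_trans (ler_wpM2r (L2dot_ge0 _ _) H) _.
  rewrite mulrAC ler_pdivrMr// ler_wpM2l ?sqr_ge0// lerDl//.
have ktail : L2dot P (k n) (k n) @[n --> \oo] --> (0 : R).
  have -> : (fun n => L2dot P (k n) (k n)) = fun n => w (n + n)%N - w (n + n).+1.
    by apply/funext => n; rewrite w_even.
  rewrite -(subrr (limn w)); apply: cvgB.
    have := w_cvg => /cvgrPdist_le H; apply/cvgrPdist_le => e /H [N _ HN].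
    by exists N => // n /= Nn; apply: HN => /=; exact: leq_trans Nn (leq_addr _ _).
  have := w_cvg => /cvgrPdist_le H; apply/cvgrPdist_le => e /H [N _ HN].
  by exists N => // n /= Nn; apply: HN => /=; rewrite leqW// (leq_trans Nn) ?leq_addr.
exists (fun z => s z - f z); first exact: Lfun2B.
have sf : (fun z => s z - (s z - f z)) = f by apply/funext => z; rewrite subKr.
split.
- rewrite (_ : (fun n => _) = fun n => L2dot P (fun z => a n z - f z) (fun z => a n z - f z))//.
  by apply/funext => n; apply: eq_Rintegral => z _; rewrite aE; ring.
- rewrite sf => g g2; have := lim_dot _ (L2projector_L2 projX g2).
  under eq_fun do rewrite aX//.
  by move=> H; exact: (cvg_unique (@Rhausdorff R) H (cvg_cst _)).
- rewrite sf => g g2; have := lim_dot _ (L2projector_L2 projY g2).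
  under eq_fun do rewrite -kaY//.
  move=> H; apply: (cvg_unique (@Rhausdorff R) H).
  apply/cvgrPdist_le => e e0.
  have Cpos : 0 < L2dot P g g + 1 by rewrite ltr_wpDl// L2dot_ge0.
  have := ktail => /cvgrPdist_le /(_ (e ^+ 2 / (L2dot P g g + 1))).
  rewrite divr_gt0 ?exprn_gt0// => /(_ isT); apply: filterS => n.
  rewrite sub0r normrN ger0_norm ?L2dot_ge0// => Hn.
  rewrite sub0r normrN -ler_sqr ?nnegrE ?(ltW e0)// real_normK ?num_real//.
  apply: le_trans (L2dot_CS (k2 n) g2) _.
  apply: le_trans (ler_wpM2r (L2dot_ge0 _ _) Hn) _.
  rewrite mulrAC ler_pdivrMr// ler_wpM2l ?sqr_ge0// lerDl//.
- move=> b b2 bX bY; rewrite L2dotBl//.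
  have ab n : L2dot P (a n) b = L2dot P s b.
    elim: n => [|n IH]; first by rewrite a0.
    rewrite aSdot// IH [L2dot P (EX _) b]L2dotC bX// addr0 kaY// ?b2//.
    by rewrite -(L2projector_adj projY)// (L2dotC P (EY _)) bY// subr0.
  have := lim_dot b b2; under eq_fun do rewrite ab.
  by move=> H; rewrite (cvg_unique (@Rhausdorff R) H (cvg_cst _)) subrr.
Qed.

End AlternatingProjections.

(** * Densities and conditional expectations *)

Section Density.
Context (R : realType) (d : measure_display) (T : measurableType d).
Local Open Scope ereal_scope.

(** Reduced to the change of variables for the Radon-Nikodym derivative, which agrees with [p]
    almost everywhere since both have the same integral over every measurable set. *)
Lemma ge0_integral_density (m : {sigma_finite_measure set T -> \bar R})
    (m' : {finite_measure set T -> \bar R}) (p : T -> R) (f : T -> \bar R) :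
  measurable_fun setT p -> (forall z, (0 <= p z)%R) ->
  (forall A, measurable A -> m' A = \int[m]_(z in A) (p z)%:E) ->
  measurable_fun setT f -> (forall z, 0 <= f z) ->
  \int[m']_z f z = \int[m]_z (f z * (p z)%:E).
Proof.
move=> mp p0 m'E mf f0.
have dom : m' `<< m.
  apply/null_content_dominatesP => A mA mA0.
  rewrite m'E//; apply: null_set_integral => //.
  by apply/measurable_EFinP; exact: measurable_funTS.
rewrite -(Radon_Nikodym_SigmaFinite.change_of_variables dom)//.
have intf := Radon_Nikodym_SigmaFinite.f_integrable dom.
apply: ae_eq_integral => //.
- by apply: emeasurable_funM => //; exact: measurable_int intf.
- by apply: emeasurable_funM => //; exact/measurable_EFinP.
apply: ae_eqe_mul2l; apply: integral_ae_eq => //; first exact/measurable_EFinP.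
by move=> A _ mA; rewrite -m'E// -Radon_Nikodym_SigmaFinite.f_integral.
Qed.

Lemma integrable_density (m : {sigma_finite_measure set T -> \bar R})
    (m' : {finite_measure set T -> \bar R}) (p : T -> R) (f : T -> R) :
  measurable_fun setT p -> (forall z, (0 <= p z)%R) ->
  (forall A, measurable A -> m' A = \int[m]_(z in A) (p z)%:E) ->
  measurable_fun setT f ->
  m'.-integrable setT (EFin \o f) <->
  m.-integrable setT (fun z => (f z * p z)%:E).
Proof.
move=> mp p0 m'E mf.
have E : \int[m']_z `|(EFin \o f) z| = \int[m]_z `|(f z * p z)%:E|.
  rewrite (ge0_integral_density mp p0 m'E)//.
    apply: eq_integral => z _; rewrite EFinM abseM.
    by rewrite [X in _ = _ * X]gee0_abs ?lee_fin.
  by apply: measurableT_comp => //; exact/measurable_EFinP.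
split=> /integrableP[mF IF]; apply/integrableP; split.
- by apply/measurable_EFinP; exact: measurable_funM.
- by rewrite -E.
- exact/measurable_EFinP.
- by rewrite E.
Qed.

Lemma Rintegral_density (m : {sigma_finite_measure set T -> \bar R})
    (m' : {finite_measure set T -> \bar R}) (p : T -> R) (f : T -> R) :
  measurable_fun setT p -> (forall z, (0 <= p z)%R) ->
  (forall A, measurable A -> m' A = \int[m]_(z in A) (p z)%:E) ->
  measurable_fun setT f ->
  (\int[m']_z f z = \int[m]_z (f z * p z))%R.
Proof.
move=> mp p0 m'E mf.
rewrite /Rintegral; congr fine; rewrite [LHS]integralE [RHS]integralE.
congr (_ - _).
- rewrite (ge0_integral_density mp p0 m'E)//.
    apply: eq_integral => z _; rewrite !funeposE -!EFin_max -EFinM; congr EFin.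
    by rewrite maxr_pMl// mul0r.
  by apply: measurable_funepos; exact/measurable_EFinP.
- rewrite (ge0_integral_density mp p0 m'E)//.
    apply: eq_integral => z _; rewrite !funenegE -!EFinN -!EFin_max -EFinM; congr EFin.
    by rewrite maxr_pMl// mul0r mulNr.
  by apply: measurable_funeneg; exact/measurable_EFinP.
Qed.

End Density.

Section DensityMeasure.
Context (R : realType) (d : measure_display) (T : measurableType d).
Local Open Scope ereal_scope.

(** Nonnegativity and integrability are arguments, so that the finite-measure structure can be
    attached to the term itself. *)
Definition density_measure (m : {measure set T -> \bar R}) (p : T -> R)
    (p0 : forall z, (0 <= p z)%R) (ip : m.-integrable setT (EFin \o p)) :=
  fun A : set T => \int[m]_(z in A) (p z)%:E.

Variables (m : {measure set T -> \bar R}) (p : T -> R).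
Hypotheses (p0 : forall z, (0 <= p z)%R) (ip : m.-integrable setT (EFin \o p)).
Local Notation mp := (density_measure p0 ip).

Let mp0 : mp set0 = 0. Proof. exact: integral_set0. Qed.

Let mp_ge0 A : 0 <= mp A.
Proof. by apply: integral_ge0 => z _; rewrite lee_fin. Qed.

Let mp_sigma : semi_sigma_additive mp.
Proof.
apply: semi_sigma_additive_nng_induced; first exact: measurable_int ip.
by move=> z; rewrite lee_fin.
Qed.

HB.instance Definition _ := isMeasure.Build _ _ _ mp mp0 mp_ge0 mp_sigma.

Let mp_fin : fin_num_fun mp.
Proof.
move=> A mA; apply: integrable_fin_num => //.
by apply: integrableS ip.
Qed.

HB.instance Definition _ := Measure_isFinite.Build _ _ _ mp mp_fin.

End DensityMeasure.

Lemma integrableB_EFin (R : realType) (d : measure_display)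
  (T : measurableType d) (m : {measure set T -> \bar R}) (D : set T)
  (f g : T -> R) : measurable D ->
  m.-integrable D (EFin \o f) -> m.-integrable D (EFin \o g) ->
  m.-integrable D (EFin \o (fun z => f z - g z)).
Proof.
move=> mD mf mg; have := integrableB mD mf mg.
by apply: eq_integrable => // z _ /=; rewrite EFinB.
Qed.

Lemma maxr0M (R : realFieldType) (x y : R) : Num.max (x * y) 0 =
  Num.max y 0 * Num.max x 0 + Num.max (- y) 0 * Num.max (- x) 0.
Proof. by rewrite !maxr_absE !subr0 !addr0 !normrN normrM; field. Qed.

(** * Conditional expectations: pull-out, existence, contraction in L2 *)

Section CondExp.
Context (R : realType) (d : measure_display) (T : measurableType d).
Variable P : probability T R.
Context (d' : measure_display) (V : measurableType d') (W : T -> V).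
Hypothesis mW : measurable_fun setT W.

Let mWpre A : measurable A -> measurable (W @^-1` A).
Proof. by move=> mA; rewrite -[X in measurable X]setTI; exact: mW. Qed.

Section Pullout.
Local Open Scope ereal_scope.
Variable u : T -> R.
Hypothesis iu : P.-integrable setT (EFin \o u).
Hypothesis u0 : forall A, measurable A -> (\int[P]_(z in W @^-1` A) u z = 0)%R.

Let mu : measurable_fun setT u.
Proof. by apply/measurable_EFinP; exact: measurable_int iu. Qed.

Let iup : P.-integrable setT (EFin \o u^\+%R).
Proof. exact: integrable_funrpos. Qed.

Let iun : P.-integrable setT (EFin \o u^\-%R).
Proof. exact: integrable_funrneg. Qed.

Let up0 z : (0 <= u^\+%R z)%R. Proof. exact: funrpos_ge0. Qed.
Let un0 z : (0 <= u^\-%R z)%R. Proof. exact: funrneg_ge0. Qed.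

Let pushE A : measurable A ->
  \int[P]_(z in W @^-1` A) (u^\+%R z)%:E = \int[P]_(z in W @^-1` A) (u^\-%R z)%:E.
Proof.
move=> mA; have mB := mWpre mA.
have ipA : P.-integrable (W @^-1` A) (EFin \o u^\+%R) by exact: integrableS iup.
have inA : P.-integrable (W @^-1` A) (EFin \o u^\-%R) by exact: integrableS iun.
have := u0 mA.
have -> : (\int[P]_(z in W @^-1` A) u z =
    \int[P]_(z in W @^-1` A) (u^\+ z - u^\- z))%R.
  by rewrite -{1}[u]funrposBneg.
rewrite RintegralB// => /subr0_eq H; have := congr1 EFin H.
by rewrite /Rintegral !fineK//; exact: integrable_fin_num.
Qed.

(** The measures with densities [u^\+] and [u^\-] have the same image under [W], because [u]
    integrates to 0 over every preimage. Both sides may be infinite. *)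
Lemma pullout_posneg (psi : V -> \bar R) : measurable_fun setT psi ->
  (forall v, 0 <= psi v) ->
  \int[P]_z (psi (W z) * (u^\+%R z)%:E) = \int[P]_z (psi (W z) * (u^\-%R z)%:E).
Proof.
move=> mpsi psi0.
have mpW : measurable_fun setT (psi \o W) by exact: measurableT_comp.
have pW0 z : 0 <= (psi \o W) z by exact: psi0.
have mup : measurable_fun setT u^\+%R by exact: measurable_funrpos.
have mun : measurable_fun setT u^\-%R by exact: measurable_funrneg.
rewrite -(@ge0_integral_density _ _ _ P (density_measure up0 iup) _ (psi \o W))//.
rewrite -(@ge0_integral_density _ _ _ P (density_measure un0 iun) _ (psi \o W))//.
rewrite -(@ge0_integral_pushforward _ _ _ _ _ _ mW (density_measure up0 iup) setT)//.
rewrite -(@ge0_integral_pushforward _ _ _ _ _ _ mW (density_measure un0 iun) setT)//.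
by apply: eq_measure_integral => A mA _; exact: pushE.
Qed.

(* If the positive and the negative part of the integrand both have infinite
   integral, then [Rintegral] is [0] by convention. *)
Lemma pullout (phi : V -> R) : measurable_fun setT phi ->
  (\int[P]_z (u z * phi (W z)) = 0)%R.
Proof.
move=> mphi.
have mphiW : measurable_fun setT (phi \o W) by exact: measurableT_comp.
have mup : measurable_fun setT u^\+%R by exact: measurable_funrpos.
have mun : measurable_fun setT u^\-%R by exact: measurable_funrneg.
have mpp : measurable_fun setT phi^\+%R by exact: measurable_funrpos.
have mpn : measurable_fun setT phi^\-%R by exact: measurable_funrneg.
have mm (f : V -> R) (g : T -> R) : measurable_fun setT f -> measurable_fun setT g ->
    measurable_fun setT (fun z => (f (W z))%:E * (g z)%:E).
  move=> mf mg; apply/measurable_EFinP; apply: measurable_funM => //.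
  exact: (@measurableT_comp _ _ _ _ _ _ f _ W).
have posE : \int[P]_z (fun z => (u z * phi (W z))%:E)^\+ z =
   \int[P]_z ((phi^\+%R (W z))%:E * (u^\+%R z)%:E) +
   \int[P]_z ((phi^\-%R (W z))%:E * (u^\-%R z)%:E).
  rewrite -ge0_integralD//; try exact: mm.
  - by apply: eq_integral => z _; rewrite funeposE -EFin_max maxr0M EFinD !EFinM.
  - by move=> z _; rewrite mule_ge0// lee_fin ?funrpos_ge0.
  - by move=> z _; rewrite mule_ge0// lee_fin ?funrneg_ge0.
have negE : \int[P]_z (fun z => (u z * phi (W z))%:E)^\- z =
   \int[P]_z ((phi^\-%R (W z))%:E * (u^\+%R z)%:E) +
   \int[P]_z ((phi^\+%R (W z))%:E * (u^\-%R z)%:E).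
  rewrite -ge0_integralD//; try exact: mm.
  - apply: eq_integral => z _.
    by rewrite funenegE -EFinN -EFin_max -mulrN maxr0M opprK EFinD !EFinM.
  - by move=> z _; rewrite mule_ge0// lee_fin ?funrpos_ge0.
  - by move=> z _; rewrite mule_ge0// lee_fin ?funrneg_ge0.
rewrite /Rintegral integralE posE negE.
rewrite (@pullout_posneg (EFin \o phi^\+%R))//; last first.
- by move=> v; rewrite lee_fin.
- exact/measurable_EFinP.
rewrite -(@pullout_posneg (EFin \o phi^\-%R))//; last first.
- by move=> v; rewrite lee_fin.
- exact/measurable_EFinP.
rewrite [X in X - _]addeC; set c := (X in _ - X).
by rewrite -[X in X - _]/c; case: c => [r| |] //=; rewrite subrr.
Qed.

End Pullout.

(** The signed measure sending A to the integral of [f] over the preimage of A is absolutely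
    continuous with respect to the law of [W]; its Radon-Nikodym derivative, made real-valued by
    [fine], is a version. *)
Lemma condexp_exists f : f \in Lfun P 1 -> exists h, is_condexp P W f h.
Proof.
move=> f1; have intf := (Lfun1P P f).1 f1.
pose D := measure_function_pushforward__canonical__charge_Charge
  (induced_charge intf) mW.
pose X : {mfun T >-> V} := MeasurableFun.Pack (MeasurableFun.Class
  (isMeasurableFun.Build _ _ _ _ _ mW)).
pose Q : probability V R := distribution P X.
have dom : D `<< Q.
  apply/null_content_dominatesP => A mA; rewrite /= /distribution /pushforward => A0.
  apply: null_set_integral => //; first exact: mWpre.
  exact/measurable_funTS/measurable_int/intf.
have iRN := Radon_Nikodym_integrable dom.
pose h := fine \o Radon_Nikodym D Q.
have mh : measurable_fun setT h.
  by apply: (measurableT_comp (fine_measurable measurableT)); exact: measurable_int iRN.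
have hE v : (h v)%:E = Radon_Nikodym D Q v.
  by rewrite /h /= fineK//; exact: Radon_Nikodym_fin_num.
have ihW : P.-integrable setT (EFin \o (h \o W)).
  apply/integrableP; split.
    by apply/measurable_EFinP; exact: measurableT_comp.
  have /integrableP[mRN IRN] := iRN.
  have m_abs : measurable_fun setT (fun v => `|Radon_Nikodym D Q v|%E).
    exact: measurableT_comp.
  have E := @ge0_integral_distribution _ _ _ _ _ P X _ m_abs (fun v => abse_ge0 _).
  move: IRN; rewrite E; apply: le_lt_trans; rewrite le_eqVlt; apply/orP; left.
  by apply/eqP; apply: eq_integral => z _; exact: (congr1 abse (hE (W z))).
exists h; split=> //; first exact/Lfun1P.
move=> A mA; rewrite /Rintegral; congr fine.
transitivity (D A); last by [].
rewrite (Radon_Nikodym_integral dom mA).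
have -> : (\int[Q]_(v in A) Radon_Nikodym D Q v = \int[pushforward P W]_(v in A) (h v)%:E)%E.
  by apply: eq_integral => v _; rewrite hE.
rewrite integral_pushforward//; first exact/measurable_EFinP.
by apply: integrableS ihW => //; exact: mWpre.
Qed.

(* A version h of E(f | W) is determined only P-a.e. on W, so the results below
   are stated for an arbitrary version. *)
Lemma condexpP f : f \in Lfun P 1 ->
  exists2 h, is_condexp P W f h & condexp P W f = h \o W.
Proof.
move=> /condexp_exists ex; exists (xget (cst 0) [set h | is_condexp P W f h]) => //.
exact: (xgetPex _ ex).
Qed.

Lemma is_condexpB f f' h h' : is_condexp P W f h -> is_condexp P W f' h' ->
  is_condexp P W (fun z => f z - f' z) (fun v => h v - h' v).
Proof.
move=> [/Lfun1P f1 mh /Lfun1P h1 E] [/Lfun1P f1' mh' /Lfun1P h1' E'].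
split.
- by apply/Lfun1P; exact: integrableB_EFin.
- exact: measurable_funB.
- by apply/Lfun1P; exact: integrableB_EFin.
- move=> A mA; have mA' := mWpre mA.
  have sub f0 : P.-integrable setT f0 -> P.-integrable (W @^-1` A) f0.
    exact: integrableS.
  rewrite RintegralB//; [|exact: sub h1|exact: sub h1'].
  by rewrite RintegralB//; [rewrite E// E'//|exact: sub f1|exact: sub f1'].
Qed.

Lemma condexp_resid f h : is_condexp P W f h ->
  P.-integrable setT (EFin \o (fun z => f z - h (W z))) /\
  forall A, measurable A -> \int[P]_(z in W @^-1` A) (f z - h (W z)) = 0.
Proof.
move=> [/Lfun1P f1 mh /Lfun1P h1 E]; split; first exact: integrableB_EFin.
move=> A mA; have mA' := mWpre mA.
by rewrite RintegralB ?E ?subrr//; [apply: integrableS f1|apply: integrableS h1].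
Qed.

Lemma condexp_dot f h phi : is_condexp P W f h -> measurable_fun setT phi ->
  P.-integrable setT (EFin \o (fun z => f z * phi (W z))) ->
  P.-integrable setT (EFin \o (fun z => h (W z) * phi (W z))) ->
  L2dot P f (phi \o W) = L2dot P (h \o W) (phi \o W).
Proof.
move=> fh mphi i1 i2; have [iu u0] := condexp_resid fh.
apply/eqP; rewrite -subr_eq0 /L2dot -RintegralB//; apply/eqP.
rewrite -[RHS](pullout iu u0 mphi).
by apply: eq_Rintegral => z _ /=; rewrite mulrBl.
Qed.

(** [h] is tested against its truncation [phi n], set to 0 where |h| > n so that [h * phi n] is the
    square of [phi n]. Cauchy-Schwarz then bounds the norm of [phi n] by that of [f], and Fatou's
    lemma passes to the limit. *)
Lemma condexp_L2 f h : f \in Lfun P 2%:E -> is_condexp P W f h ->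
  h \o W \in Lfun P 2%:E.
Proof.
move=> f2 fh; have [_ mh h1 _] := fh.
have mhW : measurable_fun setT (h \o W) by exact: measurableT_comp.
pose phi (n : nat) v := h v * \1_[set v | `|h v| <= n%:R] v.
have mset n : measurable [set v | `|h v| <= n%:R].
  rewrite -[X in measurable X]setTI; apply: measurable_fun_le => //.
  exact: measurableT_comp.
have mphi n : measurable_fun setT (phi n) by apply: measurable_funM => //; exact: measurable_indic.
have phi_le n v : `|phi n v| <= n%:R.
  rewrite /phi indicE; case: (boolP (v \in _)); last by rewrite mulr0 normr0.
  by rewrite inE/= mulr1.
have mpW n : measurable_fun setT (phi n \o W) by exact: measurableT_comp.
have p2 n : phi n \o W \in Lfun P 2%:E by apply: (@Lfun2_bounded _ _ _ _ _ n%:R) => // z; exact: phi_le.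
have hphi n v : h v * phi n v = phi n v * phi n v.
  by rewrite /phi indicE; case: (v \in _); rewrite ?mulr1// !mulr0.
have le n : (\int[P]_z ((phi n (W z)) ^+ 2)%:E <= (L2dot P f f)%:E)%E.
  have -> := esym (L2dotE (p2 n)); rewrite lee_fin.
  have E : L2dot P f (phi n \o W) = L2dot P (phi n \o W) (phi n \o W).
    rewrite (condexp_dot fh (mphi n)).
    - by apply: eq_Rintegral => z _ /=.
    - exact: L2dot_integrable (p2 n).
    - rewrite (_ : _ \o _ = EFin \o (fun z => phi n (W z) * phi n (W z))).
        exact: L2dot_integrable (p2 n) (p2 n).
      by apply/funext => z /=; rewrite hphi.
  have := L2dot_CS f2 (p2 n); rewrite E.
  have := L2dot_ge0 P (phi n \o W); rewrite le_eqVlt => /orP[/eqP <-|p0].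
    by rewrite L2dot_ge0.
  by rewrite expr2 ler_pM2r.
apply/Lfun2P; split=> //.
have -> : (\int[P]_z ((h \o W) z ^+ 2)%:E =
    \int[P]_z limn_einf (fun n => ((phi n (W z)) ^+ 2)%:E))%E.
  apply: eq_integral => z _; apply/esym.
  have : ((phi n (W z)) ^+ 2)%:E @[n --> \oo] --> ((h (W z)) ^+ 2)%:E.
    apply: cvg_near_cst; near=> n.
    have hn : `|h (W z)| <= n%:R by near: n; exact: nbhs_infty_ger.
    by rewrite /phi indicE mem_set//= mulr1.
  by move=> /cvg_limn_einf_sup [].
apply: le_lt_trans (ltry (L2dot P f f)).
apply: le_trans (fatou _ _ _ _) _ => //.
- by move=> n; apply/measurable_EFinP; exact: (measurable_funX 2 (mpW n)).
- by move=> n z _; rewrite lee_fin sqr_ge0.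
- exact: le_limn_einf_cst.
Unshelve. all: by end_near.
Qed.

Lemma condexp_L2dot f h g : f \in Lfun P 2%:E -> is_condexp P W f h ->
  g \in Lfun P 2%:E -> 
  L2dot P (h \o W) (condexp P W g) = L2dot P f (condexp P W g) /\
  L2dot P (h \o W) (condexp P W g) = L2dot P (h \o W) g.
Proof.
move=> f2 fh g2; have [h' gh' ->] := condexpP (Lfun12 g2).
have h2 := condexp_L2 f2 fh; have h2' := condexp_L2 g2 gh'.
have [_ mh _ _] := fh; have [_ mh' _ _] := gh'.
split; first by rewrite (condexp_dot fh mh')//; exact: L2dot_integrable.
rewrite L2dotC [RHS]L2dotC (condexp_dot gh' mh)//; exact: L2dot_integrable.
Qed.

Lemma L2projector_condexp : L2projector P (condexp P W).
Proof.
split=> [f f2|f g f2 g2|f g f2 g2].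
- by have [h fh ->] := condexpP (Lfun12 f2); exact: condexp_L2 fh.
- have [h fh ->] := condexpP (Lfun12 f2).
  by have [<- <-] := condexp_L2dot f2 fh g2.
- have [h fh ->] := condexpP (Lfun12 f2).
  by have [_ <-] := condexp_L2dot f2 fh g2.
Qed.

End CondExp.

(** * Joint densities on a product space *)

Lemma sigma_finite_prod (R : realType) (d1 d2 : measure_display)
    (T1 : measurableType d1) (T2 : measurableType d2)
    (m1 : {sigma_finite_measure set T1 -> \bar R})
    (m2 : {sigma_finite_measure set T2 -> \bar R}) :
  sigma_finite setT (m1 \x m2)%E.
Proof.
have [F TF mF] := sigma_finiteT m1; have [G TG mG] := sigma_finiteT m2.
exists (fun n => if @unpickle (nat * nat)%type n is Some (i, j)
                 then F i `*` G j else set0).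
  apply/esym/seteqP; split=> // -[x y] _.
  have [[i _ Fx] [j _ Gy]] : (\bigcup_i F i) x /\ (\bigcup_i G i) y.
    by rewrite -TF -TG.
  by exists (pickle (i, j)) => //; rewrite pickleK.
move=> n; case: (unpickle n) => [[i j]|]; last by rewrite measure0.
have [? Fi] := mF i; have [? Gj] := mG j; split; first exact: measurableX.
by rewrite product_measure1E// lte_mul_pinfty// ge0_fin_numE.
Qed.

(* The library's sigma-finite structure on a product measure is not found by
   canonical inference. *)
Definition prod_sigma_finite (R : realType) (d1 d2 : measure_display)
    (T1 : measurableType d1) (T2 : measurableType d2)
    (m1 : {sigma_finite_measure set T1 -> \bar R})
    (m2 : {sigma_finite_measure set T2 -> \bar R}) :
    {sigma_finite_measure set (T1 * T2)%type -> \bar R} :=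
  HB.pack_for {sigma_finite_measure set (T1 * T2)%type -> \bar R} (m1 \x m2)%E
    (Measure_isSigmaFinite.Build _ _ _ (m1 \x m2)%E (sigma_finite_prod m1 m2)).

Lemma integrable_fubini_G (R : realType) (d1 d2 : measure_display)
    (T1 : measurableType d1) (T2 : measurableType d2)
    (m1 : {sigma_finite_measure set T1 -> \bar R})
    (m2 : {sigma_finite_measure set T2 -> \bar R}) (f : T1 * T2 -> \bar R) :
  (m1 \x m2)%E.-integrable setT f -> m2.-integrable setT (fubini_G m1 f).
Proof.
move=> intf; have mf := measurable_int _ intf.
have mG := measurable_fubini_G intf.
have mabs : measurable_fun setT (fun x => \int[m1]_y `|f (y, x)|)%E.
  apply: (measurable_fun_fubini_tonelli_G (m1 := m1) (fun z => `|f z|%E)) => //.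
  exact: measurableT_comp.
have I21 := (integrable21ltyP m1 m2 mf).1 intf.
apply/integrableP; split=> //; apply: (le_lt_trans _ I21).
apply: ge0_le_integral => //.
- exact: measurableT_comp.
- move=> x _; apply: le_abse_integral => //.
  exact: measurableT_comp.
Qed.

Section JointDensity.
Context (R : realType) (d1 d2 : measure_display)
  (T1 : measurableType d1) (T2 : measurableType d2).
Variables (nu : {sigma_finite_measure set T1 -> \bar R})
          (mu : {sigma_finite_measure set T2 -> \bar R}).
Variable P : probability (T1 * T2)%type R.
Variables (k : T1 * T2 -> R) (g : T1 -> R) (eta : T2 -> R).

(** The kernel [k] abstracts the exponential factor of the model: only its measurability and
    positivity enter below. *)
Definition weight (z : T1 * T2) : R := k z * g z.1.

Definition mass (x : T2) : \bar R := (\int[nu]_y (weight (y, x))%:E)%E.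

Definition joint_density (z : T1 * T2) : R :=
  weight z / fine (mass z.2) * eta z.2.

(** An explicit version of the conditional expectation given the second coordinate. Where the mass
    is infinite, [fine] makes the divisor 0 and hence the value 0. *)
Definition cond_mean (f : T1 * T2 -> R) (x : T2) : R :=
  (\int[nu]_y (f (y, x) * weight (y, x))) / fine (mass x).

Hypotheses (mk : measurable_fun setT k) (k0 : forall z, 0 < k z).
Hypotheses (dg : is_density nu g) (deta : is_density mu eta).
Hypothesis mass_fin : {ae mu, forall x, 0 < eta x -> (mass x < +oo)%E}.
Hypothesis PE : forall A, measurable A ->
  (P A = \int[nu \x mu]_(z in A) (joint_density z)%:E)%E.

Let mg : measurable_fun setT g. Proof. by case: dg. Qed.
Let g0 y : 0 <= g y. Proof. by case: dg. Qed.
Let meta : measurable_fun setT eta. Proof. by case: deta. Qed.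
Let eta0 x : 0 <= eta x. Proof. by case: deta. Qed.

Lemma measurable_weight : measurable_fun setT weight.
Proof.
apply: measurable_funM => //; exact: (measurableT_comp mg measurable_fst).
Qed.

Lemma weight_ge0 z : 0 <= weight z.
Proof. by rewrite mulr_ge0// ltW. Qed.

Lemma measurable_partial_integral (F : T1 * T2 -> \bar R) :
  measurable_fun setT F ->
  measurable_fun setT (fun x => \int[nu]_y F (y, x))%E.
Proof.
move=> mF; rewrite (_ : (fun x => _) =
    (fun x => \int[nu]_y F^\+ (y, x) - \int[nu]_y F^\- (y, x))%E); last first.
  apply/funext => x; rewrite integralE; congr (_ - _)%E.
    by apply: eq_integral => y _; rewrite !funeposE.
  by apply: eq_integral => y _; rewrite !funenegE.
apply: emeasurable_funB.
- apply: (measurable_fun_fubini_tonelli_G F^\+)%E => //.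
  exact: measurable_funepos.
- apply: (measurable_fun_fubini_tonelli_G F^\-)%E => //.
  exact: measurable_funeneg.
Qed.

Lemma measurable_mass : measurable_fun setT mass.
Proof.
apply: (measurable_partial_integral (F := EFin \o weight)).
by apply/measurable_EFinP; exact: measurable_weight.
Qed.

(** As [k] is positive, zero mass would force [g] to vanish almost everywhere, against its total
    integral 1. *)
Lemma mass_gt0 x : (0 < mass x)%E.
Proof.
have m_g y : measurable_fun setT (fun y => weight (y, x)).
  by apply: measurableT_comp => //; exact: measurable_weight.
rewrite lt0e; apply/andP; split; last first.
  by apply: integral_ge0 => y _; rewrite lee_fin weight_ge0.
apply/eqP => w0.
have : (\int[nu]_y `|(weight (y, x))%:E| = 0)%E.
  by under eq_integral do rewrite gee0_abs ?lee_fin ?weight_ge0//.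
move/ae_eq_integral_abs => /(_ measurableT).
have mw : measurable_fun setT (fun y => (weight (y, x))%:E).
  by apply/measurable_EFinP; exact: m_g.
move=> /(_ mw) H.
have g00 : (\int[nu]_y (g y)%:E = 0)%E.
  rewrite -(integral0 nu setT); apply: ae_eq_integral => //.
    by apply/measurable_EFinP.
  apply: filterS H => y /(_ I) [] /eqP; rewrite mulf_eq0 gt_eqF//= => /eqP -> _.
  by [].
by case: dg => _ _; rewrite g00 => /eqP; rewrite eq_sym onee_eq0.
Qed.

Lemma fine_mass_ge0 x : 0 <= fine (mass x).
Proof. by rewrite fine_ge0// ltW// mass_gt0. Qed.

Lemma measurable_inv_mass : measurable_fun setT (fun x => (fine (mass x))^-1).
Proof.
(* On nonnegative reals inversion is the power -1, also at 0, and powers are measurable. *)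
rewrite (_ : (fun x => _) = (@powR R)^~ (-1) \o (fine \o mass)); last first.
  by apply/funext => x /=; rewrite powR_inv1// fine_mass_ge0.
apply: (measurableT_comp (measurable_powR _)).
by apply: (measurableT_comp (fine_measurable measurableT)); exact: measurable_mass.
Qed.

Lemma measurable_joint_density : measurable_fun setT joint_density.
Proof.
apply: measurable_funM; last exact: (measurableT_comp meta measurable_snd).
apply: measurable_funM; first exact: measurable_weight.
exact: (measurableT_comp measurable_inv_mass measurable_snd).
Qed.

Lemma joint_density_ge0 z : 0 <= joint_density z.
Proof. by rewrite mulr_ge0// divr_ge0// ?weight_ge0 ?fine_mass_ge0. Qed.


Lemma prob_null A : measurable A -> (nu \x mu)%E A = 0%E -> P A = 0%E.
Proof.
move=> mA A0; rewrite PE//; apply: null_set_integral => //.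
by apply/measurable_EFinP/measurable_funTS; exact: measurable_joint_density.
Qed.

Lemma ae_fst (Q : T1 -> Prop) : {ae nu, forall y, Q y} -> {ae P, forall z, Q z.1}.
Proof.
move=> [N [mN N0 QN]]; exists (N `*` setT); split.
- exact: measurableX.
- apply: prob_null; first exact: measurableX.
  rewrite product_measure1E//.
  exact: etrans (congr1 (fun t => t * mu setT)%E N0) (mul0e _).
- by move=> z /= nQ; split => //; apply: QN.
Qed.

Lemma ae_snd (Q : T2 -> Prop) : {ae mu, forall y, Q y} -> {ae P, forall z, Q z.2}.
Proof.
move=> [N [mN N0 QN]]; exists (setT `*` N); split.
- exact: measurableX.
- apply: prob_null; first exact: measurableX.
  rewrite product_measure1E//.
  exact: etrans (congr1 (fun t => nu setT * t)%E N0) (mule0 _).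
- by move=> z /= nQ; split => //; apply: QN.
Qed.

Lemma ae_joint_density_gt0 : {ae P, forall z, 0 < joint_density z}.
Proof.
exists [set z | joint_density z <= 0]; split.
- rewrite -[X in measurable X]setTI; apply: measurable_fun_le => //.
  exact: measurable_joint_density.
- rewrite PE; last first.
    rewrite -[X in measurable X]setTI; apply: measurable_fun_le => //.
    exact: measurable_joint_density.
  rewrite (eq_integral (cst 0%E)) ?integral0// => z; rewrite inE/= => pz.
  by congr EFin; apply/eqP; rewrite eq_le pz joint_density_ge0.
- by move=> z /= /negP; rewrite -leNgt.
Qed.

Lemma ae_exists (Q : T1 * T2 -> Prop) : {ae P, forall z, Q z} -> exists z, Q z.
Proof.
move=> [N [mN N0 QN]]; apply: contrapT => nex.
have : P setT = 0%E.
  rewrite -N0; congr (P _); apply/esym/seteqP; split=> // z _; apply: QN => /= Qz.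
  by apply: nex; exists z.
rewrite probability_setT => /eqP; by rewrite onee_eq0.
Qed.

Lemma partial_joint_density (f : T1 * T2 -> R) x :
  (fun y => f (y, x) * joint_density (y, x)) =
  (fun y => ((fine (mass x))^-1 * eta x) * (f (y, x) * weight (y, x))).
Proof. by apply/funext => y; rewrite /joint_density/=; ring. Qed.

Lemma ae_mass_eta : {ae mu, forall x,
  ((fine (mass x))^-1 * eta x)%:E * mass x = (eta x)%:E}%E.
Proof.
apply: filterS mass_fin => x fin.
have [ex|] := ltP 0 (eta x); last first.
  (* Where [eta] vanishes the mass may be infinite, but 0 times infinity is 0. *)
  by move=> ex; rewrite (_ : eta x = 0) ?mulr0 ?mul0e//; apply/eqP; rewrite eq_le ex eta0.
have mfin : mass x \is a fin_num by rewrite ge0_fin_numE ?fin// ltW// mass_gt0.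
rewrite -{2}(fineK mfin) -EFinM mulrAC mulVf ?mul1r// gt_eqF// fine_gt0//.
by rewrite mass_gt0 fin.
Qed.

(** Integrating out y turns the weight into the mass, which cancels the normalising constant almost
    everywhere that [eta] is positive. *)
Lemma marginal_snd A : measurable A ->
  P (snd @^-1` A) = (\int[mu]_(x in A) (eta x)%:E)%E.
Proof.
move=> mA; have mS : measurable (snd @^-1` A : set (T1 * T2)).
  by rewrite -[X in measurable X]setTI; exact: measurable_snd.
rewrite PE// integral_mkcond fubini_tonelli2//.
- rewrite [RHS]integral_mkcond; apply: ae_eq_integral => //.
  + apply: (measurable_fun_fubini_tonelli_G
      ((fun z => (joint_density z)%:E) \_ (snd @^-1` A))%E) => //.
      apply/(measurable_restrictT _ mS)/measurable_EFinP/measurable_funTS.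
      exact: measurable_joint_density.
    by move=> z; rewrite patchE; case: ifP => // _; rewrite lee_fin joint_density_ge0.
  + by apply/(measurable_restrictT _ mA)/measurable_EFinP/measurable_funTS.
  + apply: filterS ae_mass_eta => x mE _; rewrite /fubini_G patchE.
    case: ifPn => xA.
      rewrite -mE /mass -ge0_integralZl_EFin//.
      * apply: eq_integral => y _; rewrite patchE mem_set/=; last first.
          by move: xA; rewrite inE.
        by rewrite -EFinM; congr EFin; rewrite /joint_density/=; ring.
      * by move=> y _; rewrite lee_fin weight_ge0.
      * apply/measurable_EFinP; apply: measurableT_comp => //.
        exact: measurable_weight.
      * by rewrite mulr_ge0// invr_ge0 fine_mass_ge0.
    rewrite (eq_integral (cst 0%E)) ?integral0// => y _.
    rewrite patchE memNset//=; by move: xA; rewrite notin_setE.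
- apply/(measurable_restrictT _ mS)/measurable_EFinP/measurable_funTS.
  exact: measurable_joint_density.
- by move=> z; rewrite patchE; case: ifP => // _; rewrite lee_fin joint_density_ge0.
Qed.

Lemma measurable_cond_mean f : measurable_fun setT f ->
  measurable_fun setT (cond_mean f).
Proof.
move=> mf; apply: measurable_funM; last exact: measurable_inv_mass.
apply: (measurableT_comp (fine_measurable measurableT)).
apply: (measurable_partial_integral (F := EFin \o (fun z => f z * weight z))).
by apply/measurable_EFinP; apply: measurable_funM => //; exact: measurable_weight.
Qed.

Let numu := prod_sigma_finite nu mu.
Let Pfin : {finite_measure set (T1 * T2)%type -> \bar R} := P.

Let PfinE A : measurable A ->
  (Pfin A = \int[numu]_(z in A) (joint_density z)%:E)%E.
Proof. exact: PE. Qed.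

Lemma cond_mean_integral f : measurable_fun setT f ->
  P.-integrable setT (EFin \o f) ->
  mu.-integrable setT (EFin \o (fun x => cond_mean f x * eta x)) /\
  \int[mu]_x (cond_mean f x * eta x) = \int[P]_z f z.
Proof.
move=> mf intf.
have mp := measurable_joint_density.
have inth := (@integrable_density _ _ _ numu Pfin _ _ mp joint_density_ge0 PfinE mf).1 intf.
have iG := integrable_fubini_G inth.
have GE : {ae mu, forall x, fubini_G nu (fun z => (f z * joint_density z)%:E) x =
    (cond_mean f x * eta x)%:E}.
  apply: filterS (ae_integrable2 inth) => x ix.
  set c := (fine (mass x))^-1 * eta x.
  have -> : cond_mean f x * eta x = c * \int[nu]_y (f (y, x) * weight (y, x)).
    by rewrite /cond_mean /c; ring.
  rewrite /fubini_G.
  have hE y : (f (y, x) * joint_density (y, x)) = c * (f (y, x) * weight (y, x)).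
    by have := congr1 (@^~ y) (partial_joint_density f x).
  (* If c vanishes, integrability of the section of [f * joint_density] says nothing about
     [f * weight], but both sides are 0. *)
  have [c0|c0] := eqVneq c 0.
    rewrite c0 mul0r (eq_integral (cst 0%E)) ?integral0// => y _.
    by rewrite hE c0 mul0r.
  have iw : nu.-integrable setT (EFin \o (fun y => f (y, x) * weight (y, x))).
    have := integrableZl measurableT c^-1 ix.
    apply: eq_integrable => // y _ /=.
    by rewrite hE -EFinM mulrA mulVf// mul1r.
  rewrite -RintegralZl// /Rintegral fineK.
    by apply: eq_integral => y _; rewrite hE.
  apply: integrable_fin_num => //.
  by have := ix; apply: eq_integrable => // y _ /=; rewrite hE.
have mE : measurable_fun setT (EFin \o (fun x => cond_mean f x * eta x)).
  by apply/measurable_EFinP; apply: measurable_funM => //; exact: measurable_cond_mean.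
have mG := measurable_int _ iG.
split.
  apply/integrableP; split=> //.
  have /integrableP[_] := iG; apply: le_lt_trans.
  rewrite le_eqVlt; apply/orP; left; apply/eqP; apply: ae_eq_integral => //.
  - exact: measurableT_comp.
  - exact: measurableT_comp.
  - by apply: filterS GE => x /= -> _.
rewrite (@Rintegral_density _ _ _ numu Pfin _ _ mp joint_density_ge0 PfinE mf) /Rintegral; congr fine.
rewrite -(integral21_prod_meas1 inth); apply: ae_eq_integral => //.
by apply: filterS GE => x /= -> _.
Qed.

Lemma ae_integrable_weight f : measurable_fun setT f ->
  P.-integrable setT (EFin \o f) ->
  {ae P, forall z,
    nu.-integrable setT (EFin \o (fun y => f (y, z.2) * weight (y, z.2)))}.
Proof.
move=> mf intf; have mp := measurable_joint_density.
have inth := (@integrable_density _ _ _ numu Pfin _ _ mp joint_density_ge0 PfinE mf).1 intf.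
have /ae_snd := ae_integrable2 inth.
apply: filterS2 ae_joint_density_gt0 => -[y x] p0 /= ix.
pose c := (fine (mass x))^-1 * eta x.
have c0 : c != 0.
  apply: contraTneq p0 => c0.
  have -> : joint_density (y, x) = c * weight (y, x) by rewrite /joint_density /c/=; ring.
  by rewrite c0 mul0r ltxx.
have := integrableZl measurableT c^-1 ix; apply: eq_integrable => // y' _ /=.
have := congr1 (@^~ y') (partial_joint_density f x) => /= ->.
by rewrite -EFinM mulrA mulVf// mul1r.
Qed.

Let sndX : {mfun (T1 * T2)%type >-> T2} := MeasurableFun.Pack (MeasurableFun.Class
  (isMeasurableFun.Build _ _ _ _ _ (@measurable_snd _ _ T1 T2))).

Let law_snd : probability T2 R := distribution P sndX.

Let law_sndE A : measurable A -> law_snd A = (\int[mu]_(x in A) (eta x)%:E)%E.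
Proof. exact: marginal_snd. Qed.

Lemma integrable_snd (h : T2 -> R) : measurable_fun setT h ->
  mu.-integrable setT (EFin \o (fun x => h x * eta x)) ->
  P.-integrable setT (EFin \o (h \o snd)) /\
  \int[P]_z h z.2 = \int[mu]_x (h x * eta x).
Proof.
move=> mh ih.
have iQ := (@integrable_density _ _ _ mu law_snd _ _ meta eta0 law_sndE mh).2 ih.
have iP : P.-integrable setT (EFin \o (h \o snd)).
  have /integrableP[mhE IQ] := iQ; apply/integrableP; split.
    by apply/measurable_EFinP; exact: (measurableT_comp mh measurable_snd).
  have m_abs : measurable_fun setT (fun v => `|(EFin \o h) v|%E).
    exact: measurableT_comp.
  have E := @ge0_integral_distribution _ _ _ _ _ P sndX _ m_abs (fun v => abse_ge0 _).
  by move: IQ; rewrite E.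
split=> //.
rewrite -(@Rintegral_density _ _ _ mu law_snd _ _ meta eta0 law_sndE mh) /Rintegral; congr fine.
by rewrite integral_distribution//; apply/measurable_EFinP.
Qed.

(** [cond_mean] commutes with restriction to a set of values of the second coordinate, so equality
    of total integrals suffices. *)
Lemma is_condexp_snd f : f \in Lfun P 1 -> is_condexp P snd f (cond_mean f).
Proof.
move=> f1; have mf := Lfun_measurable f1; have intf := (Lfun1P P f).1 f1.
have mc := measurable_cond_mean mf.
have [ic _] := cond_mean_integral mf intf.
have [iP _] := integrable_snd mc ic.
split=> //; first exact/Lfun1P.
move=> A mA; have mS : measurable (snd @^-1` A : set (T1 * T2)).
  by rewrite -[X in measurable X]setTI; exact: measurable_snd.
rewrite [LHS]Rintegral_mkcond [RHS]Rintegral_mkcond.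
have mf' : measurable_fun setT (f \_ (snd @^-1` A)).
  by apply/(measurable_restrictT _ mS)/measurable_funTS.
have if' : P.-integrable setT (EFin \o (f \_ (snd @^-1` A))).
  have := (integrable_mkcond (EFin \o f) mS).1 (integrableS measurableT mS (@subsetT _ _) intf).
  by apply: eq_integrable => // z _; rewrite /= !patchE; case: ifP.
have cE x : cond_mean (f \_ (snd @^-1` A)) x = ((cond_mean f) \_ A) x.
  rewrite patchE; case: ifPn => xA.
    congr (_ / _); apply: eq_Rintegral => y _; rewrite patchE mem_set//=.
    by move: xA; rewrite inE.
  rewrite /cond_mean (@eq_Rintegral _ _ _ nu _ (cst 0)).
    by rewrite /Rintegral integral0 mul0r.
  move=> y _; rewrite patchE memNset ?mul0r//=; by move: xA; rewrite notin_setE.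
have [ic' <-] := cond_mean_integral mf' if'.
have [_ <-] := integrable_snd (measurable_cond_mean mf') ic'.
apply: eq_Rintegral => z _; rewrite cE !patchE.
by congr (if _ then _ else _); apply/idP/idP; rewrite !inE.
Qed.

(** Tonelli applied to the density restricted to the exceptional null set. A P-null set is small for
    the dominating measure only where the density is positive, whence the premise in both
    conclusions. *)
Lemma ae_partial (D : T1 * T2 -> Prop) : {ae P, forall z, D z} ->
  {ae mu, forall x, {ae nu, forall y, 0 < joint_density (y, x) -> D (y, x)}} /\
  {ae nu, forall y, {ae mu, forall x, 0 < joint_density (y, x) -> D (y, x)}}.
Proof.
move=> [N [mN N0 DN]].
pose F := ((fun z => (joint_density z)%:E) \_ N)%E.
have mF : measurable_fun setT F.
  apply/(measurable_restrictT _ mN)/measurable_EFinP/measurable_funTS.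
  exact: measurable_joint_density.
have F0 z : (0 <= F z)%E.
  by rewrite /F patchE; case: ifP => // _; rewrite lee_fin joint_density_ge0.
have IF : (\int[nu \x mu]_z F z = 0)%E by rewrite -integral_mkcond -PE.
have FD z : F z = 0%E -> 0 < joint_density z -> D z.
  move=> Fz p0; apply: contrapT => nD; move: Fz; rewrite /F patchE mem_set; last exact: DN.
  by case=> pz; rewrite pz ltxx in p0.
split.
- have := fubini_tonelli2 (m1 := nu) (m2 := mu) F mF F0; rewrite IF => /esym I0.
  have mG := measurable_fun_fubini_tonelli_G (m1 := nu) F mF F0.
  have : (\int[mu]_x `|fubini_G nu F x| = 0)%E.
    by rewrite -[RHS]I0; apply: eq_integral => x _; rewrite gee0_abs// integral_ge0.
  move/(ae_eq_integral_abs mu measurableT mG) => H.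
  apply: filterS H => x /(_ I) Gx.
  have mFx : measurable_fun setT (fun y => F (y, x)) by exact: measurableT_comp.
  have : (\int[nu]_y `|F (y, x)| = 0)%E.
    by rewrite -[RHS]Gx; apply: eq_integral => y _; rewrite gee0_abs.
  move/(ae_eq_integral_abs nu measurableT mFx); apply: filterS => y /(_ I).
  exact: FD.
- have := fubini_tonelli1 (m1 := nu) (m2 := mu) F mF F0; rewrite IF => /esym I0.
  have mG := measurable_fun_fubini_tonelli_F (m2 := mu) F mF F0.
  have : (\int[nu]_x `|fubini_F mu F x| = 0)%E.
    by rewrite -[RHS]I0; apply: eq_integral => x _; rewrite gee0_abs// integral_ge0.
  move/(ae_eq_integral_abs nu measurableT mG) => H.
  apply: filterS H => y /(_ I) Gy.
  have mFy : measurable_fun setT (fun x => F (y, x)) by exact: measurableT_comp.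
  have : (\int[mu]_x `|F (y, x)| = 0)%E.
    by rewrite -[RHS]Gy; apply: eq_integral => x _; rewrite gee0_abs.
  move/(ae_eq_integral_abs mu measurableT mFy); apply: filterS => x /(_ I).
  exact: FD.
Qed.

(* The positivity set of the density is a rectangle, so P-almost everywhere
   properties can be propagated along horizontal and vertical lines. *)
Lemma four_points (D : T1 * T2 -> Prop) : {ae P, forall z, D z} ->
  exists y0 x0, D (y0, x0) /\
    {ae P, forall z, D z /\ D (z.1, x0) /\ D (y0, z.2)}.
Proof.
move=> aeD; have [/ae_snd aeX /ae_fst aeY] := ae_partial aeD.
pose S1 y := 0 < g y; pose S2 x := 0 < (fine (mass x))^-1 * eta x.
have pE y x : (0 < joint_density (y, x)) <-> S1 y /\ S2 x.
  have -> : joint_density (y, x) = k (y, x) * (g y * ((fine (mass x))^-1 * eta x)).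
    by rewrite /joint_density /weight/=; ring.
  rewrite pmulr_rgt0//; split=> [|[s1 s2]]; last exact: mulr_gt0.
  have := g0 y; rewrite le_eqVlt => /orP[/eqP <-|s1]; first by rewrite mul0r ltxx.
  by rewrite pmulr_rgt0.
have aeS : {ae P, forall z, S1 z.1 /\ S2 z.2}.
  by apply: filterS ae_joint_density_gt0 => -[y x] /pE.
have [[y0 _] /= [[s1 _] aey0]] := ae_exists (filterI aeS aeY).
have aey0P : {ae P, forall z, S2 z.2 -> D (y0, z.2)}.
  apply: (@ae_snd (fun x => S2 x -> D (y0, x))); apply: filterS aey0 => x H s2.
  by apply: H; apply/pE.
(* With [y0] fixed first, almost every column is good and meets the line through [y0] in [D], so one
   [x0] satisfies both. *)
have [[_ x0] /= [[[_ s2] aex0] Dx0]] := ae_exists (filterI (filterI aeS aeX) aey0P).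
exists y0, x0; split; first exact: Dx0.
have aex0P : {ae P, forall z, S1 z.1 -> D (z.1, x0)}.
  apply: (@ae_fst (fun y => S1 y -> D (y, x0))); apply: filterS aex0 => y H s.
  by apply: H; apply/pE.
apply: filterS3 (filterI aeS aeD) aey0P aex0P => z [[? ?] ?] H1 H2.
by split=> //; split; [exact: H2|exact: H1].
Qed.

End JointDensity.

(** * Orthogonality to additive functions *)

Section Orthogonality.
Context (R : realType) (d : measure_display) (T : measurableType d).
Variable P : probability T R.

Section OneVariable.
Context (d' : measure_display) (V : measurableType d') (W : T -> V).
Hypothesis mW : measurable_fun setT W.

Lemma condexp0_dot b phi : b \in Lfun P 2%:E -> is_condexp P W b (cst 0) ->
  measurable_fun setT phi -> phi \o W \in Lfun P 2%:E ->
  L2dot P b (phi \o W) = 0.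
Proof.
move=> b2 b0 mphi phi2; rewrite (condexp_dot mW b0 mphi).
- by rewrite /L2dot (@eq_Rintegral _ _ _ P _ (cst 0)) ?Rintegral_probability_cst// => z _; rewrite mul0r.
- exact: L2dot_integrable.
- rewrite (_ : _ \o _ = cst 0%E); first exact: integrable0.
  by apply/funext => z /=; rewrite mul0r.
Qed.

Lemma condexp0_dot_condexp b g : b \in Lfun P 2%:E ->
  is_condexp P W b (cst 0) -> g \in Lfun P 2%:E ->
  L2dot P b (condexp P W g) = 0.
Proof.
move=> b2 b0 g2; have [h gh ->] := condexpP mW (Lfun12 g2).
by apply: condexp0_dot => //; [case: gh|exact: condexp_L2 gh].
Qed.

Lemma condexp0P b : b \in Lfun P 2%:E ->
  (forall A, measurable A -> \int[P]_(z in W @^-1` A) b z = 0) ->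
  is_condexp P W b (cst 0).
Proof.
move=> b2 b0; split; first exact: Lfun12.
- exact: measurable_cst.
- exact: (Lfun_cst P 0 1).
- move=> A mA; rewrite b0//; apply: (@etrans _ _ (\int[P]_(z in W @^-1` A) (0 : R))) => //.
  by rewrite /Rintegral integral0.
Qed.

Lemma dot_indic b A : measurable A ->
  L2dot P b (fun z => \1_A (W z)) = \int[P]_(z in W @^-1` A) b z.
Proof.
move=> mA; rewrite [RHS]Rintegral_mkcond; apply: eq_Rintegral => z _.
rewrite patchE indicE.
have -> : (z \in W @^-1` A) = (W z \in A) by apply/idP/idP; rewrite !inE.
by case: (W z \in A); rewrite ?mulr1// mulr0.
Qed.

Lemma indic_Lfun2 A : measurable A -> (fun z => \1_A (W z)) \in Lfun P 2%:E.
Proof.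
move=> mA; apply: (@Lfun2_bounded _ _ _ _ _ 1).
  have mI : measurable_fun setT (\1_A : V -> R) by exact: measurable_indic.
  exact: (measurableT_comp mI mW).
by move=> z; rewrite indicE; case: (_ \in _); rewrite ?normr1// normr0.
Qed.

(** Testing [b] against its own conditional expectation shows that the latter has norm 0; testing
    against indicators then gives the integrals over preimages. *)
Lemma dot_condexp0 b : b \in Lfun P 2%:E ->
  (forall g, g \in Lfun P 2%:E -> L2dot P b (condexp P W g) = 0) ->
  is_condexp P W b (cst 0).
Proof.
move=> b2 b0; apply: condexp0P => // A mA.
have [h bh Eb] := condexpP mW (Lfun12 b2).
have h2 := condexp_L2 mW b2 bh; have [_ mh _ _] := bh.
have A2 := indic_Lfun2 mA.
have hh : L2dot P (h \o W) (h \o W) = 0.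
  rewrite -(b0 b b2) Eb; apply/esym.
  by rewrite (condexp_dot mW bh mh)//; exact: L2dot_integrable.
have E : L2dot P b (\1_A \o W) = L2dot P (h \o W) (\1_A \o W).
  apply: (condexp_dot mW bh); first exact: measurable_indic.
    exact: (L2dot_integrable b2 A2).
  exact: (L2dot_integrable h2 A2).
rewrite -dot_indic// [LHS]E.
have := L2dot_CS h2 A2; rewrite hh mul0r => H.
by apply/eqP; rewrite -sqrf_eq0 eq_le H sqr_ge0.
Qed.

End OneVariable.

Definition clamp (n : nat) (t : R) : R := Num.max (- n%:R) (Num.min t n%:R).

Lemma clamp_bounded n t : `|clamp n t| <= n%:R.
Proof.
rewrite /clamp ler_norml le_max lexx/= ge_max ge_min lexx orbT andbT.
by rewrite (@le_trans _ _ 0)// ?oppr_le0 ler0n.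
Qed.

Lemma clamp_lip n s t : `|clamp n s - clamp n t| <= `|s - t|.
Proof.
have n0 : 0 <= n%:R :> R by [].
rewrite /clamp; have [s1|s1] := leP s n%:R; have [t1|t1] := leP t n%:R;
  [have [s2|s2] := leP (- n%:R) s; have [t2|t2] := leP (- n%:R) t|
   have [s2|s2] := leP (- n%:R) s; have [t2|t2] := leP (- n%:R) (n%:R : R)|
   have [s2|s2] := leP (- n%:R) t; have [t2|t2] := leP (- n%:R) (n%:R : R)|];
  rewrite ?subrr ?normr0//;
  rewrite ler_norml; have := ler_norm (s - t); have := ler_norm (t - s); rewrite (distrC t s) => ? ?;
  by apply/andP; split; lra.
Qed.

Lemma clamp_cvg t : clamp n t @[n --> \oo] --> t.
Proof.
apply: cvg_near_cst; near=> n.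
have : `|t| <= n%:R by near: n; exact: nbhs_infty_ger.
rewrite ler_norml => /andP[t1 t2].
by rewrite /clamp (min_idPl t2) (max_idPr t1).
Unshelve. all: by end_near.
Qed.

Lemma measurable_clamp n : measurable_fun setT (clamp n).
Proof. by apply: measurable_maxr => //; apply: measurable_minr. Qed.

(* [u] and [v] need not be integrable; truncating both at the same level is a
   contraction for their sum, which gives an integrable majorant. *)
Lemma additive_orth (d1 d2 : measure_display) (T1 : measurableType d1)
    (T2 : measurableType d2) (W1 : T -> T1) (W2 : T -> T2)
    (u : T1 -> R) (v : T2 -> R) (b s : T -> R) :
  measurable_fun setT W1 -> measurable_fun setT W2 ->
  measurable_fun setT u -> measurable_fun setT v ->
  b \in Lfun P 2%:E -> s \in Lfun P 2%:E ->
  is_condexp P W1 b (cst 0) -> is_condexp P W2 b (cst 0) ->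
  {ae P, forall z, s z = u (W1 z) + v (W2 z)} -> L2dot P b s = 0.
Proof.
move=> mW1 mW2 mu mv b2 s2 b01 b02 sE.
(* Clamping [- v] writes the truncated sum as a difference of two clamped values, so [clamp_lip]
   bounds it by |u + v|. *)
pose c1 n y := clamp n (u y); pose c2 n x := clamp n (- v x).
have mc1 n : measurable_fun setT (c1 n) by exact: (measurableT_comp (measurable_clamp n)).
have mc2 n : measurable_fun setT (c2 n).
  by apply: (measurableT_comp (measurable_clamp n)); exact: measurableT_comp.
have mc1W n : measurable_fun setT (c1 n \o W1) by exact: measurableT_comp.
have mc2W n : measurable_fun setT (c2 n \o W2) by exact: measurableT_comp.
have c12 n : c1 n \o W1 \in Lfun P 2%:E.
  by apply: (@Lfun2_bounded _ _ _ _ _ n%:R) => // z; exact: clamp_bounded.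
have c22 n : c2 n \o W2 \in Lfun P 2%:E.
  by apply: (@Lfun2_bounded _ _ _ _ _ n%:R) => // z; exact: clamp_bounded.
pose sn n z := c1 n (W1 z) - c2 n (W2 z).
have sn2 n : sn n \in Lfun P 2%:E by exact: (Lfun2B (c12 n) (c22 n)).
have bsn n : L2dot P b (sn n) = 0.
  rewrite (L2dotBr (c12 n) (c22 n) b2).
  by rewrite (condexp0_dot mW1 b2 b01 (mc1 n) (c12 n))
    (condexp0_dot mW2 b2 b02 (mc2 n) (c22 n)) subrr.
have mb := Lfun_measurable b2; have ms := Lfun_measurable s2.
have mbs n : measurable_fun setT (fun z => (b z * sn n z)%:E).
  by apply/measurable_EFinP; apply: measurable_funM => //; exact: Lfun_measurable (sn2 n).
have mbs0 : measurable_fun setT (fun z => (b z * s z)%:E).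
  by apply/measurable_EFinP; exact: measurable_funM.
have ibs := L2dot_integrable b2 s2.
have cv : {ae P, forall z, setT z -> (fun n => (b z * sn n z)%:E) @ \oo --> (b z * s z)%:E}.
  apply: filterS sE => z -> _; apply: cvg_EFin; first exact: nearW.
  apply: cvgM; first exact: cvg_cst.
  rewrite -[v (W2 z)]opprK; apply: cvgB; exact: clamp_cvg.
have dom : {ae P, forall z, forall n, setT z -> (`|(b z * sn n z)%:E| <= `|(b z * s z)%:E|)%E}.
  apply: filterS sE => z -> n _; rewrite lee_fin !normrM ler_wpM2l//.
  by rewrite (le_trans (clamp_lip _ _ _))// opprK.
have [_ _ ] := dominated_convergence measurableT mbs mbs0 cv (integrable_abse ibs) dom.
have -> : [sequence (\int[P]_z (b z * sn n z)%:E)%E]_n = cst 0%E.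
  apply/funext => n /=; rewrite -[RHS](congr1 EFin (bsn n)) /L2dot /Rintegral fineK//.
  by apply: integrable_fin_num => //; exact: L2dot_integrable (sn2 n).
move=> H; have := cvg_unique (@ereal_hausdorff R) H (cvg_cst _).
by rewrite /L2dot /Rintegral => ->.
Qed.

End Orthogonality.

(** * The proportional likelihood ratio model *)

Section ModelBasics.
Context (R : realType) (q : nat).
Local Notation RY := (measurableTypeR R).
Local Notation RX := (q.-tuple (measurableTypeR R)).
Variables (nu : {sigma_finite_measure set RY -> \bar R})
          (mu : {sigma_finite_measure set RX -> \bar R}).

Definition tilt (b : 'rV[R]_q) (z : RY * RX) : R := expR (dot b (vec z.2) * z.1).

Lemma tilt_gt0 b z : 0 < tilt b z.
Proof. exact: expR_gt0. Qed.

Lemma dot_sum (r : nat) (u v : 'rV[R]_r) : dot u v = \sum_j u 0 j * v 0 j.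
Proof. by rewrite /dot mxE; apply: eq_bigr => j _; rewrite mxE. Qed.

Lemma measurable_dot_vec (b : 'rV[R]_q) :
  measurable_fun setT (fun x : RX => dot b (vec x)).
Proof.
under eq_fun do rewrite dot_sum.
apply: measurable_sum => j; apply: measurable_funM => //.
under eq_fun do rewrite mxE.
exact: measurable_tnth.
Qed.

Lemma measurable_tilt b : measurable_fun setT (tilt b).
Proof.
apply: measurableT_comp; first exact: measurable_expR.
apply: measurable_funM; last exact: measurable_fst.
exact: (measurableT_comp (measurable_dot_vec b) measurable_snd).
Qed.

Lemma plr_densityE b g eta :
  plr_density nu b g eta = joint_density nu (tilt b) g eta.
Proof. by []. Qed.

Lemma plr_normE b g : plr_norm nu b g = mass nu (tilt b) g.
Proof. by []. Qed.

End ModelBasics.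

Section LocalMin.
Variable R : realType.

(** Difference quotients on the two sides of 0 have opposite signs, whereas for D different from 0
    both would lie within |D| of D and share its sign. *)
Lemma is_derive_local_min (phi : R -> R) (D : R) :
  is_derive (0 : R) (1 : R) phi D ->
  (\forall h \near (0 : R), phi 0 <= phi h) -> D = 0.
Proof.
move=> phiD phi_min.
have /cvg_ex[l /= cl] := @ex_derive _ _ _ _ _ _ _ phiD.
have lD : l = D.
  have := @derive_val _ _ _ _ _ _ _ phiD; rewrite /derive => <-.
  by apply/esym/cvg_lim.
rewrite lD in cl => {l lD}.
apply: contrapT => /eqP D0.
have e0 : 0 < `|D| by rewrite normr_gt0.
have /cvgrPdist_lt/(_ _ e0) := cl.
rewrite near_withinE => near_cl.
have [e /= ee He] := filterI near_cl phi_min.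
have close (t : R) : `|t| < e -> t != 0 ->
    `|D - t^-1 * (phi t - phi 0)| < `|D| /\ phi 0 <= phi t.
  move=> te t0; have [] := He t; first by rewrite /ball_/= sub0r normrN.
  by move=> /(_ t0); rewrite /= scaler1 addr0.
have half (s : R) : `|s| = 1 -> `|s * (e / 2)| < e /\ s * (e / 2) != 0.
  move=> s1; rewrite normrM s1 mul1r gtr0_norm ?divr_gt0//; split; first lra.
  have s0 : s != 0 by rewrite -normr_eq0 s1 oner_eq0.
  by rewrite mulf_neq0// gt_eqF// divr_gt0.
have [pe pne] := half 1 (normr1 _).
have [ne nne] := half (-1) (normrN1 _).
have [c1 m1] := close _ pe pne; have [c2 m2] := close _ ne nne.
move: c1 c2; set A := (1 * _)^-1 * _; set B := (-1 * _)^-1 * _ => c1 c2.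
have A0 : 0 <= A by rewrite mulr_ge0 ?subr_ge0// invr_ge0 mul1r divr_ge0// ltW.
have B0 : B <= 0.
  by rewrite mulr_le0_ge0 ?subr_ge0// invr_le0 mulN1r oppr_le0 divr_ge0// ltW.
move: c1 c2; have [Dp|Dn] := leP 0 D.
  by rewrite (ger0_norm Dp) !ltr_norml => /andP[? ?] /andP[? ?]; lra.
by rewrite (ltr0_norm Dn) !ltr_norml => /andP[? ?] /andP[? ?]; lra.
Qed.

End LocalMin.

(** * The score for the parameter of interest *)

Section BetaScore.
Context (R : realType) (q : nat).
Local Notation RY := (measurableTypeR R).
Local Notation RX := (q.-tuple (measurableTypeR R)).
Variables (nu : {sigma_finite_measure set RY -> \bar R})
          (mu : {sigma_finite_measure set RX -> \bar R}).

Lemma dot_line (h : R) (i : 'I_q) (b v : 'rV[R]_q) :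
  dot (h *: delta_mx 0 i + b) v = h * v 0 i + dot b v.
Proof.
rewrite !dot_sum.
under eq_bigr => j _ do rewrite !mxE eqxx/= mulrDl.
rewrite big_split/=; congr (_ + _).
rewrite (bigD1 i)//= eqxx mulr1 big1 ?addr0// => j /negPf ->.
by rewrite mulr0 mul0r.
Qed.

Lemma XYE (i : 'I_q) (z : RY * RX) : XY z 0 i = z.1 * vec z.2 0 i.
Proof. by rewrite /XY !mxE. Qed.

Lemma near_line (r : nat) (e b : 'rV[R]_r) (Q : 'rV[R]_r -> Prop) :
  (\forall t \near b, Q t) -> \forall h \near (0 : R), Q (h *: e + b).
Proof.
move=> nQ.
have : (fun h : R => h *: e + b) h @[h --> (0 : R)] --> b.
  rewrite -[X in _ --> X]add0r; apply: cvgD; last exact: cvg_cst.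
  by rewrite -[X in _ --> X](scale0r e); apply: cvgZr_tmp; exact: cvg_id.
by move=> /(_ _ nQ).
Qed.

Lemma is_derive_line (r : nat) (L : 'rV[R]_r -> R) (b e : 'rV[R]_r) :
  differentiable L b ->
  is_derive (0 : R) (1 : R) (fun h : R => L (h *: e + b)) ('D_e L b).
Proof.
move=> dL.
have E : (fun h : R => h^-1 *: (((fun h => L (h *: e + b)) \o shift 0) (h *: (1 : R)) -
    L (0 *: e + b))) = (fun h => h^-1 *: ((L \o shift b) (h *: e) - L b)).
  apply/funext => h; rewrite /= /shift /= addr0 scale0r add0r.
  by rewrite (_ : h *: (1 : R) = h)// -[RHS]mulr1.
have := @diff_derivable _ _ _ _ _ e dL; rewrite /derivable => dE.
by split; rewrite /derivable /derive E.
Qed.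

(** Integrates exp u >= 1 + u, with u = h x_i y, against the weight at [b0]. The parameter [b1]
    enters only through its product with [vec x], which is what the equation prescribes. *)
Lemma mass_line_ge (b0 b1 : 'rV[R]_q) (g : RY -> R) (i : 'I_q) (x : RX) (h : R) :
  is_density nu g ->
  (mass nu (tilt b0) g x < +oo)%E ->
  (mass nu (tilt b1) g x < +oo)%E ->
  dot b1 (vec x) = h * vec x 0 i + dot b0 (vec x) ->
  nu.-integrable setT (EFin \o (fun y => XY (y, x) 0 i * weight (tilt b0) g (y, x))) ->
  fine (mass nu (tilt b0) g x) *
    (1 + h * cond_mean nu (tilt b0) g (fun z => XY z 0 i) x) <=
  fine (mass nu (tilt (b1)) g x).
Proof.
move=> dg f0 fh b1E int.
have mw b : measurable_fun setT (fun y : RY => weight (tilt b) g (y, x)).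
  have mw := measurable_weight (measurable_tilt b) dg.
  exact: measurableT_comp.
have w0 b y : 0 <= weight (tilt b) g (y, x) by exact: (weight_ge0 (tilt_gt0 b) dg).
have iw b : (mass nu (tilt b) g x < +oo)%E ->
    nu.-integrable setT (EFin \o (fun y : RY => weight (tilt b) g (y, x))).
  move=> fin; apply/integrableP; split; first exact/measurable_EFinP.
  apply: le_lt_trans fin; rewrite le_eqVlt; apply/orP; left; apply/eqP.
  by apply: eq_integral => y _; rewrite /= ger0_norm.
have massE b : fine (mass nu (tilt b) g x) = \int[nu]_y (weight (tilt b) g (y, x)) by [].
have N0 : 0 < fine (mass nu (tilt b0) g x).
  by rewrite fine_gt0// f0 (mass_gt0 (measurable_tilt b0) (tilt_gt0 b0) dg).
rewrite mulrDr mulr1 /cond_mean.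
have -> : fine (mass nu (tilt b0) g x) *
   (h * (\int[nu]_y (XY (y, x) 0 i * weight (tilt b0) g (y, x)) / fine (mass nu (tilt b0) g x))) =
   h * \int[nu]_y (XY (y, x) 0 i * weight (tilt b0) g (y, x)).
  by field; rewrite gt_eqF.
have ihXY : nu.-integrable setT
    (EFin \o (fun y => h * (XY (y, x) 0 i * weight (tilt b0) g (y, x)))).
  by have := integrableZl measurableT h int; apply: eq_integrable => // y _ /=; rewrite EFinM.
rewrite (massE b0) (massE b1) -(RintegralZl h measurableT int).
rewrite -(RintegralD measurableT (iw _ f0) ihXY).
apply: (le_Rintegral measurableT _ (iw _ fh)).
  have := integrableD measurableT (iw _ f0) ihXY.
  by apply: eq_integrable => // y _ /=; rewrite EFinD.
move=> y _.
have -> : weight (tilt b1) g (y, x) = expR (h * vec x 0 i * y) * weight (tilt b0) g (y, x).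
  by rewrite /weight /tilt/= b1E mulrDl expRD; ring.
rewrite XYE/=.
have -> : weight (tilt b0) g (y, x) + h * (y * vec x 0 i * weight (tilt b0) g (y, x)) =
  (1 + h * vec x 0 i * y) * weight (tilt b0) g (y, x) by ring.
by rewrite ler_wpM2r// expR_ge1Dx.
Qed.

(* Because exp u >= 1 + u, the normalising constant lies above the line with the
   slope one expects for its derivative.  Regularity provides a derivative, which
   must then be that slope: no differentiation under the integral is needed. *)
Lemma derive_from_exp_bound (psi : R -> R) (S a m : R) :
  is_derive (0 : R) (1 : R) psi S ->
  (\forall h \near (0 : R), 1 + h * m <= expR (h * a - (psi h - psi 0))) ->
  S = a - m.
Proof.
move=> psi' bound.
(* [phi] vanishes at 0 and is nonnegative near 0, so its derivative a - S - m there is 0. *)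
pose phi (h : R) := expR (h * a - (psi h - psi 0)) - (1 + h * m).
have phi_min : \forall h \near (0 : R), phi 0 <= phi h.
  apply: filterS bound => h.
  by rewrite /phi !mul0r subrr subr0 expR0 addr0 subrr subr_ge0.
have dphi : is_derive (0 : R) (1 : R) phi (a - S - m).
  have did : is_derive (0 : R) (1 : R) (id : R -> R) 1 by exact: is_derive_id.
  have dcst (c : R) : is_derive (0 : R) (1 : R) (cst c : R -> R) 0 by exact: is_derive_cst.
  have d1 : is_derive (0 : R) (1 : R) (a \*: id - (psi - cst (psi 0)))
      (a *: 1 - (S - 0)).
    exact: is_deriveB.
  have d2 : is_derive (0 : R) (1 : R) (expR \o (a \*: id - (psi - cst (psi 0))))
      (1 * (a *: 1 - (S - 0))).
    apply: is_derive1_comp => //; apply: is_derive_eq.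
    by rewrite !fctE /= subrr subr0 -[_ *: _]/(a * 0) mulr0 expR0.
  have d3 : is_derive (0 : R) (1 : R) (cst 1 + m \*: id) (0 + m *: 1).
    exact: is_deriveD.
  have -> : phi = (expR \o (a \*: id - (psi - cst (psi 0)))) - (cst 1 + m \*: id).
    by apply/funext => h; rewrite /phi !fctE/= (mulrC h) (mulrC h).
  apply: is_derive_eq.
  by rewrite mul1r subr0 add0r -[a *: 1]/(a * 1) -[m *: 1]/(m * 1) !mulr1.
have := is_derive_local_min dphi phi_min; lra.
Qed.

(** An infinite mass would make the divisor, and with it the density, 0 by convention. *)
Lemma plr_density_gt0 (b : 'rV[R]_q) (g : RY -> R) (eta : RX -> R) z :
  is_density nu g -> 0 < plr_density nu b g eta z ->
  0 < fine (mass nu (tilt b) g z.2) /\ (mass nu (tilt b) g z.2 < +oo)%E.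
Proof.
rewrite plr_densityE /joint_density => dg p0.
have N0 : fine (mass nu (tilt b) g z.2) != 0.
  by apply: contraTneq p0 => ->; rewrite invr0 mulr0 mul0r ltxx.
split; first by rewrite lt_def N0 (fine_mass_ge0 (measurable_tilt b) (tilt_gt0 b) dg).
by rewrite ltey; apply: contraNN N0 => /eqP ->.
Qed.

Lemma expR_lnB (a p0 p1 : R) : 0 < p0 -> 0 < p1 ->
  expR (a - (ln p1 - ln p0)) = expR a / (p1 / p0).
Proof. by move=> ? ?; rewrite expRB [expR (ln _ - _)]expRB !lnK. Qed.

Lemma ratio_algebra (t gy e N0 N1 ex : R) :
  0 < N0 -> 0 < N1 -> 0 < ex ->
  0 < t * gy / N0 * e -> 0 < ex * t * gy / N1 * e ->
  ex / ((ex * t * gy / N1 * e) / (t * gy / N0 * e)) = N1 / N0.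
Proof.
move=> N00 N10 ex0 p0 _.
have t0 : t != 0 by apply: contraTneq p0 => ->; rewrite !mul0r ltxx.
have gy0 : gy != 0 by apply: contraTneq p0 => ->; rewrite mulr0 !mul0r ltxx.
have e0 : e != 0 by apply: contraTneq p0 => ->; rewrite mulr0 ltxx.
by field; rewrite t0 gy0 e0 !gt_eqF.
Qed.

Lemma ratio_plr_density (b0 b1 : 'rV[R]_q) (h xi : R) (g : RY -> R) (eta : RX -> R) z :
  is_density nu g ->
  0 < plr_density nu b0 g eta z -> 0 < plr_density nu b1 g eta z ->
  dot b1 (vec z.2) = h * xi + dot b0 (vec z.2) ->
  expR (h * (z.1 * xi) -
    (ln (plr_density nu b1 g eta z) - ln (plr_density nu b0 g eta z))) =
  fine (mass nu (tilt b1) g z.2) / fine (mass nu (tilt b0) g z.2).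
Proof.
move=> dg p0 p1 b1E.
have [n0 _] := plr_density_gt0 dg p0; have [n1 _] := plr_density_gt0 dg p1.
rewrite (expR_lnB _ p0 p1).
move: p0 p1; rewrite !plr_densityE /joint_density /weight.
have -> : tilt b1 z = expR (h * (z.1 * xi)) * tilt b0 z.
  by rewrite /tilt b1E mulrDl expRD; congr (expR _ * _); ring.
exact: ratio_algebra n0 n1 (expR_gt0 _).
Qed.

(** Along the i-th coordinate line, exp(h y x_i) divided by the density ratio is a ratio of
    normalising constants, in which [g] and [eta] at the point have cancelled; [mass_line_ge] bounds
    it below. *)
Lemma derive_ln_plr_density (b0 : 'rV[R]_q) (g : RY -> R) (eta : RX -> R)
    (i : 'I_q) (y : RY) (x : RX) :
  is_density nu g ->
  (\forall t \near b0, 0 < plr_density nu t g eta (y, x)) ->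
  differentiable (fun t => ln (plr_density nu t g eta (y, x))) b0 ->
  nu.-integrable setT (EFin \o (fun y => XY (y, x) 0 i * weight (tilt b0) g (y, x))) ->
  'D_(delta_mx 0 i) (fun t => ln (plr_density nu t g eta (y, x))) b0 =
  XY (y, x) 0 i - cond_mean nu (tilt b0) g (fun z => XY z 0 i) x.
Proof.
move=> dg near_pos diffL int; rewrite XYE /=.
apply: derive_from_exp_bound (is_derive_line (delta_mx 0 i) diffL) _.
have p0 := nbhs_singleton near_pos.
have [N0 mass0] := plr_density_gt0 dg p0.
have := near_line (delta_mx 0 i) near_pos; apply: filterS => h.
have := dot_line h i b0 (vec x).
rewrite scale0r add0r; move: (h *: delta_mx 0 i + b0) => b1 b1E p1.
have [N1 mass1] := plr_density_gt0 dg p1.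
rewrite (ratio_plr_density (h := h) (xi := vec x 0 i) dg p0 p1 b1E).
rewrite ler_pdivlMr// mulrC.
exact: (mass_line_ge dg mass0 mass1 b1E int).
Qed.

End BetaScore.

(** * Additivity of nuisance scores *)

Section ScoreFacts.
Context (R : realType) (q : nat).
Local Notation RY := (measurableTypeR R).
Local Notation RX := (q.-tuple (measurableTypeR R)).
Variables (nu : {sigma_finite_measure set RY -> \bar R})
          (mu : {sigma_finite_measure set RX -> \bar R}).

Lemma ln_cross (a1 a0 a2 a3 g1 g0 n1 n0 e1 e0 : R) :
  0 < expR a1 * g1 / n1 * e1 -> 0 < expR a0 * g0 / n0 * e0 ->
  0 < expR a2 * g1 / n0 * e0 -> 0 < expR a3 * g0 / n1 * e1 ->
  ln (expR a1 * g1 / n1 * e1) + ln (expR a0 * g0 / n0 * e0)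
    - ln (expR a2 * g1 / n0 * e0) - ln (expR a3 * g0 / n1 * e1) =
  a1 + a0 - a2 - a3.
Proof.
move=> p1 p0 p2 p3; rewrite -lnM ?posrE//.
rewrite -addrA -opprD -[X in _ - X]lnM ?posrE//.
have -> : expR a1 * g1 / n1 * e1 * (expR a0 * g0 / n0 * e0) =
    expR (a1 + a0 - a2 - a3) * (expR a2 * g1 / n0 * e0 * (expR a3 * g0 / n1 * e1)).
  rewrite (_ : expR (a1 + a0 - a2 - a3) = expR a1 * expR a0 / expR a2 / expR a3).
    have := expR_gt0 a2; have := expR_gt0 a3; move: (expR a2) (expR a3) => x y x0 y0.
    have -> : expR a1 * expR a0 / x / y * (x * g1 / n0 * e0 * (y * g0 / n1 * e1)) =
      (x / x) * (y / y) * (expR a1 * expR a0 * (g1 / n0 * e0 * (g0 / n1 * e1))) by ring.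
    by rewrite !divff ?gt_eqF//; ring.
  by rewrite !expRB expRD.
rewrite [X in X - _]lnM; last 2 first.
- exact: expR_gt0.
- exact: mulr_gt0 p2 p3.
by rewrite addrK; exact: expRK.
Qed.

(** In this mixed second difference ln g, ln eta and the logarithm of the normalising constant
    cancel. The right-hand side involves neither [g] nor [eta], hence is constant along a nuisance
    submodel. *)
Lemma ln_plr_cross (b : 'rV[R]_q) (g : RY -> R) (eta : RX -> R) y x y0 x0 :
  0 < plr_density nu b g eta (y, x) -> 0 < plr_density nu b g eta (y0, x0) ->
  0 < plr_density nu b g eta (y, x0) -> 0 < plr_density nu b g eta (y0, x) ->
  ln (plr_density nu b g eta (y, x)) + ln (plr_density nu b g eta (y0, x0))
  - ln (plr_density nu b g eta (y, x0)) - ln (plr_density nu b g eta (y0, x)) =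
  dot b (vec x) * y + dot b (vec x0) * y0 - dot b (vec x0) * y - dot b (vec x) * y0.
Proof. exact: ln_cross. Qed.

Lemma derive_cross (r : nat) (L1 L0 L2 L3 : 'rV[R]_r -> R) (c e : 'rV[R]_r) (K : R) :
  differentiable L1 c -> differentiable L0 c -> differentiable L2 c ->
  differentiable L3 c ->
  (\forall t \near c, L1 t + L0 t - L2 t - L3 t = K) ->
  'D_e L1 c = 'D_e L2 c - 'D_e L0 c + 'D_e L3 c.
Proof.
move=> d1 d0 d2 d3 nK.
have D (L : 'rV[R]_r -> R) : differentiable L c -> is_derive c e L ('D_e L c).
  by move=> dL; apply: DeriveDef => //; exact: diff_derivable.
have H1 := @D L1 d1; have H0 := @D L0 d0; have H2 := @D L2 d2; have H3 := @D L3 d3.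
have HD : is_derive c e (L1 + L0 - L2 - L3) ('D_e L1 c + 'D_e L0 c - 'D_e L2 c - 'D_e L3 c).
  exact: is_deriveB.
have HK : is_derive c e (L1 + L0 - L2 - L3) 0.
  apply: (@near_eq_is_derive _ _ _ (cst K)).
  by apply: filterS nK => t <-.
have := @derive_val _ _ _ _ _ _ _ HD; rewrite (@derive_val _ _ _ _ _ _ _ HK); lra.
Qed.

Variable P : probability (RY * RX)%type R.
Variables (b0 : 'rV[R]_q) (g0 : RY -> R) (eta0 : RX -> R).
Hypothesis hP : has_plr_law nu mu P b0 g0 eta0.

Lemma density_g : is_density nu g0. Proof. by case: hP => -[]. Qed.
Lemma density_eta : is_density mu eta0. Proof. by case: hP => -[]. Qed.
Lemma ae_mass_fin :
  {ae mu, forall x, 0 < eta0 x -> (mass nu (tilt b0) g0 x < +oo)%E}.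
Proof. by case: hP => -[]. Qed.
Lemma plr_lawE A : measurable A ->
  (P A = \int[nu \x mu]_(z in A) (joint_density nu (tilt b0) g0 eta0 z)%:E)%E.
Proof. by case: hP => _; exact. Qed.

Lemma beta_scoreE (S : RY * RX -> 'rV[R]_q) (i : 'I_q) :
  is_beta_score nu mu P b0 g0 eta0 S ->
  (fun z => @XY R q z 0 i) \in Lfun P 1 ->
  {ae P, forall z, S z 0 i =
     XY z 0 i - cond_mean nu (tilt b0) g0 (fun z => @XY R q z 0 i) z.2}.
Proof.
move=> [score _ _ _] XY1.
have int := ae_integrable_weight (measurable_tilt b0) (tilt_gt0 b0) density_g
  density_eta plr_lawE (Lfun_measurable XY1) ((Lfun1P P _).1 XY1).
apply: filterS2 score int => -[y x] [pos diff ->] iw.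
rewrite mxE; exact: (derive_ln_plr_density density_g pos diff iw).
Qed.

Lemma nuisance_score_orth (r : nat) (g : 'rV[R]_r -> RY -> R)
    (eta : 'rV[R]_r -> RX -> R) (c0 : 'rV[R]_r) (S : RY * RX -> 'rV[R]_r)
    (j : 'I_r) (F : RY * RX -> R) :
  nuisance_submodel nu mu P b0 g0 eta0 g eta c0 S ->
  F \in Lfun P 2%:E -> is_condexp P fst F (cst 0) -> is_condexp P snd F (cst 0) ->
  L2dot P F (fun z => S z 0 j) = 0.
Proof.
move=> [_ _ _ [score var _ _]] F2 F1 F0.
have [y0 [x0 [D0 aeD]]] := four_points (measurable_tilt b0) (tilt_gt0 b0)
  density_g density_eta plr_lawE score.
have mS := Lfun_measurable (var j).
(* Differentiating the cross identity in the parameter recovers the score at (y, x) from its values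
   on the two lines through (y0, x0). *)
apply: (@additive_orth _ _ _ P _ _ _ _ fst snd
  (fun y => S (y, x0) 0 j - S (y0, x0) 0 j) (fun x => S (y0, x) 0 j)) => //.
- by apply: measurable_funB => //; exact: (measurableT_comp mS (measurable_pair2 x0)).
- exact: (measurableT_comp mS (measurable_pair1 y0)).
apply: filterS aeD => -[y x] [D1 [D2 D3]] /=.
have [pos0 diff0 ->] := D0; have [pos1 diff1 ->] := D1.
have [pos2 diff2 ->] := D2; have [pos3 diff3 ->] := D3; rewrite !mxE.
apply: (derive_cross (K := dot b0 (vec x) * y + dot b0 (vec x0) * y0
  - dot b0 (vec x0) * y - dot b0 (vec x) * y0) _ diff1 diff0 diff2 diff3).
apply: (filterS _ (filterI (filterI pos1 pos0) (filterI pos2 pos3))).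
by move=> t [[p1 p0] [p2 p3]]; exact: (ln_plr_cross p1 p0 p2 p3).
Qed.

End ScoreFacts.

(** * Bounded submodels *)

Section TiltAnalysis.
Variable R : realType.
Implicit Types a t f h m : R.

(* A bounded reparametrization of the line with derivative 1 at 0: the factor
   1 + damp t * f is positive for all t as soon as |f| <= 1/2. *)
Definition damp t : R := t / (1 + t ^+ 2).

Lemma damp_den_gt0 t : 0 < 1 + t ^+ 2.
Proof. by rewrite ltr_wpDr ?sqr_ge0. Qed.

Lemma dampK t : damp t * (1 + t ^+ 2) = t.
Proof. by rewrite /damp divfK// gt_eqF// damp_den_gt0. Qed.

Lemma damp_bound t : `|damp t| <= 2^-1.
Proof.
have d0 := damp_den_gt0 t.
rewrite /damp normrM normfV (gtr0_norm d0) ler_pdivrMr// ler_norml.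
have h1 := sqr_ge0 (t - 1); have h2 := sqr_ge0 (t + 1).
by apply/andP; split; lra.
Qed.

Lemma damp_le t : `|damp t| <= `|t|.
Proof.
have d0 := damp_den_gt0 t.
rewrite /damp normrM normfV (gtr0_norm d0) ler_pdivrMr//.
by rewrite ler_peMr// lerDl sqr_ge0.
Qed.

Lemma damp_near t : `|t| <= 1 -> `|damp t - t| <= t ^+ 2.
Proof.
move=> t1; have d0 := damp_den_gt0 t.
have -> : damp t - t = - (damp t * t ^+ 2).
  by rewrite -{2}(dampK t); ring.
rewrite normrN normrM (ger0_norm (sqr_ge0 t)) -[leRHS]mul1r ler_wpM2r ?sqr_ge0//.
exact: le_trans (damp_le t) t1.
Qed.

Lemma damp0 : damp 0 = 0. Proof. by rewrite /damp mul0r. Qed.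

Lemma onePM_bounds a f : `|a| <= 2^-1 -> `|f| <= 2^-1 ->
  3 / 4 <= 1 + a * f <= 5 / 4.
Proof.
move=> a1 f1; have af : `|a * f| <= 4^-1.
  rewrite normrM (le_trans (ler_pM _ _ a1 f1))//. lra.
by move: af; rewrite ler_norml => /andP[? ?]; apply/andP; split; lra.
Qed.

(** Ratio of the perturbed joint density to the original one: [f] perturbs [g], [h] perturbs [eta],
    and [m], the conditional mean of [f], accounts for the change of the normalising constant. *)
Definition tilt_ratio a f h m : R := (1 + a * f) * (1 + a * h) / (1 + a * m).

Lemma tilt_ratio_gt0 a f h m : `|a| <= 2^-1 -> `|f| <= 2^-1 -> `|h| <= 2^-1 ->
  `|m| <= 2^-1 -> 0 < tilt_ratio a f h m.
Proof.
move=> a1 f1 h1 m1.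
have /andP[? _] := onePM_bounds a1 f1; have /andP[? _] := onePM_bounds a1 h1.
have /andP[? _] := onePM_bounds a1 m1.
by rewrite /tilt_ratio divr_gt0 ?mulr_gt0//; lra.
Qed.

(** Squares are compared: w^2 - e^2 is of order a^2, where e = 1 + a L / 2, and w + e is bounded
    below. The 6 is 5 for this error plus 1 for replacing [damp t] by t; being uniform in f, h, m,
    it yields mean-square differentiability by plain integration. *)
Lemma sqrt_tilt_ratio_expansion t f h m : `|t| <= 1 ->
  `|f| <= 2^-1 -> `|h| <= 2^-1 -> `|m| <= 2^-1 ->
  `|Num.sqrt (tilt_ratio (damp t) f h m) - 1 - 2^-1 * (t * (f + h - m))| <= 6 * t ^+ 2.
Proof.
move=> t1 f1 h1 m1; have a1 := damp_bound t; have at_ := damp_le t.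
have near_t := damp_near t1.
set a := damp t in a1 at_ near_t *; set L := f + h - m.
set rho := tilt_ratio a f h m.
have rho0 : 0 < rho by exact: tilt_ratio_gt0.
set w := Num.sqrt rho.
have w0 : 0 <= w by exact: sqrtr_ge0.
have w2 : w ^+ 2 = rho by rewrite sqr_sqrtr// ltW.
have L1 : `|L| <= 3 / 2.
  by move: f1 h1 m1; rewrite !ler_norml => /andP[? ?] /andP[? ?] /andP[? ?]; apply/andP; split; rewrite /L; lra.
have aL : `|a * L| <= 3 / 4.
  by rewrite normrM (le_trans (ler_pM _ _ a1 L1))//; lra.
have a2t : a ^+ 2 <= t ^+ 2 by rewrite -[a ^+ 2]real_normK ?num_real// -[t ^+ 2]real_normK ?num_real// lerXn2r ?nnegrE.
have /andP[am1 am2] := onePM_bounds a1 m1.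
(* The numerator is at most 2 a^2 and the divisor at least 5/8 * 3/4 = 15/32; 64/15 is below 5. *)
have key : `|w - (1 + 2^-1 * (a * L))| <= 5 * a ^+ 2.
  set e := 1 + 2^-1 * (a * L).
  have e1 : 5 / 8 <= e by move: aL; rewrite ler_norml /e => /andP[? ?]; lra.
  have we : 5 / 8 <= w + e by lra.
  have we0 : 0 < w + e by lra.
  have num : (w - e) * (w + e) * (1 + a * m) =
      a ^+ 2 * (f * h - m * L - L ^+ 2 / 4 - a * m * (L ^+ 2 / 4)).
    have -> : (w - e) * (w + e) = w ^+ 2 - e ^+ 2 by ring.
    rewrite w2 /rho /tilt_ratio mulrBl divfK; last by rewrite gt_eqF//; lra.
    by rewrite /e /L; field.
  have b1 : `|f * h| <= 4^-1 by rewrite normrM (le_trans (ler_pM _ _ f1 h1))//; lra.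
  have b2 : `|m * L| <= 3 / 4 by rewrite normrM (le_trans (ler_pM _ _ m1 L1))//; lra.
  have b3 : `|L ^+ 2 / 4| <= 9 / 16.
    have : `|L * L| <= 3 / 2 * (3 / 2) by rewrite normrM ler_pM.
    by rewrite -expr2 !ger0_norm ?divr_ge0 ?sqr_ge0//; lra.
  have am4 : `|a * m| <= 4^-1 by rewrite normrM (le_trans (ler_pM _ _ a1 m1))//; lra.
  have b4 : `|a * m * (L ^+ 2 / 4)| <= 9 / 64.
    by rewrite normrM (le_trans (ler_pM _ _ am4 b3))//; lra.
  have num_le : `|(w - e) * (w + e) * (1 + a * m)| <= 2 * a ^+ 2.
    rewrite num normrM (ger0_norm (sqr_ge0 a)) mulrC ler_wpM2r ?sqr_ge0//.
    move: b1 b2 b3 b4; rewrite !ler_norml => /andP[? ?] /andP[? ?] /andP[? ?] /andP[? ?].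
    by apply/andP; split; lra.
  move: num_le; rewrite !normrM (gtr0_norm we0) (gtr0_norm (x := 1 + a * m)); last by lra.
  move=> num_le.
  have : `|w - e| * (5 / 8 * (3 / 4)) <= `|w - e| * (w + e) * (1 + a * m).
    by rewrite -[leRHS]mulrA ler_wpM2l// ler_pM.
  by move=> /le_trans/(_ num_le); have := sqr_ge0 a; lra.
have -> : w - 1 - 2^-1 * (t * L) = (w - (1 + 2^-1 * (a * L))) + 2^-1 * ((a - t) * L).
  by ring.
apply: (le_trans (ler_normD _ _)).
have k2 : `|2^-1 * ((a - t) * L)| <= t ^+ 2.
  rewrite !normrM (gtr0_norm (x := 2^-1))//.
  have : `|a - t| * `|L| <= t ^+ 2 * (3 / 2) by rewrite ler_pM.
  have := sqr_ge0 t; lra.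
by lra.
Qed.

Lemma is_derive_damp : is_derive (0 : R) (1 : R) damp 1.
Proof.
have did : is_derive (0 : R) (1 : R) (id : R -> R) 1 by exact: is_derive_id.
have dsq := is_deriveM did did.
have dden : is_derive (0 : R) (1 : R) (cst 1 + (id : R -> R) * id) 0.
  apply: is_derive_eq.
  by rewrite add0r -[id 0 *: _]/(0 * 1) mul0r addr0.
have den0 : (cst 1 + (id : R -> R) * id) 0 != 0 by rewrite !fctE mulr0 addr0 oner_neq0.
have dinv := is_deriveV den0 dden.
rewrite (_ : damp = (id : R -> R) * (fun y => ((cst 1 + (id : R -> R) * id) y)^-1)); last first.
  by apply/funext.
apply: is_derive_eq.
have one : (cst 1 + (id : R -> R) * id) 0 = 1 by rewrite !fctE mulr0 addr0.
by rewrite !one invr1 -[0 *: _]/(0 * _) -[1%:A]/(1 * 1) mul0r mulr1 add0r.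
Qed.

Lemma is_derive_ln_onePM f : is_derive (0 : R) (1 : R) (fun t => ln (1 + damp t * f)) f.
Proof.
have dd := is_derive_damp.
have din : is_derive (0 : R) (1 : R) (cst 1 + f \*: damp) (0 + f *: 1).
  exact: is_deriveD.
have one : (cst 1 + f \*: damp) 0 = 1 :> R.
  by rewrite !fctE /= damp0 -[f *: 0]/(f * 0) mulr0 addr0.
have dln : is_derive ((cst 1 + f \*: damp) 0) (1 : R) (@ln R) 1.
  by rewrite one; apply: is_derive_eq (is_derive1_ln ltr01) _; rewrite invr1.
have := is_derive1_comp dln din.
rewrite mul1r add0r -[f *: 1]/(f * 1) mulr1.
congr (is_derive _ _ _ _); apply/funext => t /=.
by rewrite !fctE /= mulrC.
Qed.

Lemma is_derive_ln_tilt p0 f h m : 0 < p0 -> `|f| <= 2^-1 -> `|h| <= 2^-1 ->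
  `|m| <= 2^-1 ->
  is_derive (0 : R) (1 : R) (fun t => ln (p0 * tilt_ratio (damp t) f h m)) (f + h - m).
Proof.
move=> p00 f1 h1 m1.
have E : (fun t => ln (p0 * tilt_ratio (damp t) f h m)) =
    cst (ln p0) + (fun t => ln (1 + damp t * f)) + (fun t => ln (1 + damp t * h))
    - (fun t => ln (1 + damp t * m)).
  apply/funext => t; rewrite !fctE; have a1 := damp_bound t.
  have /andP[? _] := onePM_bounds a1 f1; have /andP[? _] := onePM_bounds a1 h1.
  have /andP[? _] := onePM_bounds a1 m1.
  have pf : 0 < 1 + damp t * f by lra. have ph : 0 < 1 + damp t * h by lra.
  have pm : 0 < 1 + damp t * m by lra.
  rewrite /tilt_ratio !mulrA lnM ?posrE ?invr_gt0 ?mulr_gt0//.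
  rewrite lnM ?posrE ?mulr_gt0// lnM ?posrE//.
  by rewrite lnV ?posrE.
have d1 := is_derive_ln_onePM f; have d2 := is_derive_ln_onePM h.
have d3 := is_derive_ln_onePM m.
rewrite E; apply: is_derive_eq.
by rewrite add0r.
Qed.

Lemma differentiable_coord1 (F : R -> R) (D : R) :
  is_derive (0 : R) (1 : R) F D ->
  differentiable (fun c : 'rV[R]_1 => F (c 0 0)) 0 /\
  'D_(delta_mx 0 0) (fun c : 'rV[R]_1 => F (c 0 0)) 0 = D.
Proof.
move=> dF.
have diff : differentiable (fun c : 'rV[R]_1 => F (c 0 0)) 0.
  apply: (@differentiable_comp _ _ _ _ (fun c : 'rV[R]_1 => c 0 0) F).
    exact: differentiable_coord.
  by rewrite mxE; apply/derivable1_diffP; exact: ex_derive.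
split=> //.
have := is_derive_line (delta_mx 0 0) diff.
rewrite (_ : (fun h => _) = F); last first.
  by apply/funext => h; rewrite !mxE eqxx mulr1 addr0.
by move=> H; rewrite -(@derive_val _ _ _ _ _ _ _ H) (@derive_val _ _ _ _ _ _ _ dF).
Qed.

End TiltAnalysis.

(** * Effect of a bounded perturbation on densities and masses *)

Section TiltedDensity.
Context (R : realType).

Lemma density_integrable (d : measure_display) (T : measurableType d)
    (m : {measure set T -> \bar R}) (g : T -> R) :
  is_density m g -> m.-integrable setT (EFin \o g).
Proof.
move=> [mg g0 g1]; apply/integrableP; split; first exact/measurable_EFinP.
under eq_integral do rewrite /= ger0_norm//.
by rewrite g1 ltry.
Qed.

Lemma integrableMr_half (d : measure_display) (T : measurableType d)
    (m : {measure set T -> \bar R}) (f g : T -> R) :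
  measurable_fun setT f -> (forall x, `|f x| <= 2^-1) ->
  m.-integrable setT (EFin \o g) ->
  m.-integrable setT (EFin \o (fun x => f x * g x)).
Proof.
move=> mf f1 ig; have bf : [bounded f x | x in setT].
  exists 1; split; rewrite ?num_real// => M M1 x _ /=.
  by rewrite (le_trans (f1 x))//; move: M1; lra.
have := integrableMr measurableT mf bf ig.
by apply: eq_integrable => // x _ /=; rewrite EFinM.
Qed.

Lemma is_density_tilt (d : measure_display) (T : measurableType d)
    (m : {measure set T -> \bar R}) (g f : T -> R) (a : R) :
  is_density m g -> measurable_fun setT f -> (forall x, `|f x| <= 2^-1) ->
  \int[m]_x (f x * g x) = 0 -> `|a| <= 2^-1 ->
  is_density m (fun x => g x * (1 + a * f x)).
Proof.
move=> dg mf f1 fg0 a1; have [mg g0 g1] := dg.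
have ig := density_integrable dg.
have ifg := integrableMr_half mf f1 ig.
split.
- apply: measurable_funM => //; apply: measurable_funD => //.
  exact: measurable_funM.
- move=> x; rewrite mulr_ge0//; have /andP[? _] := onePM_bounds a1 (f1 x); lra.
- have iafg : m.-integrable setT (EFin \o (fun x => a * (f x * g x))).
    have := integrableZl measurableT a ifg.
    by apply: eq_integrable => // x _ /=; rewrite EFinM.
  have E : (fun x => g x * (1 + a * f x)) = (fun x => g x + a * (f x * g x)).
    by apply/funext => x; ring.
  have it : m.-integrable setT (EFin \o (fun x => g x * (1 + a * f x))).
    rewrite E; have := integrableD measurableT ig iafg.
    by apply: eq_integrable => // x _ /=; rewrite EFinD.
  have : \int[m]_x (g x * (1 + a * f x)) = 1.
    rewrite E RintegralD// RintegralZl// fg0 mulr0 addr0.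
    exact: (congr1 fine g1).
  move=> H; transitivity ((\int[m]_x (g x * (1 + a * f x)))%:E); last by rewrite H.
  by rewrite /Rintegral fineK//; exact: integrable_fin_num.
Qed.

Context (d1 d2 : measure_display)
  (T1 : measurableType d1) (T2 : measurableType d2).
Variables (nu : {sigma_finite_measure set T1 -> \bar R}).
Variables (k : T1 * T2 -> R) (g : T1 -> R) (f : T1 -> R).
Hypotheses (mk : measurable_fun setT k) (k0 : forall z, 0 < k z).
Hypotheses (dg : is_density nu g).
Hypotheses (mf : measurable_fun setT f) (f1 : forall y, `|f y| <= 2^-1).

Let w x y := weight k g (y, x).

Let mw x : measurable_fun setT (w x).
Proof.
have mw := measurable_weight mk dg; exact: (measurableT_comp mw (measurable_pair2 x)).
Qed.

Let w0 x y : 0 <= w x y. Proof. exact: (weight_ge0 k0 dg). Qed.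

Let iw x : (mass nu k g x < +oo)%E -> nu.-integrable setT (EFin \o w x).
Proof.
move=> fin; apply/integrableP; split; first exact/measurable_EFinP.
apply: le_lt_trans fin; rewrite le_eqVlt; apply/orP; left; apply/eqP.
by apply: eq_integral => y _; rewrite /= ger0_norm// w0.
Qed.

Lemma cond_mean_half x : `|cond_mean nu k g (fun z => f z.1) x| <= 2^-1.
Proof.
rewrite /cond_mean; have [fin|] := boolP (mass nu k g x < +oo)%E; last first.
  by rewrite -leNgt leye_eq => /eqP ->; rewrite /= invr0 mulr0 normr0 invr_ge0.
have M0 : 0 < fine (mass nu k g x) by rewrite fine_gt0// fin (mass_gt0 mk k0 dg).
have ifw := integrableMr_half mf f1 (iw fin).
rewrite normrM normfV (gtr0_norm M0) ler_pdivrMr//.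
apply: (le_trans (le_normr_Rintegral measurableT ifw)).
have -> : fine (mass nu k g x) = \int[nu]_y w x y by [].
rewrite -(RintegralZl _ measurableT (iw fin)).
apply: le_Rintegral => //.
- have := integrable_abse ifw.
  by apply: eq_integrable.
- have := integrableZl measurableT 2^-1 (iw fin).
  by apply: eq_integrable => // y _ /=; rewrite EFinM.
by move=> y _; rewrite normrM (ger0_norm (w0 _ _)) ler_wpM2r// w0.
Qed.

Lemma mass_tilt_fin (a : R) x : `|a| <= 2^-1 -> (mass nu k g x < +oo)%E ->
  mass nu k (fun y => g y * (1 + a * f y)) x =
  (fine (mass nu k g x) * (1 + a * cond_mean nu k g (fun z => f z.1) x))%:E.
Proof.
move=> a1 fin.
have M0 : 0 < fine (mass nu k g x) by rewrite fine_gt0// fin (mass_gt0 mk k0 dg).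
have ifw := integrableMr_half mf f1 (iw fin).
have iafw : nu.-integrable setT (EFin \o (fun y => a * (f y * w x y))).
  have := integrableZl measurableT a ifw.
  by apply: eq_integrable => // y _ /=; rewrite EFinM.
have isum : nu.-integrable setT (EFin \o (fun y => w x y + a * (f y * w x y))).
  have := integrableD measurableT (iw fin) iafw.
  by apply: eq_integrable => // y _ /=; rewrite EFinD.
have -> : fine (mass nu k g x) * (1 + a * cond_mean nu k g (fun z => f z.1) x) =
    \int[nu]_y (w x y + a * (f y * w x y)).
  rewrite RintegralD// ?RintegralZl//; last exact: iw.
  have -> : \int[nu]_y w x y = fine (mass nu k g x) by [].
  rewrite /cond_mean -/(\int[nu]_y (f y * w x y)).
  by field; rewrite gt_eqF.
rewrite /Rintegral fineK; last exact: integrable_fin_num.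
by apply: eq_integral => y _; congr EFin; rewrite /w /weight/=; ring.
Qed.

(** The factor 1 + a f is at least 3/4. With this, [joint_density_tilt] holds at every point, those
    with the default value 0 included. *)
Lemma mass_tilt_infty (a : R) x : `|a| <= 2^-1 -> mass nu k g x = +oo%E ->
  mass nu k (fun y => g y * (1 + a * f y)) x = +oo%E.
Proof.
move=> a1 inf; apply/eqP; rewrite -leye_eq.
apply: (@le_trans _ _ ((3 / 4)%:E * mass nu k g x)%E).
  by rewrite inf gt0_muley// lte_fin divr_gt0.
have mwE : measurable_fun setT (fun y => (weight k g (y, x))%:E).
  by apply/measurable_EFinP; exact: mw.
rewrite /mass -ge0_integralZl_EFin//; last by move=> y _; rewrite lee_fin; exact: w0.
apply: ge0_le_integral => //.
- by move=> y _; rewrite -EFinM lee_fin mulr_ge0//; exact: w0.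
- exact: measurable_funeM.
- apply/measurable_EFinP; rewrite /weight.
  rewrite (_ : (fun y => _) = (fun y => w x y * (1 + a * f y))); last first.
    by apply/funext => y; rewrite /w /weight/=; ring.
  by apply: measurable_funM => //; apply: measurable_funD => //; exact: measurable_funM.
- move=> y _; rewrite -EFinM lee_fin.
  have -> : weight k (fun y => g y * (1 + a * f y)) (y, x) = (1 + a * f y) * w x y.
    by rewrite /w /weight/=; ring.
  by rewrite ler_wpM2r ?w0//; have /andP[] := onePM_bounds a1 (f1 y).
Qed.

Lemma joint_density_tilt (eta h : T2 -> R) (a : R) z : `|a| <= 2^-1 ->
  joint_density nu k (fun y => g y * (1 + a * f y)) (fun x => eta x * (1 + a * h x)) z =
  joint_density nu k g eta z *
  tilt_ratio a (f z.1) (h z.2) (cond_mean nu k g (fun z => f z.1) z.2).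
Proof.
move=> a1; rewrite /joint_density.
have [fin|] := boolP (mass nu k g z.2 < +oo)%E; last first.
  rewrite -leNgt leye_eq => /eqP inf.
  by rewrite mass_tilt_infty// inf /= invr0 !mulr0 !mul0r.
have M0 : 0 < fine (mass nu k g z.2) by rewrite fine_gt0// fin (mass_gt0 mk k0 dg).
have /andP[m1 _] := onePM_bounds a1 (cond_mean_half z.2).
rewrite mass_tilt_fin//= /tilt_ratio /weight.
have m0 : 0 < 1 + a * cond_mean nu k g (fun z => f z.1) z.2 by lra.
by field; rewrite !gt_eqF.
Qed.

End TiltedDensity.

(** * Regularity of the perturbed submodels *)

Section TiltSubmodel.
Context (R : realType) (q : nat).
Local Notation RY := (measurableTypeR R).
Local Notation RX := (q.-tuple (measurableTypeR R)).
Variables (nu : {sigma_finite_measure set RY -> \bar R})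
          (mu : {sigma_finite_measure set RX -> \bar R}).
Variable P : probability (RY * RX)%type R.
Variables (b0 : 'rV[R]_q) (g0 : RY -> R) (eta0 : RX -> R).
Hypothesis hP : has_plr_law nu mu P b0 g0 eta0.
Variables (f : RY -> R) (h : RX -> R).
Hypotheses (mf : measurable_fun setT f) (f1 : forall y, `|f y| <= 2^-1).
Hypotheses (mh : measurable_fun setT h) (h1 : forall x, `|h x| <= 2^-1).
Hypotheses (fg0 : \int[nu]_y (f y * g0 y) = 0) (heta0 : \int[mu]_x (h x * eta0 x) = 0).

Let dg := density_g hP.
Let deta := density_eta hP.
Let mk := measurable_tilt b0.
Let k0 := tilt_gt0 b0.

Definition tilt_mean (x : RX) : R := cond_mean nu (tilt b0) g0 (fun z => f z.1) x.

Definition tilt_score (z : RY * RX) : R := f z.1 + h z.2 - tilt_mean z.2.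

Lemma tilt_mean_half x : `|tilt_mean x| <= 2^-1.
Proof. exact: (cond_mean_half mk k0 dg mf f1). Qed.

Lemma measurable_tilt_mean : measurable_fun setT tilt_mean.
Proof.
exact: (measurable_cond_mean mk k0 dg (measurableT_comp mf measurable_fst)).
Qed.

Lemma measurable_tilt_score : measurable_fun setT tilt_score.
Proof.
apply: measurable_funB; last exact: (measurableT_comp measurable_tilt_mean measurable_snd).
apply: measurable_funD; first exact: (measurableT_comp mf measurable_fst).
exact: (measurableT_comp mh measurable_snd).
Qed.

Lemma tilt_score_L2 : tilt_score \in Lfun P 2%:E.
Proof.
apply: (@Lfun2_bounded _ _ _ _ _ (3 / 2)); first exact: measurable_tilt_score.
move=> z; have := f1 z.1; have := h1 z.2; have := tilt_mean_half z.2.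
rewrite /tilt_score !ler_norml => /andP[? ?] /andP[? ?] /andP[? ?].
by apply/andP; split; lra.
Qed.

Definition tilt_g (c : 'rV[R]_1) (y : RY) : R := g0 y * (1 + damp (c 0 0) * f y).
Definition tilt_eta (c : 'rV[R]_1) (x : RX) : R := eta0 x * (1 + damp (c 0 0) * h x).

Lemma tilt_g0 : tilt_g 0 = g0.
Proof. by apply/funext => y; rewrite /tilt_g mxE damp0 mul0r addr0 mulr1. Qed.

Lemma tilt_eta0 : tilt_eta 0 = eta0.
Proof. by apply/funext => y; rewrite /tilt_eta mxE damp0 mul0r addr0 mulr1. Qed.

Lemma plr_density_tilt c z : plr_density nu b0 (tilt_g c) (tilt_eta c) z =
  plr_density nu b0 g0 eta0 z *
  tilt_ratio (damp (c 0 0)) (f z.1) (h z.2) (tilt_mean z.2).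
Proof. exact: (joint_density_tilt mk k0 dg mf f1 _ _ _ (damp_bound _)). Qed.

Lemma plr_model_tilt c : plr_model nu mu b0 (tilt_g c) (tilt_eta c).
Proof.
split.
- exact: (is_density_tilt dg mf f1 fg0 (damp_bound _)).
- exact: (is_density_tilt deta mh h1 heta0 (damp_bound _)).
apply: filterS (ae_mass_fin hP) => x fin ex.
have e0 : 0 < eta0 x.
  have /andP[? _] := onePM_bounds (damp_bound (c 0 0)) (h1 x).
  by move: ex; rewrite /tilt_eta pmulr_lgt0//; lra.
have := mass_tilt_fin mk k0 dg mf f1 (damp_bound (c 0 0)) (fin e0).
by rewrite plr_normE => ->; exact: ltry.
Qed.

(** The pointwise expansion multiplied by the density, whose integral is 1. *)
Lemma tilt_qmd (c : 'rV[R]_1) : `|c 0 0| <= 1 ->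
  (\int[nu \x mu]_z ((Num.sqrt (plr_density nu b0 (tilt_g c) (tilt_eta c) z)
      - Num.sqrt (plr_density nu b0 g0 eta0 z)
      - 2^-1 * (c 0 0 * tilt_score z) * Num.sqrt (plr_density nu b0 g0 eta0 z)) ^+ 2)%:E
   <= ((6 * (c 0 0) ^+ 2) ^+ 2)%:E)%E.
Proof.
move=> c1.
have [dgc detac _] := plr_model_tilt c.
have mp0 : measurable_fun setT (plr_density nu b0 g0 eta0).
  exact: (measurable_joint_density mk k0 dg deta).
have mpc : measurable_fun setT (plr_density nu b0 (tilt_g c) (tilt_eta c)).
  exact: (measurable_joint_density mk k0 dgc detac).
have msqrt : measurable_fun setT (@Num.sqrt R).
  by apply: continuous_measurable_fun; exact: sqrt_continuous.
have p0 z : 0 <= plr_density nu b0 g0 eta0 z by exact: (joint_density_ge0 mk k0 dg deta).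
have Ip0 : (\int[nu \x mu]_z (plr_density nu b0 g0 eta0 z)%:E = 1)%E.
  by have := plr_lawE hP measurableT; rewrite probability_setT => ->.
have p0E (z : RY * RX) : setT z -> (0 <= (plr_density nu b0 g0 eta0 z)%:E)%E.
  by move=> _; rewrite lee_fin; exact: p0.
have mp0E : measurable_fun setT (EFin \o plr_density nu b0 g0 eta0).
  exact/measurable_EFinP.
rewrite -[leRHS]mule1 -Ip0 -(ge0_integralZl_EFin _ measurableT p0E mp0E (sqr_ge0 _)).
apply: ge0_le_integral => //.
- by move=> z _; rewrite lee_fin sqr_ge0.
- apply/measurable_EFinP; apply: measurable_funX; apply: measurable_funB.
    apply: measurable_funB; exact: measurableT_comp.
  apply: measurable_funM; last exact: measurableT_comp.
  apply: measurable_funM => //; apply: measurable_funM => //.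
  exact: measurable_tilt_score.
- by apply/measurable_EFinP; apply: measurable_funM => //.
move=> z _; rewrite -EFinM lee_fin plr_density_tilt sqrtrM//.
have -> : Num.sqrt (plr_density nu b0 g0 eta0 z) *
    Num.sqrt (tilt_ratio (damp (c 0 0)) (f z.1) (h z.2) (tilt_mean z.2)) -
    Num.sqrt (plr_density nu b0 g0 eta0 z) -
    2^-1 * (c 0 0 * tilt_score z) * Num.sqrt (plr_density nu b0 g0 eta0 z) =
  (Num.sqrt (tilt_ratio (damp (c 0 0)) (f z.1) (h z.2) (tilt_mean z.2)) - 1 -
    2^-1 * (c 0 0 * tilt_score z)) * Num.sqrt (plr_density nu b0 g0 eta0 z) by ring.
rewrite exprMn sqr_sqrtr// ler_wpM2r// -[leLHS]real_normK ?num_real//.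
apply: lerXn2r; [by rewrite nnegrE|by rewrite nnegrE mulr_ge0 ?sqr_ge0|].
exact: (sqrt_tilt_ratio_expansion c1 (f1 _) (h1 _) (tilt_mean_half _)).
Qed.

(** The hypothesis is nonsingularity of the 1 by 1 information matrix. *)
Lemma tilt_nuisance_submodel : L2dot P tilt_score tilt_score != 0 ->
  nuisance_submodel nu mu P b0 g0 eta0 tilt_g tilt_eta 0
    (fun z => const_mx (tilt_score z)).
Proof.
move=> info; split; [exact: plr_model_tilt|exact: tilt_g0|exact: tilt_eta0|].
have s2 := tilt_score_L2.
split.
- have := ae_joint_density_gt0 mk k0 dg deta (plr_lawE hP).
  apply: filterS => z pz.
  have E : (fun c => plr_density nu b0 (tilt_g c) (tilt_eta c) z) =
      fun c : 'rV[R]_1 => plr_density nu b0 g0 eta0 z *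
        tilt_ratio (damp (c 0 0)) (f z.1) (h z.2) (tilt_mean z.2).
    by apply/funext => c; exact: plr_density_tilt.
  have [diff der] := differentiable_coord1
    (is_derive_ln_tilt pz (f1 z.1) (h1 z.2) (tilt_mean_half z.2)).
  have pos : \forall c \near (0 : 'rV[R]_1),
      0 < plr_density nu b0 (tilt_g c) (tilt_eta c) z.
    apply: (@nearW _ (nbhs (0 : 'rV[R]_1)) (fun c => 0 <
        plr_density nu b0 (tilt_g c) (tilt_eta c) z) (nbhs_filter _)) => c.
    rewrite plr_density_tilt mulr_gt0//.
    exact: (tilt_ratio_gt0 (damp_bound _) (f1 _) (h1 _) (tilt_mean_half _)).
  split=> //.
  + by rewrite (_ : (fun c => _) = fun c : 'rV[R]_1 => ln (plr_density nu b0 g0 eta0 z *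
        tilt_ratio (damp (c 0 0)) (f z.1) (h z.2) (tilt_mean z.2))) //;
      apply/funext => c; rewrite plr_density_tilt.
  + apply/rowP => i; rewrite !mxE ord1.
    rewrite (_ : (fun c => _) = fun c : 'rV[R]_1 => ln (plr_density nu b0 g0 eta0 z *
        tilt_ratio (damp (c 0 0)) (f z.1) (h z.2) (tilt_mean z.2))).
      by rewrite der.
    by apply/funext => c; rewrite plr_density_tilt.
- move=> i; rewrite (_ : (fun z => _) = tilt_score) //.
  by apply/funext => z; rewrite mxE.
- move=> e e0.
  (* The error is 36 t^4 with t^2 <= |c|^2 <= |c| < e / 36, hence at most e |c|^2. *)
  pose del : R := Num.min 1 (e / 36).
  have del0 : 0 < del by rewrite lt_min ltr01 divr_gt0.
  apply/nbhs_norm0P; exists del => //= c cdel.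
  have c00 : `|c 0 0| <= `|c|.
    by rewrite /Num.norm/= mx_normrE (le_bigmax _ (fun ij => `|c ij.1 ij.2|) (0, 0)).
  have [cd1 cd2] : `|c| < 1 /\ `|c| < e / 36.
    by move: cdel; rewrite /= /del lt_min => /andP[].
  have c1 : `|c 0 0| <= 1 by rewrite (le_trans c00)// ltW.
  rewrite tilt_g0 tilt_eta0.
  apply: le_trans (le_trans _ (tilt_qmd c1)) _.
    rewrite le_eqVlt; apply/orP; left; apply/eqP; apply: eq_integral => z _.
    by rewrite subr0 dot_sum big_ord1 mxE.
  rewrite lee_fin subr0; set n := `|c| in c00 cd1 cd2 *; set t := c 0 0 in c00 *.
  have n0 : 0 <= n by rewrite normr_ge0.
  have t2 : t ^+ 2 <= n ^+ 2.
    by rewrite -[leLHS]real_normK ?num_real// lerXn2r ?nnegrE.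
  have n2 : n ^+ 2 <= e / 36 by rewrite (le_trans _ (ltW cd2))// expr2 ler_piMl// ltW.
  have t0 := sqr_ge0 t.
  have : t ^+ 2 * t ^+ 2 <= e / 36 * n ^+ 2 by apply: ler_pM => //; exact: le_trans t2 n2.
  have -> : (6 * t ^+ 2) ^+ 2 = 36 * (t ^+ 2 * t ^+ 2) by ring.
  have -> : e * n ^+ 2 = 36 * (e / 36 * n ^+ 2) by field.
  by rewrite ler_pM2l.
- rewrite unitmxE det_mx11 mxE unitfE.
  rewrite (_ : \int[P]_z _ = L2dot P tilt_score tilt_score)//.
  by apply: eq_Rintegral => z _; rewrite !mxE.
Qed.

End TiltSubmodel.

(** * The tangent space and the efficient score *)

Section VectorL2.
Context (R : realType) (d : measure_display) (T : measurableType d).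
Variable P : probability T R.

Lemma Lfun2_ae (f g : T -> R) : f \in Lfun P 2%:E -> measurable_fun setT g ->
  {ae P, forall z, f z = g z} -> g \in Lfun P 2%:E.
Proof.
move=> /Lfun2P[mf If] mg fg; apply/Lfun2P; split=> //.
apply: le_lt_trans If; rewrite le_eqVlt; apply/orP; left; apply/eqP.
apply: ae_eq_integral => //.
- by apply/measurable_EFinP; exact: measurable_funX.
- by apply/measurable_EFinP; exact: measurable_funX.
- by apply: filterS fg => z -> _.
Qed.

Lemma Lfun2_sum (I : eqType) (r : seq I) (u : I -> T -> R) :
  (forall i, u i \in Lfun P 2%:E) -> (fun z => \sum_(i <- r) u i z) \in Lfun P 2%:E.
Proof.
move=> u2; elim: r => [|i r IH].
  by under eq_fun do rewrite big_nil; exact: (Lfun_cst P 0 2).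
by under eq_fun do rewrite big_cons; exact: (Lfun2D (u2 i) IH).
Qed.

Lemma L2dot_suml (I : eqType) (r : seq I) (u : I -> T -> R) g :
  (forall i, u i \in Lfun P 2%:E) -> g \in Lfun P 2%:E ->
  L2dot P (fun z => \sum_(i <- r) u i z) g = \sum_(i <- r) L2dot P (u i) g.
Proof.
move=> u2 g2; elim: r => [|i r IH].
  rewrite big_nil /L2dot (@eq_Rintegral _ _ _ P _ (cst 0)).
    exact: Rintegral_probability_cst.
  by move=> z _; rewrite big_nil mul0r.
rewrite big_cons -IH -L2dotDl ?Lfun2_sum//.
by apply: eq_Rintegral => z _; rewrite big_cons.
Qed.

Variable q : nat.
Implicit Types a b : T -> 'rV[R]_q.

Lemma HinnerE a b : (forall i, (fun z => a z 0 i) \in Lfun P 2%:E) ->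
  (forall i, (fun z => b z 0 i) \in Lfun P 2%:E) ->
  Hinner P a b = \sum_i L2dot P (fun z => a z 0 i) (fun z => b z 0 i).
Proof.
move=> a2 b2; rewrite /Hinner.
have E (r : seq 'I_q) : \int[P]_z (\sum_(i <- r) (a z 0 i * b z 0 i)) =
    \sum_(i <- r) L2dot P (fun z => a z 0 i) (fun z => b z 0 i) /\
    P.-integrable setT (EFin \o (fun z => \sum_(i <- r) (a z 0 i * b z 0 i))).
  elim: r => [|i r [IH int]].
    rewrite big_nil; split.
      rewrite (@eq_Rintegral _ _ _ P _ (cst 0)); first exact: Rintegral_probability_cst.
      by move=> z _; rewrite big_nil.
    rewrite (_ : _ \o _ = cst 0%E); first exact: integrable0.
    by apply/funext => z /=; rewrite big_nil.
  have ii := L2dot_integrable (a2 i) (b2 i).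
  split.
    by rewrite big_cons -IH -RintegralD//; apply: eq_Rintegral => z _; rewrite big_cons.
  have := integrableD measurableT ii int.
  by apply: eq_integrable => // z _ /=; rewrite big_cons EFinD.
have [<- _] := E (index_enum 'I_q).
by apply: eq_Rintegral => z _; rewrite dot_sum.
Qed.

Section OneVariable.
Context (d' : measure_display) (V : measurableType d') (W : T -> V).
Hypothesis mW : measurable_fun setT W.

Lemma is_condexp_mean f h : is_condexp P W f h -> \int[P]_z h (W z) = \int[P]_z f z.
Proof. by move=> [_ _ _ /(_ setT measurableT)]; rewrite preimage_setT. Qed.

Lemma is_condexp_id f h : is_condexp P W f h -> is_condexp P W (h \o W) h.
Proof. by case=> f1 mh h1 _; split. Qed.

(** The difference of the versions is a version of E(0 | W); tested against itself, it has norm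
    0. *)
Lemma condexp_unique f h h' : is_condexp P W f h -> is_condexp P W f h' ->
  {ae P, forall z, h (W z) = h' (W z)}.
Proof.
move=> fh fh'; have fhh := is_condexpB mW fh fh'.
have f02 : (fun z => f z - f z) \in Lfun P 2%:E.
  under eq_fun do rewrite subrr.
  exact: (Lfun_cst P 0 2).
have hh2 := condexp_L2 mW f02 fhh; have [_ mhh _ _] := fhh.
have hh0 : L2dot P ((fun v => h v - h' v) \o W) ((fun v => h v - h' v) \o W) = 0.
  rewrite -(condexp_dot mW fhh mhh (L2dot_integrable f02 hh2) (L2dot_integrable hh2 hh2)).
  rewrite /L2dot (@eq_Rintegral _ _ _ P _ (cst 0)); first exact: Rintegral_probability_cst.
  by move=> z _; rewrite subrr mul0r.
have := L2dot_eq0 hh2 hh0; apply: filterS => z /= /eqP.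
by rewrite subr_eq0 => /eqP.
Qed.

Lemma is_condexp_resid0 f h : is_condexp P W f h ->
  is_condexp P W (fun z => f z - h (W z)) (cst 0).
Proof.
move=> fh; have := is_condexpB mW fh (is_condexp_id fh).
by congr (is_condexp _ _ _ _); apply/funext => v; rewrite subrr.
Qed.

End OneVariable.
End VectorL2.

(** Here [c] is the mean of the indicator. It lies in [0, 1], so the factor 1/2 gives the bound that
    the perturbed submodels require. *)
Lemma centered_indic (R : realType) (d : measure_display) (T : measurableType d)
    (m : {measure set T -> \bar R}) (g : T -> R) (A : set T) :
  is_density m g -> measurable A ->
  exists c : R, let phi x := 2^-1 * (\1_A x - c) in
    [/\ measurable_fun setT phi, forall x, `|phi x| <= 2^-1 &
        \int[m]_x (phi x * g x) = 0].
Proof.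
move=> dg mA; have [mg gge0 gint1] := dg; have ig := density_integrable dg.
have Ig : \int[m]_x g x = 1 by exact: (congr1 fine gint1).
pose c := \int[m]_x (\1_A x * g x); exists c => phi.
have mI : measurable_fun setT (\1_A : T -> R) by exact: measurable_indic.
have I01 x : 0 <= (\1_A x : R) <= 1.
  by rewrite indicE; case: (x \in A); rewrite /= ?lexx ?ler01.
have iIg : m.-integrable setT (EFin \o (fun x => \1_A x * g x)).
  apply: le_integrable ig => //.
    by apply/measurable_EFinP; exact: measurable_funM.
  move=> x _ /=; rewrite lee_fin normrM (ger0_norm (gge0 x)) ler_piMl//.
  by have /andP[? ?] := I01 x; rewrite ger0_norm.
have c01 : 0 <= c <= 1.
  apply/andP; split.
    by apply: Rintegral_ge0 => x _; rewrite mulr_ge0//; have /andP[] := I01 x.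
  rewrite -Ig; apply: (le_Rintegral measurableT iIg ig) => x _.
  by have /andP[_ ?] := I01 x; rewrite ler_piMl.
split.
- by apply: measurable_funM => //; exact: measurable_funB.
- move=> x; have /andP[? ?] := I01 x; have /andP[? ?] := c01.
  by rewrite /phi ler_norml; apply/andP; split; lra.
- have icg : m.-integrable setT (EFin \o (fun x => c * g x)).
    have := integrableZl measurableT c ig.
    by apply: eq_integrable => // x _ /=; rewrite EFinM.
  have id : m.-integrable setT (EFin \o (fun x => \1_A x * g x - c * g x)).
    exact: integrableB_EFin.
  rewrite (_ : (fun x => _) = (fun x => 2^-1 * (\1_A x * g x - c * g x))); last first.
    by apply/funext => x; rewrite /phi; ring.
  by rewrite RintegralZl// RintegralB// RintegralZl// Ig -/c; ring.
Qed.

(** * The orthocomplement of the nuisance tangent space *)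

Section TangentSpace.
Context (R : realType) (q : nat).
Local Notation RY := (measurableTypeR R).
Local Notation RX := (q.-tuple (measurableTypeR R)).
Variables (nu : {sigma_finite_measure set RY -> \bar R})
          (mu : {sigma_finite_measure set RX -> \bar R}).
Variable P : probability (RY * RX)%type R.
Variables (b0 : 'rV[R]_q) (g0 : RY -> R) (eta0 : RX -> R).
Hypothesis hP : has_plr_law nu mu P b0 g0 eta0.

Let Tan := nuisance_tangent_space nu mu P b0 g0 eta0.

(* Membership of one component in the orthocomplement of the nuisance tangent
   space. *)
Definition uncorrelated (F : RY * RX -> R) : Prop :=
  is_condexp P fst F (cst 0) /\ is_condexp P snd F (cst 0).

Lemma uncorrelated_Horth (F : RY * RX -> 'rV[R]_q) :
  (forall i, (fun z => F z 0 i) \in Lfun P 2%:E) ->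
  (forall i, uncorrelated (fun z => F z 0 i)) -> Horth P Tan F.
Proof.
move=> F2 F0; split=> [i|b [Hb approx]].
  by split=> //; have /is_condexp_mean <- := (F0 i).2; rewrite Rintegral_probability_cst.
have b2 i : (fun z => b z 0 i) \in Lfun P 2%:E by case: (Hb i).
rewrite HinnerE// big1// => i _.
have [F1 F2'] := F0 i.
have orth_score a : nuisance_scores nu mu P b0 g0 eta0 a ->
    (forall i, (fun z => a z 0 i) \in Lfun P 2%:E) /\
    L2dot P (fun z => F z 0 i) (fun z => a z 0 i) = 0.
  move=> [r [g [eta [c0 [S [C [sub ->]]]]]]].
  have S2 j : (fun z => S z 0 j) \in Lfun P 2%:E by case: sub => _ _ _ [].
  have E i' : (fun z => (S z *m C^T) 0 i') = (fun z => \sum_j (C i' j * S z 0 j)).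
    by apply/funext => z; rewrite mxE; apply: eq_bigr => j _; rewrite mxE mulrC.
  split=> [i'|]; first by rewrite E; apply: Lfun2_sum => j; exact: Lfun2Z.
  rewrite E L2dotC L2dot_suml//; last by move=> j; exact: Lfun2Z.
  rewrite big1// => j _; rewrite L2dotZl// L2dotC.
  by rewrite (nuisance_score_orth hP j sub (F2 i) F1 F2') mulr0.
(* Passage to the closure: subtracting a nearby score from [b] leaves the product with [F]
   unchanged, so Cauchy-Schwarz bounds its square by every e > 0. *)
apply/eqP; rewrite -sqrf_eq0 eq_le sqr_ge0 andbT.
apply/ler_addgt0Pr => e e0; rewrite add0r.
pose C := L2dot P (fun z => F z 0 i) (fun z => F z 0 i) + 1.
have C0 : 0 < C by rewrite ltr_wpDl// L2dot_ge0.
have [a Sa] := approx (e / C) (divr_gt0 e0 C0).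
have [a2 Fa] := orth_score _ Sa.
have ba2 i' : (fun z => (b - a) z 0 i') \in Lfun P 2%:E.
  rewrite (_ : (fun z => _) = fun z => b z 0 i' - a z 0 i'); first exact: Lfun2B.
  by apply/funext => z; rewrite !fctE !mxE.
rewrite HinnerE// => dist.
have di : L2dot P (fun z => (b - a) z 0 i) (fun z => (b - a) z 0 i) <= e / C.
  apply: le_trans (ltW dist).
  rewrite (bigD1 i)//= lerDl; apply: sumr_ge0 => j _; exact: L2dot_ge0.
have -> : L2dot P (fun z => F z 0 i) (fun z => b z 0 i) =
    L2dot P (fun z => F z 0 i) (fun z => (b - a) z 0 i).
  rewrite (_ : (fun z => (b - a) z 0 i) = fun z => b z 0 i - a z 0 i).
    by rewrite L2dotBr// Fa subr0.
  by apply/funext => z; rewrite !fctE !mxE.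
apply: le_trans (L2dot_CS (F2 i) (ba2 i)) _.
apply: (@le_trans _ _ (C * (e / C))); last by rewrite mulrCA divff ?mulr1// gt_eqF.
by apply: ler_pM; rewrite ?L2dot_ge0// lerDl.
Qed.

Section TiltScoresAreTangent.
Variables (f : RY -> R) (h : RX -> R).
Hypotheses (mf : measurable_fun setT f) (f1 : forall y, `|f y| <= 2^-1).
Hypotheses (mh : measurable_fun setT h) (h1 : forall x, `|h x| <= 2^-1).
Hypotheses (fg0 : \int[nu]_y (f y * g0 y) = 0) (heta0 : \int[mu]_x (h x * eta0 x) = 0).
Let mk := measurable_tilt b0.
Let k0 := tilt_gt0 b0.
Let dg := density_g hP.
Let deta := density_eta hP.
Let s := tilt_score nu b0 g0 f h.

Let s2 : s \in Lfun P 2%:E.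
Proof. exact: (tilt_score_L2 hP). Qed.

Let mfst : measurable_fun setT (fun z : RY * RX => f z.1).
Proof. exact: (measurableT_comp mf measurable_fst). Qed.

Let f2 : (fun z : RY * RX => f z.1) \in Lfun P 2%:E.
Proof. by apply: (@Lfun2_bounded _ _ _ _ _ 2^-1) => // z; exact: f1. Qed.

Let m2 : (fun z : RY * RX => tilt_mean nu b0 g0 f z.2) \in Lfun P 2%:E.
Proof.
apply: (@Lfun2_bounded _ _ _ _ _ 2^-1).
  exact: (measurableT_comp (measurable_tilt_mean hP mf) measurable_snd).
by move=> z; exact: (tilt_mean_half hP).
Qed.

Let h2 : (fun z : RY * RX => h z.2) \in Lfun P 2%:E.
Proof.
apply: (@Lfun2_bounded _ _ _ _ _ 2^-1) => //.
exact: (measurableT_comp mh measurable_snd).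
Qed.

Let int1 (F : RY * RX -> R) : F \in Lfun P 2%:E -> P.-integrable setT (EFin \o F).
Proof. by move=> F2; apply/Lfun1P; exact: Lfun12. Qed.

Let s_mean : \int[P]_z s z = 0.
Proof.
have E : s = (fun z => (f z.1 + h z.2) - tilt_mean nu b0 g0 f z.2) by [].
rewrite E RintegralB//; [|exact: int1 (Lfun2D f2 h2)|exact: int1 m2].
rewrite RintegralD//; [|exact: int1 f2|exact: int1 h2].
have cm := is_condexp_snd mk k0 dg deta (ae_mass_fin hP) (plr_lawE hP) (Lfun12 f2).
have /is_condexp_mean := cm; rewrite -/(tilt_mean nu b0 g0 f) => ->.
have ih : mu.-integrable setT (EFin \o (fun x => h x * eta0 x)).
  exact: (integrableMr_half mh h1 (density_integrable deta)).
have [_ ->] := integrable_snd mk k0 dg deta (ae_mass_fin hP) (plr_lawE hP) mh ih.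
by rewrite heta0 addr0 subrr.
Qed.

Lemma Horth_tilt_score (b : RY * RX -> 'rV[R]_q) (i : 'I_q) :
  Horth P Tan b -> L2dot P (fun z => b z 0 i) s = 0.
Proof.
move=> [Hb orth].
have b2 j : (fun z => b z 0 j) \in Lfun P 2%:E by case: (Hb j).
(* A null score has singular information and gives no submodel, but every product with it is 0. *)
have [s0|s0] := eqVneq (L2dot P s s) 0.
  have := L2dot_CS (b2 i) s2; rewrite s0 mulr0 => H.
  by apply/eqP; rewrite -sqrf_eq0 eq_le H sqr_ge0.
(* The constant matrix is a unit column: it puts the scalar score in coordinate i, which isolates
   that component of [b]. *)
pose a z : 'rV[R]_q := const_mx (s z) *m (delta_mx i 0 : 'M[R]_(q, 1))^T.
have aE j : (fun z => a z 0 j) = (fun z => (j == i)%:R * s z).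
  apply/funext => z; rewrite /a mxE big_ord1 !mxE eqxx andbT.
  by rewrite mulrC.
have a2 j : (fun z => a z 0 j) \in Lfun P 2%:E by rewrite aE; exact: Lfun2Z.
have Sa : nuisance_scores nu mu P b0 g0 eta0 a.
  exists 1%N, (tilt_g g0 f), (tilt_eta eta0 h), 0, (fun z => const_mx (s z)), (delta_mx i 0).
  by split=> //; exact: (tilt_nuisance_submodel hP).
have Ta : Tan a.
  split=> [j|e e0].
    split=> //; rewrite aE RintegralZl//; last exact: int1 s2.
    by rewrite s_mean mulr0.
  exists a => //; rewrite subrr HinnerE; last 2 first.
  - by move=> j; rewrite (_ : (fun z => _) = cst 0); [exact: Lfun_cst|apply/funext => z; rewrite mxE].
  - by move=> j; rewrite (_ : (fun z => _) = cst 0); [exact: Lfun_cst|apply/funext => z; rewrite mxE].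
  rewrite big1// => j _; rewrite /L2dot (@eq_Rintegral _ _ _ P _ (cst 0)).
    exact: Rintegral_probability_cst.
  by move=> z _; rewrite mxE mul0r.
have := orth a Ta; rewrite HinnerE// (bigD1 i)//= big1; last first.
  move=> j ji; rewrite aE (negPf ji) L2dotC L2dotZl ?b2// mul0r//.
rewrite addr0 aE eqxx => <-; apply: eq_Rintegral => z _; by rewrite mul1r.
Qed.

End TiltScoresAreTangent.

(** The order matters. Perturbing [eta] alone gives scores that are centred indicators of X, which
    settles conditioning on X. Perturbing [g] alone gives phi(Y) - E(phi(Y) | X), and the second
    term is then already known to be orthogonal to [b]. *)
Lemma Horth_uncorrelated (b : RY * RX -> 'rV[R]_q) (i : 'I_q) :
  Horth P Tan b -> uncorrelated (fun z => b z 0 i).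
Proof.
move=> Hb; have [HH _] := Hb; have [b2 bmean] := HH i.
have ib : P.-integrable setT (EFin \o (fun z => b z 0 i)) by apply/Lfun1P; exact: Lfun12.
have z1 (T : Type) (x : T) : `|(cst 0 : T -> R) x| <= 2^-1 by rewrite normr0 invr_ge0.
have mc0 (d : measure_display) (T : measurableType d) :
  measurable_fun setT (cst 0 : T -> R) by exact: measurable_cst.
have m0 x : tilt_mean nu b0 g0 (cst 0) x = 0.
  rewrite /tilt_mean /cond_mean (@eq_Rintegral _ _ _ nu _ (cst 0)).
    by rewrite /Rintegral integral0 mul0r.
  by move=> y _; rewrite mul0r.
have Z0 (d : measure_display) (T : measurableType d) (m : {measure set T -> \bar R}) (g : T -> R) :
    \int[m]_x ((cst 0 : T -> R) x * g x) = 0.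
  rewrite (@eq_Rintegral _ _ _ m _ (cst 0)); first by rewrite /Rintegral integral0.
  by move=> y _; rewrite mul0r.
have dot_center (W : RY * RX -> R) c : measurable_fun setT W -> (forall z, `|W z| <= 1) ->
    L2dot P (fun z => b z 0 i) (fun z => 2^-1 * (W z - c)) =
    2^-1 * L2dot P (fun z => b z 0 i) W.
  move=> mW W1; have W2 : W \in Lfun P 2%:E by exact: (@Lfun2_bounded _ _ _ P _ 1).
  have c2 : cst c \in Lfun P 2%:E by exact: Lfun_cst.
  rewrite L2dotC L2dotZl//; last exact: (Lfun2B W2 c2).
  rewrite (L2dotBl W2 c2 b2) L2dotC; congr (_ * _).
  have -> : L2dot P (cst c) (fun z => b z 0 i) = 0.
    by rewrite /L2dot RintegralZl// bmean mulr0.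
  by rewrite subr0.
have I1 (T : Type) (A : set T) (x : T) : `|\1_A x : R| <= 1.
  by rewrite indicE; case: (x \in A); rewrite ?normr1// normr0.
have Xorth : is_condexp P snd (fun z => b z 0 i) (cst 0).
  apply: condexp0P => // A mA.
  have [c [mphi phi1 phi0]] := centered_indic (density_eta hP) mA.
  have := Horth_tilt_score (mc0 _ RY) (z1 _) mphi phi1 (Z0 _ _ nu g0) phi0 i Hb.
  have mI : measurable_fun setT (\1_A : RX -> R) by exact: measurable_indic.
  rewrite (_ : tilt_score _ _ _ _ _ = (fun z => 2^-1 * (\1_A z.2 - c))); last first.
    by apply/funext => z; rewrite /tilt_score m0 /= add0r subr0.
  rewrite dot_center//; last exact: (measurableT_comp mI measurable_snd).
  by move=> /eqP; rewrite mulf_eq0 invr_eq0 pnatr_eq0/= dot_indic// => /eqP.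
split=> //; apply: condexp0P => // A mA.
have [c [mphi phi1 phi0]] := centered_indic (density_g hP) mA.
have mI : measurable_fun setT (\1_A : RY -> R) by exact: measurable_indic.
pose phi (y : RY) : R := 2^-1 * (\1_A y - c).
have : L2dot P (fun z => b z 0 i) (tilt_score nu b0 g0 phi (cst 0)) = 0.
  exact: (Horth_tilt_score mphi phi1 (mc0 _ RX) (z1 _) phi0 (Z0 _ _ mu eta0) i Hb).
have phi2 : (fun z : RY * RX => phi z.1) \in Lfun P 2%:E.
  apply: (@Lfun2_bounded _ _ _ _ _ 2^-1); last by move=> z; exact: phi1.
  exact: (measurableT_comp mphi measurable_fst).
have mm := measurable_tilt_mean hP mphi.
have m2 : (fun z : RY * RX => tilt_mean nu b0 g0 phi z.2) \in Lfun P 2%:E.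
  apply: (@Lfun2_bounded _ _ _ _ _ 2^-1).
    exact: (measurableT_comp mm measurable_snd).
  by move=> z; exact: (tilt_mean_half hP).
have -> : tilt_score nu b0 g0 phi (cst 0) = (fun z => phi z.1 - tilt_mean nu b0 g0 phi z.2).
  by apply/funext => z; rewrite /tilt_score addr0.
rewrite L2dotBr// (condexp0_dot measurable_snd b2 Xorth mm m2) subr0.
rewrite dot_center//; last exact: (measurableT_comp mI measurable_fst).
by move=> /eqP; rewrite mulf_eq0 invr_eq0 pnatr_eq0/= dot_indic// => /eqP.
Qed.

End TangentSpace.

Lemma cvgn_sum (R : realType) (I : Type) (r : seq I) (u : I -> nat -> R) (l : I -> R) :
  (forall i, u i n @[n --> \oo] --> l i) ->
  (\sum_(i <- r) u i n) @[n --> \oo] --> \sum_(i <- r) l i.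
Proof.
move=> ul; elim: r => [|i r IH].
  by rewrite big_nil; under eq_fun do rewrite big_nil; exact: cvg_cst.
by rewrite big_cons; under eq_fun do rewrite big_cons; exact: cvgD.
Qed.

(** * Assembly of the expansion *)

Section EfficientScore.
Context (R : realType) (q : nat).
Local Notation RY := (measurableTypeR R).
Local Notation RX := (q.-tuple (measurableTypeR R)).
Variables (nu : {sigma_finite_measure set RY -> \bar R})
          (mu : {sigma_finite_measure set RX -> \bar R}).
Variable P : probability (RY * RX)%type R.
Variables (b0 : 'rV[R]_q) (g0 : RY -> R) (eta0 : RX -> R).
Variable Sb : RY * RX -> 'rV[R]_q.
Hypothesis hP : has_plr_law nu mu P b0 g0 eta0.
Hypothesis hS : is_beta_score nu mu P b0 g0 eta0 Sb.
Hypothesis hXY : forall i : 'I_q, (fun z => @XY R q z 0 i) \in Lfun P 1.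

Let EY := condexp P (@fst RY RX).
Let EX := condexp P (@snd RY RX).
Let mfst := @measurable_fst _ _ RY RX.
Let msnd := @measurable_snd _ _ RY RX.
Let projX : L2projector P EX := L2projector_condexp P msnd.
Let projY : L2projector P EY := L2projector_condexp P mfst.

Let xy (i : 'I_q) (z : RY * RX) : R := XY z 0 i.
Let s (i : 'I_q) z := xy i z - EX (xy i) z.
Let k (i : 'I_q) (n : nat) (z : RY * RX) := iter n (@opB R q P) (opK P (@XY R q)) z 0 i.

Let Sb2 i : (fun z => Sb z 0 i) \in Lfun P 2%:E.
Proof. by case: hS. Qed.

Let measurable_s i : measurable_fun setT (s i).
Proof.
have [h [_ mh _ _] E] := condexpP msnd (hXY i).
rewrite /s /EX E; apply: measurable_funB; first exact: Lfun_measurable (hXY i).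
exact: measurableT_comp.
Qed.

Let Sb_s i : {ae P, forall z, Sb z 0 i = s i z}.
Proof.
have [h xyh E] := condexpP msnd (hXY i).
have xym := is_condexp_snd (measurable_tilt b0) (tilt_gt0 b0) (density_g hP)
  (density_eta hP) (ae_mass_fin hP) (plr_lawE hP) (hXY i).
apply: filterS2 (beta_scoreE hP hS (hXY i)) (condexp_unique msnd xyh xym) => z -> hm.
by rewrite /s /EX E /= hm.
Qed.

(** Square integrability is inherited from the score, since [XY] itself is only known to be
    integrable. *)
Let s2 i : s i \in Lfun P 2%:E.
Proof. exact: Lfun2_ae (Sb2 i) (measurable_s i) (Sb_s i). Qed.

Let s_X0 i : is_condexp P snd (s i) (cst 0).
Proof.
by have [h xyh E] := condexpP msnd (hXY i); rewrite /s /EX E; exact: is_condexp_resid0.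
Qed.

Let kS i n : k i n.+1 = EY (EX (k i n)).
Proof.
apply/funext => z; rewrite /k iterS /opB /condY /condX /vcondexp mxE.
congr (condexp _ _ _ _); apply/funext => z'; rewrite mxE.
by [].
Qed.

Let k0E i : k i 0%N = fun z => EY (xy i) z - EY (EX (xy i)) z.
Proof.
apply/funext => z; rewrite /k /= /opK /condY /condX /vcondexp !fctE !mxE.
congr (_ - condexp _ _ _ _); apply/funext => z'; by rewrite mxE.
Qed.

(** Linearity of conditional expectations of integrable functions makes K(XY) a version of E(s | Y);
    from there on only functions in L2 occur. *)
Let k0_version i : exists2 h, is_condexp P fst (s i) h & k i 0%N = h \o fst.
Proof.
have [h xyh E] := condexpP msnd (hXY i).
have [_ _ h1 _] := xyh.
have [h' xyh' E'] := condexpP mfst (hXY i).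
have EX1 : EX (xy i) \in Lfun P 1 by rewrite /EX E.
have [h'' xyh'' E''] := condexpP mfst EX1.
exists (fun y => h' y - h'' y); first exact: (is_condexpB mfst xyh' xyh'').
by rewrite k0E /EY E' E''.
Qed.

Let k02 i : k i 0%N \in Lfun P 2%:E.
Proof. by have [h sh ->] := k0_version i; exact: (condexp_L2 mfst (s2 i) sh). Qed.

Let k0Y i g : g \in Lfun P 2%:E -> L2dot P (k i 0%N) g = L2dot P (s i) (EY g).
Proof.
move=> g2; have [h sh ->] := k0_version i.
by have [<- <-] := condexp_L2dot mfst (s2 i) sh g2.
Qed.

Let sX i g : g \in Lfun P 2%:E -> L2dot P (s i) (EX g) = 0.
Proof. by move=> g2; exact: (condexp0_dot_condexp msnd (s2 i) (s_X0 i) g2). Qed.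

Let k2 i n : k i n \in Lfun P 2%:E.
Proof.
elim: n => [|n IH]; first exact: k02.
by rewrite kS; exact/(L2projector_L2 projY)/(L2projector_L2 projX).
Qed.

Let mean_s i : \int[P]_z s i z = 0.
Proof. by have /is_condexp_mean <- := s_X0 i; rewrite Rintegral_probability_cst. Qed.

Let int1 (F : RY * RX -> R) : F \in Lfun P 2%:E -> P.-integrable setT (EFin \o F).
Proof. by move=> F2; apply/Lfun1P; exact: Lfun12. Qed.

Let termE n i : (fun z => series_term P n z 0 i) = fun z => k i n z - EX (k i n) z.
Proof. by apply/funext => z; rewrite /series_term !fctE !mxE. Qed.

Let term_H n : Hspace P (series_term P n).
Proof.
move=> i; rewrite termE; have Xk2 := L2projector_L2 projX (k2 i n).
split; first exact: Lfun2B (k2 i n) Xk2.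
rewrite RintegralB//; [|exact: int1|exact: int1].
have [h kh E] := condexpP msnd (Lfun12 (k2 i n)).
by rewrite /EX E; have /= -> := is_condexp_mean kh; rewrite subrr.
Qed.

Let ae_dot (u v w : RY * RX -> R) : u \in Lfun P 2%:E -> v \in Lfun P 2%:E ->
  w \in Lfun P 2%:E -> {ae P, forall z, u z = v z} -> L2dot P u w = L2dot P v w.
Proof.
move=> u2 v2 w2; apply: L2dot_ae; [exact: Lfun_measurable u2
  |exact: Lfun_measurable v2|exact: Lfun_measurable w2].
Qed.

Let subE (u v : RY * RX -> 'rV[R]_q) i :
  (fun z => (u - v) z 0 i) = fun z => u z 0 i - v z 0 i.
Proof. by apply/funext => z; rewrite !fctE !mxE. Qed.

Lemma efficient_score_expansion :
  exists T : RY * RX -> 'rV[R]_q,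
    let F := @XY R q - condX P (@XY R q) - T in
    [/\ is_Hsum P (series_term P) T,
        is_efficient_score nu mu P b0 g0 eta0 Sb F &
        forall Seff : RY * RX -> 'rV[R]_q,
          is_efficient_score nu mu P b0 g0 eta0 Sb Seff ->
          Seff = F %[ae P]].
Proof.
have alt i := alternating_projections projX projY (s2 i) (@sX i) (k02 i) (@k0Y i)
  (kS i) (a := fun n z => s i z - \sum_(0 <= j < n) (k i j z - EX (k i j) z))
  (fun n z => erefl).
(* Orthogonality to the ranges of the projections becomes vanishing of conditional expectations, the
   form in which the orthocomplement of the tangent space is described. *)
have altT i : exists t : RY * RX -> R, [/\ t \in Lfun P 2%:E,
    (fun n => L2dot P
       (fun z => \sum_(0 <= j < n) (k i j z - EX (k i j) z) - t z)
       (fun z => \sum_(0 <= j < n) (k i j z - EX (k i j) z) - t z)) @ \oo --> (0 : R),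
    uncorrelated P (fun z => s i z - t z) &
    forall b, b \in Lfun P 2%:E -> uncorrelated P b -> L2dot P t b = 0].
  have [t t2 [cv FX FY tb]] := alt i; exists t; split=> //.
    split; [apply: (dot_condexp0 mfst)|apply: (dot_condexp0 msnd)] => //; exact: Lfun2B.
  move=> b b2 [bY bX]; apply: tb => // g g2.
    exact: (condexp0_dot_condexp msnd b2 bX g2).
  exact: (condexp0_dot_condexp mfst b2 bY g2).
have [t tP] := choice altT.
pose T (z : RY * RX) : 'rV[R]_q := \row_i t i z.
have TE i : (fun z => T z 0 i) = t i by apply/funext => z; rewrite mxE.
have t2 i : t i \in Lfun P 2%:E by case: (tP i).
exists T => F.
have FE i : (fun z => F z 0 i) = fun z => s i z - t i z.
  apply/funext => z; rewrite /F (congr1 (@^~ z) (subE _ T i)) (congr1 (@^~ z) (TE i)).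
  rewrite (congr1 (@^~ z) (subE _ (condX P (@XY R q)) i)).
  by congr (_ - _ - _); rewrite /condX /vcondexp mxE.
clearbody F.
have F2 i : (fun z => F z 0 i) \in Lfun P 2%:E by rewrite FE; exact: Lfun2B.
have F0 i : uncorrelated P (fun z => F z 0 i) by rewrite FE; case: (tP i).
have FH := uncorrelated_Horth hP F2 F0.
have eff : is_efficient_score nu mu P b0 g0 eta0 Sb F.
  split=> // b Hb; have b2 i : (fun z => b z 0 i) \in Lfun P 2%:E by case: Hb => /(_ i) [].
  have D2 i : (fun z => (Sb - F) z 0 i) \in Lfun P 2%:E.
    by rewrite subE; exact: Lfun2B.
  rewrite HinnerE// big1// => i _.
  (* The i-th component of [Sb - F] is almost everywhere [t i], which is orthogonal to all such
     [b]. *)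
  have [_ _ _ tb] := tP i.
  rewrite -(tb _ (b2 i) (Horth_uncorrelated hP i Hb)); apply: ae_dot => //.
  apply: filterS (Sb_s i) => z Sz.
  rewrite (congr1 (@^~ z) (subE Sb F i)) Sz (congr1 (@^~ z) (FE i)).
  exact: subKr.
split=> //.
- split; [exact: term_H| |].
    move=> i; rewrite TE; split=> //.
    (* [t i] is centred because [s i] and [s i - t i] are. *)
    have [_ _ [_ /is_condexp_mean st0] _] := tP i.
    have := etrans (esym st0) (Rintegral_probability_cst P 0).
    rewrite RintegralB//; [|exact: int1 (s2 i)|exact: int1 (t2 i)].
    by rewrite mean_s sub0r => /eqP; rewrite oppr_eq0 => /eqP.
  have serE n i : (fun z => (series (series_term P) n - T) z 0 i) =
      fun z => \sum_(0 <= j < n) (k i j z - EX (k i j) z) - t i z.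
    apply/funext => z; rewrite /series /= !fctE !mxE; congr (_ - _).
    rewrite fct_sumE summxE; apply: eq_bigr => j _.
    exact: (congr1 (@^~ z) (termE j i)).
  have ser2 n i : (fun z => (series (series_term P) n - T) z 0 i) \in Lfun P 2%:E.
    rewrite serE; apply: Lfun2B => //; apply: Lfun2_sum => j.
    exact: Lfun2B (k2 i j) (L2projector_L2 projX (k2 i j)).
  rewrite (_ : (fun n => _) = (fun n => \sum_i L2dot P
       (fun z => \sum_(0 <= j < n) (k i j z - EX (k i j) z) - t i z)
       (fun z => \sum_(0 <= j < n) (k i j z - EX (k i j) z) - t i z))); last first.
    by apply/funext => n; rewrite HinnerE//; apply: eq_bigr => i _; rewrite serE.
  rewrite [X in _ --> X](_ : _ = \sum_(i < q) 0); last by rewrite big1.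
  apply: cvgn_sum => i.
  by case: (tP i).
move=> Seff [SH Sorth].
have S2 i : (fun z => Seff z 0 i) \in Lfun P 2%:E by case: SH => /(_ i) [].
have DE i := subE Seff F i.
have D2 i : (fun z => (Seff - F) z 0 i) \in Lfun P 2%:E by rewrite DE; exact: Lfun2B.
have D0 i : uncorrelated P (fun z => (Seff - F) z 0 i).
  have [SY SX] := Horth_uncorrelated hP i SH; have [FY FX] := F0 i.
  have z0 (V : Type) : (fun v : V => cst (0 : R) v - cst 0 v) = cst 0.
    by apply/funext => v; rewrite subrr.
  rewrite DE; split; [have := is_condexpB mfst SY FY|have := is_condexpB msnd SX FX];
  by rewrite z0.
(* [Seff - F] lies in the orthocomplement, and it is also the difference of two residuals orthogonal
   to that space; so it is orthogonal to itself. *)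
have DH := uncorrelated_Horth hP D2 D0.
have Dz i : L2dot P (fun z => (Seff - F) z 0 i) (fun z => (Seff - F) z 0 i) = 0.
  have : \sum_i L2dot P (fun z => (Seff - F) z 0 i) (fun z => (Seff - F) z 0 i) = 0.
    have SbF2 j : (fun z => (Sb - F) z 0 j) \in Lfun P 2%:E.
      by rewrite subE; exact: Lfun2B.
    have SbS2 j : (fun z => (Sb - Seff) z 0 j) \in Lfun P 2%:E.
      by rewrite subE; exact: Lfun2B.
    have := eff.2 _ DH; have := Sorth _ DH; rewrite !HinnerE// => e1 e2.
    have e3 : \sum_j (L2dot P (fun z => (Sb - F) z 0 j) (fun z => (Seff - F) z 0 j)
        - L2dot P (fun z => (Sb - Seff) z 0 j) (fun z => (Seff - F) z 0 j)) = 0.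
      by rewrite sumrB e1 e2 subrr.
    rewrite -[RHS]e3; apply: eq_bigr => j _; rewrite -L2dotBl//; apply: eq_Rintegral => z _.
    rewrite (congr1 (@^~ z) (DE j)) (congr1 (@^~ z) (subE Sb F j)).
    by rewrite (congr1 (@^~ z) (subE Sb Seff j)) /=; ring.
  move/eqP; rewrite psumr_eq0; last by move=> j _; exact: L2dot_ge0.
  by move=> /allP /(_ i); rewrite mem_index_enum => /(_ isT) /eqP.
have aeD i : {ae P, forall z, (Seff - F) z 0 i = 0} by exact: L2dot_eq0 (D2 i) (Dz i).
apply: (filterS _ (@filter_forall _ _ (fun i z => (Seff - F) z 0 i = 0) _ _ aeD)).
move=> z Dz0 _; apply/rowP => i; apply/eqP; rewrite -subr_eq0; apply/eqP.
by rewrite -[LHS](congr1 (@^~ z) (DE i)); exact: Dz0.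
Qed.

End EfficientScore.

Theorem lemma5 (R : realType) (q : nat)
  (nu : {sigma_finite_measure set (measurableTypeR R) -> \bar R})
  (mu : {sigma_finite_measure set (q.-tuple (measurableTypeR R)) -> \bar R})
  (P : probability (measurableTypeR R * q.-tuple (measurableTypeR R))%type R)
  (beta0 : 'rV[R]_q) (g0 : measurableTypeR R -> R)
  (eta0 : q.-tuple (measurableTypeR R) -> R)
  (Sbeta : measurableTypeR R * q.-tuple (measurableTypeR R) -> 'rV[R]_q)
  (hP : has_plr_law nu mu P beta0 g0 eta0)
  (hS : is_beta_score nu mu P beta0 g0 eta0 Sbeta)
  (hXY : forall i : 'I_q, (fun z => @XY R q z 0 i) \in Lfun P 1) :
  exists T : measurableTypeR R * q.-tuple (measurableTypeR R) -> 'rV[R]_q,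
    let F := @XY R q - condX P (@XY R q) - T in
    [/\ is_Hsum P (series_term P) T,
        is_efficient_score nu mu P beta0 g0 eta0 Sbeta F &
        forall Seff : measurableTypeR R * q.-tuple (measurableTypeR R) ->
                      'rV[R]_q,
          is_efficient_score nu mu P beta0 g0 eta0 Sbeta Seff ->
          Seff = F %[ae P]].
Proof. exact: (efficient_score_expansion hP hS hXY). Qed.
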